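(* Let $d\ge 1$, let $\Omega\subset\mathbb{R}^d$ be an open bounded hyperrectangle, let $\alpha>0$, and let $G$ be a grid on $\Omega$ with mesh size $h=h(G)$ and averaging operator $A_G$. For $g\in L^2(\Omega)$ let $u_g$ denote the unique minimizer over $u\in L^2(\Omega)$ of $\frac12\|u-g\|_{L^2(\Omega)}^2+\alpha J(u)$, where $J$ is the $\ell^1$-anisotropic total variation. All norms below are over $\Omega$. 1. For every $f\in L^2(\Omega)$, $$\|u_{A_Gf}-u_f\|_{L^2}\le \|A_Gf-f\|_{L^2}.$$ 2. For every $f\in L^q(\Omega)$, $2\le q\le\infty$, $$\|u_{A_Gf}-u_f\|_{L^2}^2\le 2^{1+\frac{q'}{q}}\,J(u_f)^{1-\frac{q'}{q}}\,\|u_f\|_{L^q}^{\frac{q'}{q}}\,\big(\|u_f\|_{L^q}+\|f\|_{L^q}\big)\,h^{1-\frac{q'}{q}}.$$ If in addition $d=1$, then $$\|u_{A_Gf}-u_f\|_{L^2}^2\le 2\,J(u_f)\,\big(\|u_f\|_{L^q}+\|f\|_{L^q}\big)\,h^{1-\frac1q}.$$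
   Context: $\Omega=a+\prod_{i=1}^d(0,l_i)$ with $a\in\mathbb{R}^d$, $l\in\mathbb{R}^d_{>0}$. $J:L^2(\Omega)\to[0,+\infty]$ is the $\ell^1$-anisotropic total variation $$J(u)=\sup\Big\{\int_\Omega u\,\mathrm{div}\,H\,dx : H\in C_c^\infty(\Omega,\mathbb{R}^d),\ |H(x)|_\infty\le 1\ \text{for all }x\in\Omega\Big\},$$ where $|\cdot|_\infty$ is the maximum norm. $J$ is proper, convex and lower semicontinuous, so minimizers $u_g$ exist and are unique. A grid $G$ on $\Omega$ is a finite collection of affine hyperplanes of $\mathbb{R}^d$, each orthogonal to one of the coordinate axes, with $\partial\Omega\subset\bigcup G$. It defines the partition $\mathcal{Q}(G)=\{R_1,\dots,R_n\}$ of $\Omega$ (up to a null set) into open hyperrectangles, namely the connected components of $\Omega\setminus\bigcup G$. The mesh size $h(G)$ is the greatest side length among all hyperrectangles in $\mathcal{Q}(G)$. The averaging operator is $A_Gg=\sum_{i=1}^n g_{R_i}\mathbf{1}_{R_i}$ for $g\in L^1(\Omega)$, with $g_R=\frac1{|R|}\int_R g\,dx$. $q'$ is the Hölder conjugate of $q$, $\frac1q+\frac1{q'}=1$; conventions: $\frac1q=\frac{q'}{q}=0$ for $q=\infty$. *)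

(* Defs.v *)
From HB Require Import structures.
From mathcomp Require Import all_boot all_order all_algebra.
From mathcomp Require Import all_classical all_reals all_analysis.

Set Implicit Arguments.
Unset Strict Implicit.
Unset Printing Implicit Defensive.
Import Order.TTheory GRing.Theory Num.Theory.
Import numFieldNormedType.Exports.
Local Open Scope classical_set_scope.
Local Open Scope ring_scope.

Fact rV_display : measure_display.
Proof. exact: default_measure_display. Qed.

Section measurable_rV.
Context (R : realType) (n : nat).

Let coord (i : 'I_n) (x : 'rV[R]_n) : measurableTypeR R := x ord0 i.

Let rV_set0 : g_sigma_preimage coord set0.
Proof. exact: sigma_algebra0. Qed.

Let rV_setC A : g_sigma_preimage coord A -> g_sigma_preimage coord (~` A).
Proof. exact: sigma_algebraC. Qed.

Let rV_bigcup (F : (set 'rV[R]_n)^nat) :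
  (forall i, g_sigma_preimage coord (F i)) ->
  g_sigma_preimage coord (\bigcup_i (F i)).
Proof. exact: sigma_algebra_bigcup. Qed.

(* The sigma-algebra generated by the coordinate maps; it coincides with the
   Borel sigma-algebra of R^n. *)
HB.instance Definition _ := @isMeasurable.Build rV_display 'rV[R]_n
  (g_sigma_preimage coord) rV_set0 rV_setC rV_bigcup.

End measurable_rV.

Lemma measurable_rV_coord (R : realType) n (i : 'I_n) :
  measurable_fun [set: 'rV[R]_n] (fun x => x ord0 i : measurableTypeR R).
Proof.
move=> _ Y mY; rewrite setTI; apply: sub_sigma_algebra => /=.
rewrite -bigcup_seq/=; exists i => /=; first by rewrite mem_index_enum.
by exists Y => //; rewrite setTI.
Qed.

Lemma measurable_fun_rVP (R : realType) d (T : measurableType d) n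
    (f : T -> 'rV[R]_n) :
  measurable_fun [set: T] f <->
  forall i, measurable_fun [set: T] (fun x => f x ord0 i : measurableTypeR R).
Proof.
split=> [mf i|mf].
  exact: (measurableT_comp (measurable_rV_coord i) mf).
apply: (@measurability _ _ _ _ _ _
  (\big[setU/set0]_(i < n) preimage_set_system setT
     (fun x : 'rV[R]_n => x ord0 i : measurableTypeR R) measurable)) => //.
move=> _ [B + <-]; rewrite -bigcup_seq => -[i /= _ [C mC <-]].
rewrite !setTI -[X in measurable X]setTI; exact: mf.
Qed.

Definition rV_cons (R : realType) n (p : measurableTypeR R * 'rV[R]_n) :
  'rV[R]_n.+1 := row_mx (p.1%:M : 'rV[R]_1) p.2.

Lemma rV_cons0 (R : realType) n (p : measurableTypeR R * 'rV[R]_n) :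
  rV_cons p ord0 ord0 = p.1.
Proof.
have := row_mxEl (p.1%:M : 'rV[R]_1) p.2 ord0 ord0.
by rewrite [RHS]mxE eqxx mulr1n => <-; congr (row_mx _ _ _ _); exact/val_inj.
Qed.

Lemma rV_consS (R : realType) n (p : measurableTypeR R * 'rV[R]_n) i :
  rV_cons p ord0 (lift ord0 i) = p.2 ord0 i.
Proof.
have <- := row_mxEr (p.1%:M : 'rV[R]_1) p.2 ord0 i.
by congr (row_mx _ _ _ _); exact/val_inj.
Qed.

Lemma measurable_rV_cons (R : realType) n :
  measurable_fun setT (@rV_cons R n).
Proof.
apply/measurable_fun_rVP => i.
have [->|[j ->]] : i = ord0 \/ exists j, i = lift ord0 j.
  by case: (unliftP ord0 i) => [j ->|->]; [right; exists j|left].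
- by under eq_fun do rewrite rV_cons0; exact: measurable_fst.
- under eq_fun do rewrite rV_consS.
  exact: (measurableT_comp (measurable_rV_coord j) measurable_snd).
Qed.

(* Lebesgue measure on R^n, by iterated products of the Lebesgue measure of
   the line; R^0 carries the unit mass, so that [lebesgue_rV_hyperrect] below
   holds for all n. *)
Fixpoint lebesgue_rV (R : realType) (n : nat) : set 'rV[R]_n -> \bar R :=
  match n with
  | 0 => dirac (0 : 'rV[R]_0)
  | m.+1 =>
      pushforward (lebesgue_measure \x @lebesgue_rV R m)%E (@rV_cons R m)
  end.

Section lebesgue_rV_measure.
Context (R : realType).

Let rV_uncons n (x : 'rV[R]_n.+1) : measurableTypeR R * 'rV[R]_n :=
  (x ord0 ord0, \row_i x ord0 (lift ord0 i)).

Let rV_unconsK n : cancel (@rV_uncons n) (@rV_cons R n).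
Proof.
move=> x; apply/rowP => i.
case: (unliftP ord0 i) => [j ->|->]; last by rewrite rV_cons0.
by rewrite rV_consS mxE.
Qed.

Let rV_consK n : cancel (@rV_cons R n) (@rV_uncons n).
Proof.
move=> [x y]; rewrite /rV_uncons rV_cons0; congr pair.
by apply/rowP => i; rewrite mxE rV_consS.
Qed.

Let measurable_rV_uncons n : measurable_fun setT (@rV_uncons n).
Proof.
apply/measurable_fun_pairP; split; first exact: measurable_rV_coord.
apply/measurable_fun_rVP => i /=.
under eq_fun do rewrite mxE.
exact: measurable_rV_coord.
Qed.


Let pack_sigma_finite n (nu : set 'rV[R]_n -> \bar R) :
  nu set0 = 0%E -> (forall A, 0 <= nu A)%E -> semi_sigma_additive nu ->
  sigma_finite setT nu ->
  exists m : {sigma_finite_measure set 'rV[R]_n -> \bar R}, nu = m.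
Proof.
move=> nu0 nu_ge0 nu_sigma nu_fin.
pose nuM := isMeasure.Build _ _ _ nu nu0 nu_ge0 nu_sigma.
pose nuT : {measure set 'rV[R]_n -> \bar R} := HB.pack nu nuM.
pose nuS := Measure_isSigmaFinite.Build _ _ _ nuT nu_fin.
pose nuU : {sigma_finite_measure set 'rV[R]_n -> \bar R} :=
  HB.pack nu nuM nuS.
by exists nuU.
Qed.

Let pushforward_rV_cons n
    (m1 : {sigma_finite_measure set (measurableTypeR R) -> \bar R})
    (m2 : {sigma_finite_measure set 'rV[R]_n -> \bar R}) :
  exists m : {sigma_finite_measure set 'rV[R]_n.+1 -> \bar R},
    pushforward (m1 \x m2)%E (@rV_cons R n) = m.
Proof.
pose mu := [the {measure set _ -> \bar R} of (m1 \x m2)%E].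
rewrite -[(_ \x _)%E]/(mu : set _ -> \bar R).
set nu := pushforward _ _.
apply: pack_sigma_finite.
- by rewrite /nu /pushforward preimage_set0; exact: (measure0 mu).
- by move=> A; exact: (measure_ge0 mu).
- move=> F mF tF mUF; rewrite /nu /pushforward preimage_bigcup.
  have mpre A : measurable A -> measurable (@rV_cons R n @^-1` A).
    by move=> mA; rewrite -[X in measurable X]setTI; exact: measurable_rV_cons.
  apply: measure_semi_sigma_additive.
  + by move=> k; exact: mpre.
  + apply/trivIsetP => /= i j _ _ ij; rewrite -preimage_setI.
    by move/trivIsetP : tF => /(_ _ _ _ _ ij) ->//; rewrite preimage_set0.
  + by rewrite -preimage_bigcup; exact: mpre.
- have /sigma_finiteP[F [TF ndF Foo]] := sigma_finiteT m1.
  have /sigma_finiteP[G [TG ndG Goo]] := sigma_finiteT m2.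
  exists (fun k => @rV_uncons n @^-1` (F k `*` G k)).
    rewrite -preimage_bigcup (_ : \bigcup_k _ = setT) ?preimage_setT//.
    apply/seteqP; split=> // -[x y] _.
    have [[i _ Fix] [j _ Gjy]] : (\bigcup_i F i) x /\ (\bigcup_i G i) y.
      by rewrite -TF -TG.
    exists (maxn i j) => //; split.
      by move: x Fix; exact/subsetPset/ndF/leq_maxl.
    by move: y Gjy; exact/subsetPset/ndG/leq_maxr.
  move=> k; have [mFk Fk] := Foo k; have [mGk Gk] := Goo k; split.
    rewrite -[X in measurable X]setTI; apply: measurable_rV_uncons => //.
    exact: measurableX.
  rewrite /nu /pushforward -comp_preimage (_ : _ \o _ = id); last first.
    by apply/funext => p /=; rewrite rV_consK.
  rewrite preimage_id /mu /= product_measure1E//.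
  by rewrite lte_mul_pinfty// ge0_fin_numE.
Qed.

Let lebesgue_rV_sigma_finite_measure n :
  exists m : {sigma_finite_measure set 'rV[R]_n -> \bar R},
    @lebesgue_rV R n = m.
Proof.
elim: n => [|n [m mE]] /=; first by exists (dirac (0 : 'rV[R]_0)).
by rewrite mE; exact: pushforward_rV_cons.
Qed.

Variable n : nat.

Let lebesgue_rV0 : @lebesgue_rV R n set0 = 0%E.
Proof. by have [m ->] := lebesgue_rV_sigma_finite_measure n. Qed.

Let lebesgue_rV_ge0 A : (0 <= @lebesgue_rV R n A)%E.
Proof. by have [m ->] := lebesgue_rV_sigma_finite_measure n. Qed.

Let lebesgue_rV_sigma_additive : semi_sigma_additive (@lebesgue_rV R n).
Proof.
have [m ->] := lebesgue_rV_sigma_finite_measure n.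
exact: measure_semi_sigma_additive.
Qed.

HB.instance Definition _ := isMeasure.Build _ _ _ (@lebesgue_rV R n)
  lebesgue_rV0 lebesgue_rV_ge0 lebesgue_rV_sigma_additive.

Let lebesgue_rV_sigma_finite : sigma_finite setT (@lebesgue_rV R n).
Proof.
have [m ->] := lebesgue_rV_sigma_finite_measure n; exact: sigma_finiteT.
Qed.

HB.instance Definition _ := Measure_isSigmaFinite.Build _ _ _ (@lebesgue_rV R n)
  lebesgue_rV_sigma_finite.

End lebesgue_rV_measure.

Section hyperrectangle.
Context (R : realType).

Definition hyperrect n (a l : 'rV[R]_n) : set 'rV[R]_n :=
  [set x | forall i, a ord0 i < x ord0 i < a ord0 i + l ord0 i].

Lemma measurable_hyperrect n (a l : 'rV[R]_n) : measurable (hyperrect a l).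
Proof.
rewrite (_ : hyperrect a l = \bigcap_(i in [set: 'I_n])
    ((fun x : 'rV[R]_n => x ord0 i : measurableTypeR R) @^-1`
       `]a ord0 i, a ord0 i + l ord0 i[)).
  apply: fin_bigcap_measurable => // i _; rewrite -[X in measurable X]setTI.
  by apply: measurable_rV_coord.
apply/seteqP; split=> x /=.
  by move=> H i _ /=; rewrite in_itv/= H.
by move=> H i; have := H i I; rewrite /= in_itv.
Qed.

Lemma lebesgue_rV_hyperrect n (a l : 'rV[R]_n) :
  (forall i, 0 <= l ord0 i) ->
  lebesgue_rV (hyperrect a l) = (\prod_(i < n) l ord0 i)%:E.
Proof.
elim: n a l => [|n IHn] a l l0 /=.
  rewrite big_ord0 diracE mem_set//.
  by case.
rewrite /pushforward.
pose tl (v : 'rV[R]_n.+1) : 'rV[R]_n := \row_i v ord0 (lift ord0 i).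
rewrite (_ : _ @^-1` _ =
    `]a ord0 ord0, a ord0 ord0 + l ord0 ord0[ `*` hyperrect (tl a) (tl l)).
  rewrite product_measure1E//; last exact: measurable_hyperrect.
  rewrite [X in (_ * X)%E]IHn; last by move=> i; rewrite mxE.
  rewrite big_ord_recl EFinM.
  have := @lebesgue_measure_itv R
    `]a ord0 ord0, a ord0 ord0 + l ord0 ord0[%R.
  rewrite /= lte_fin ltrDl => ->.
  congr (_ * _)%E; last by congr EFin; apply: eq_bigr => i _; rewrite mxE.
  have [l00|l00] := ltP 0 (l ord0 ord0).
    by rewrite -EFinD addrAC subrr add0r.
  by congr EFin; apply/eqP; rewrite eq_le l0.
apply/seteqP; split=> [p /= H|p /= [Hx Hy] i].
  split; first by have := H ord0; rewrite rV_cons0 in_itv.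
  by move=> i; have := H (lift ord0 i); rewrite rV_consS !mxE.
case: (unliftP ord0 i) => [j ->|->].
  by have := Hy j; rewrite rV_consS !mxE.
by rewrite rV_cons0; move: Hx; rewrite in_itv.
Qed.

End hyperrectangle.

Section rof.
Context (R : realType) (d : nat).
Implicit Types (a l x : 'rV[R]_d) (Omega : set 'rV[R]_d) (u g : 'rV[R]_d -> R).
Implicit Types (H : 'rV[R]_d -> 'rV[R]_d) (G : set (set 'rV[R]_d)).

Definition lebesgue_on_rect a l : set 'rV[R]_d -> \bar R :=
  mrestr (@lebesgue_rV R d) (measurable_hyperrect a l).

HB.instance Definition _ a l := Measure.on (lebesgue_on_rect a l).

(* C^k through existence and continuity of the iterated partial derivatives. *)
Fixpoint Ck (k : nat) u : Prop :=
  continuous u /\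
  if k is k'.+1 then
    forall i : 'I_d, (forall x, derivable u x (delta_mx ord0 i)) /\
                     Ck k' ('D_(delta_mx ord0 i) u)
  else True.

Definition smooth u : Prop := forall k, Ck k u.

Definition divergence H x : R :=
  \sum_(i < d) 'D_(delta_mx ord0 i) (fun y => H y ord0 i) x.

(* Elements of C_c^oo(Omega, R^d) are represented by their extensions by zero
   to R^d; the norm of ['rV[R]_d] is the maximum norm. *)
Definition tv_test_field Omega H : Prop :=
  [/\ forall i, smooth (fun x => H x ord0 i),
      exists K, [/\ compact K, K `<=` Omega & forall x, ~ K x -> H x = 0]
    & forall x, Omega x -> `|H x| <= 1].

Definition aniso_tv Omega u : \bar R :=
  ereal_sup [set (\int[@lebesgue_rV R d]_(x in Omega)
                    (u x * divergence H x)%:E)%E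
            | H in tv_test_field Omega].

Definition rof_energy a l (alpha : R) g u : \bar R :=
  ((2^-1)%:E * 'N[lebesgue_on_rect a l]_2%:E[EFin \o (u \- g)%R] ^+ 2
   + alpha%:E * aniso_tv (hyperrect a l) u)%E.

(* Elements of L^2 are represented by functions, so a minimizer is determined
   up to a.e. equality on the hyperrectangle only. *)
Definition rof_minimizer a l alpha g u : Prop :=
  u \in Lfun (lebesgue_on_rect a l) 2%:E /\
  forall v, v \in Lfun (lebesgue_on_rect a l) 2%:E ->
    (rof_energy a l alpha g u <= rof_energy a l alpha g v)%E.

Definition axis_hyperplane (i : 'I_d) (c : R) : set 'rV[R]_d :=
  [set x | x ord0 i = c].

Definition is_grid Omega G : Prop :=
  [/\ finite_set G,
      forall P, G P -> exists i c, P = axis_hyperplane i c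
    & closure Omega `\` interior Omega `<=` \bigcup_(P in G) P].

Definition grid_cells Omega G : set (set 'rV[R]_d) :=
  connected_component (Omega `\` \bigcup_(P in G) P) @`
    (Omega `\` \bigcup_(P in G) P).

(* The cells of a grid are finitely many open hyperrectangles, so the supremum
   is the greatest of their side lengths. *)
Definition mesh_size Omega G : R :=
  sup [set s | exists b m i,
    [/\ grid_cells Omega G (hyperrect b m), forall j, 0 < m ord0 j
      & s = m ord0 i]].

Definition cell_avg g (Q : set 'rV[R]_d) : R :=
  (fine (lebesgue_rV Q))^-1 * \int[@lebesgue_rV R d]_(x in Q) g x.

(* The cells are pairwise disjoint, so at most one term is nonzero and the
   finitely supported sum is never the default value 0 of an infinite one. *)
Definition grid_avg Omega G g : 'rV[R]_d -> R :=
  fun x => \sum_(Q \in grid_cells Omega G) cell_avg g Q * \1_Q x.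

End rof.

(* Main.v *)
Require Import Defs.
From HB Require Import structures.
From mathcomp Require Import all_boot all_order all_algebra.
From mathcomp Require Import all_classical all_reals all_analysis.
From mathcomp Require Import measurable_realfun ess_sup_inf.
From mathcomp Require Import ring lra.
Set Implicit Arguments.
Unset Strict Implicit.
Unset Printing Implicit Defensive.
Import Order.TTheory GRing.Theory Num.Theory.
Import numFieldNormedType.Exports.
Local Open Scope classical_set_scope.
Local Open Scope ring_scope.

(* Write u, v for the minimizers with data f, Af, where A is the averaging operator.

   The variational inequalities of u and v add up to |v - u|^2 <= <Af - f, v - u>, whence the first
   estimate.  As A is an orthogonal projection with J(Av) <= J(v), the inequality of v tested with
   Av gives v = Av, and then |v - u|^2 <= <f, u - Au>.  The right-hand side is estimated by
   Hoelder's inequality, interpolating between |u - Au|_q <= 2 |u|_q and |u - Au|_1 <= 2 h J(u); in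
   dimension one, |u - Au| <= J(u) a.e. gives the sharper bound.

   Both J(Av) <= J(v) and |u - Au|_1 <= 2 h J(u) follow from a discrete lower bound for J.  Cut the
   rectangle into cells Q_k and let F_i(k), bounded by 1, live on their faces, vanishing on the
   boundary.  The field that is equal to F on the faces and interpolates it along the axes can be
   smoothed by bump functions concentrated on the cells without leaving the unit ball, so that J(u)
   is at least the pairing of u with the discrete divergence of F.  For J(Av) the numbers F are the
   averages of a test field over faces.  For the L^1 bound, u - Au is paired with the sign of an
   arbitrary finite union of boxes: going from a sign function to its average one coordinate at a
   time, each step is the discrete derivative of a field bounded by h.  A monotone class argument
   passes to arbitrary measurable sets. *)

(** * Smooth functions *)

(** [J] is accessible only as a supremum over smooth compactly supported fields, so every lower
    bound on it has to come from explicit fields. The maximum norm makes this feasible: each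
    component is bounded separately, so a field can be assembled axis by axis from tensor products
    of one-dimensional profiles. A finite union of boxes is resolved only by a cutting finer than
    the grid, and on such a cutting [A] averages over blocks of cells. This is why the cells of a
    cutting are kept apart from the cells of the grid, and why a block relation appears beside the
    cells. In the passage from a sign function to its average, the step along the axis [i] enters
    only the [i]-th component of the field, with size at most a block length. Hence the bound [h]
    carries no dimensional constant. The factor 2 in the L^1 estimate comes from treating the
    positivity set of [u - A u] and its complement separately. *)

Section directional_smoothness.
Context (R : realType) (V : normedModType R) (E : set V).
Implicit Types u v : V -> R.

(* [Ck] of the definitions with an arbitrary set [E] of directions, so that the calculus rules are
   shared with functions of one variable. *)
Fixpoint Cdir (k : nat) u : Prop :=
  continuous u /\
  if k is k'.+1 then
    forall e, E e -> (forall x, derivable u x e) /\ Cdir k' ('D_e u)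
  else True.

Lemma Cdir_continuous k u : Cdir k u -> continuous u.
Proof. by case: k => [|k] []. Qed.

Lemma Cdir_pred k u : Cdir k.+1 u -> Cdir k u.
Proof.
elim: k u => [|k IH] u [cu du]; split=> // e Ee.
by have [dux Du] := du e Ee; split=> //; exact: IH.
Qed.

Lemma Cdir_cst k (c : R) : Cdir k (cst c).
Proof.
elim: k c => [|k IH] c; split=> //; try exact: cst_continuous.
move=> e Ee; split=> [x|]; first exact: derivable_cst.
rewrite (_ : 'D_e (cst c) = cst 0)//.
by apply/funext => x; rewrite derive_cst.
Qed.

Lemma CdirD k u v : Cdir k u -> Cdir k v -> Cdir k (u \+ v).
Proof.
elim: k u v => [|k IH] u v [cu du] [cv dv]; split=> //;
  try by move=> x; apply: cvgD; [exact: cu|exact: cv].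
move=> e Ee; have [dux Du] := du e Ee; have [dvx Dv] := dv e Ee.
split=> [x|]; first exact: derivableD.
rewrite (_ : 'D_e _ = 'D_e u \+ 'D_e v); first exact: IH.
by apply/funext => x; rewrite deriveD.
Qed.

Lemma CdirM k u v : Cdir k u -> Cdir k v -> Cdir k (u \* v).
Proof.
elim: k u v => [|k IH] u v Cu Cv; split=> //;
  try by move=> x; apply: cvgM; [exact: (Cdir_continuous Cu)|exact: (Cdir_continuous Cv)].
move=> e Ee; have [dux Du] := Cu.2 e Ee; have [dvx Dv] := Cv.2 e Ee.
split=> [x|]; first exact: derivableM.
rewrite (_ : 'D_e _ = (u \* 'D_e v) \+ (v \* 'D_e u)).
  by apply: CdirD; apply: IH => //; exact: Cdir_pred.
by apply/funext => x; rewrite deriveM.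
Qed.

Lemma Cdir_sum k (I : Type) (r : seq I) (P : pred I) (F : I -> V -> R) :
  (forall i, Cdir k (F i)) -> Cdir k (fun x => \sum_(i <- r | P i) F i x).
Proof.
move=> CF; elim: r => [|i r IH].
  by under eq_fun do rewrite big_nil; exact: Cdir_cst.
under eq_fun do rewrite big_cons.
by case: (P i) => //; exact: CdirD.
Qed.

Lemma Cdir_prod k (I : Type) (r : seq I) (P : pred I) (F : I -> V -> R) :
  (forall i, Cdir k (F i)) -> Cdir k (fun x => \prod_(i <- r | P i) F i x).
Proof.
move=> CF; elim: r => [|i r IH].
  by under eq_fun do rewrite big_nil; exact: Cdir_cst.
under eq_fun do rewrite big_cons.
by case: (P i) => //; exact: CdirM.
Qed.

End directional_smoothness.

Section smooth_line.
Context (R : realType).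
Implicit Types f g : R -> R.

Definition smooth1 f := forall k, Cdir [set (1 : R)] k f.

Lemma smooth1_continuous f : smooth1 f -> continuous f.
Proof. by move=> /(_ 0%N) []. Qed.

Lemma smooth1_derivable f x : smooth1 f -> derivable f x 1.
Proof. by move=> /(_ 1%N) [_ /(_ 1 erefl)] []. Qed.

Lemma smooth1M f g : smooth1 f -> smooth1 g -> smooth1 (f \* g).
Proof. by move=> sf sg k; exact: CdirM. Qed.

Lemma smooth1_cst (c : R) : smooth1 (cst c).
Proof. by move=> k; exact: Cdir_cst. Qed.

Lemma smooth1_primitive f g : (forall x : R, is_derive x (1 : R) f (g x)) ->
  smooth1 g -> smooth1 f.
Proof.
move=> df sg [|k]; split=> //;
  try by move=> x; apply/differentiable_continuous/derivable1_diffP.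
move=> _ ->; split=> // [].
rewrite (_ : 'D_1 f = g) ?sg//.
by apply/funext => x; rewrite derive_val.
Qed.

Lemma smooth1_affine f (p q : R) : smooth1 f ->
  smooth1 (fun x => f (p * x + q)).
Proof.
move=> sf k; elim: k f sf => [|k IH] f sf.
  split=> // x; apply: continuous_comp; last exact: smooth1_continuous.
  by apply: cvgD; [apply: cvgM; [exact: cvg_cst|exact: cvg_id]|exact: cvg_cst].
have df (x : R) : is_derive x (1 : R) (fun x => f (p * x + q)) (p * 'D_1 f (p * x + q)).
  have dl : is_derive x (1 : R) (fun x => p * x + q) p.
    have h := is_deriveD (is_deriveM (is_derive_cst p x 1) (is_derive_id x (1:R)))
       (is_derive_cst q x (1:R)).
    apply: (is_derive_eq h).
    by rewrite scaler0 !addr0 -[_ *: _]/(_ * _) mulr1.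
  have df : is_derive (p * x + q) (1 : R) f ('D_1 f (p * x + q)).
    exact/derivableP/smooth1_derivable.
  by rewrite [X in is_derive _ _ _ X]mulrC;
    exact: (@is_derive1_comp R f (fun x : R => p * x + q) x _ _ df dl).
split; first by move=> x; exact/differentiable_continuous/derivable1_diffP.
move=> _ ->; split=> //.
rewrite (_ : 'D_1 (fun x : R => f (p * x + q)) = cst p \* (fun x => 'D_1 f (p * x + q))).
  apply: CdirM; first exact: Cdir_cst.
  by apply: (IH ('D_1 f)) => j; have := sf j.+1; move=> [_ /(_ 1 erefl)] [].
by apply/funext => x; rewrite derive_val.
Qed.

End smooth_line.

Section smooth_coordinate.
Context (R : realType) (d : nat).
Implicit Types (x e : 'rV[R]_d) (u : 'rV[R]_d -> R).

Lemma CkE k u :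
  Ck k u <-> Cdir (range (fun i : 'I_d => delta_mx ord0 i : 'rV[R]_d)) k u.
Proof.
elim: k u => [|k IH] u; first by split.
split=> -[cu du]; split=> //.
  by move=> _ [i _ <-]; have [? /IH] := du i.
by move=> i; have [? /IH] := du (delta_mx ord0 i) (ex_intro2 _ _ i I erefl).
Qed.

Lemma coord_quotientE (f : R -> R) (i : 'I_d) x e :
  (fun h : R => h^-1 *: (((fun y => f (y ord0 i)) \o shift x) (h *: e)
     - f (x ord0 i))) =
  (fun h : R => h^-1 *: ((f \o shift (x ord0 i)) (h *: e ord0 i)
     - f (x ord0 i))).
Proof. by apply/funext => h /=; rewrite !mxE. Qed.

Lemma derivable_coord (f : R -> R) (i : 'I_d) x e :
  derivable (fun y : 'rV[R]_d => f (y ord0 i)) x e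
  <-> derivable f (x ord0 i) (e ord0 i).
Proof. by rewrite /derivable coord_quotientE. Qed.

Lemma derive_coord (f : R -> R) (i : 'I_d) x e :
  'D_e (fun y : 'rV[R]_d => f (y ord0 i)) x = 'D_(e ord0 i) f (x ord0 i).
Proof. by rewrite /derive coord_quotientE. Qed.

Lemma derivable_dir0 (f : R -> R) (x : R) : is_derive x (0 : R) f 0.
Proof.
have E : (fun h : R => h^-1 *: ((f \o shift x) (h *: (0 : R)) - f x)) = cst 0.
  by apply/funext => h /=; rewrite scaler0 add0r subrr scaler0.
split; first by rewrite /derivable E; exact: is_cvg_cst.
by rewrite /derive E; exact: lim_cst.
Qed.

Lemma smooth_coord (f : R -> R) (i : 'I_d) :
  smooth1 f -> smooth (fun x : 'rV[R]_d => f (x ord0 i)).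
Proof.
move=> sf k; apply/CkE; elim: k f sf => [|k IH] f sf.
  split=> // x; apply: continuous_comp; first exact: coord_continuous.
  exact: smooth1_continuous.
split.
  move=> x; apply: continuous_comp; first exact: coord_continuous.
  exact: smooth1_continuous.
move=> _ [j _ <-]; split=> [x|].
  apply/derivable_coord; rewrite mxE eqxx/=.
  case: eqVneq => _ /=; first exact: smooth1_derivable.
  by have [] := derivable_dir0 f (x ord0 i).
rewrite (_ : 'D__ _ = (fun x => (i == j)%:R * 'D_1 f (x ord0 i))).
  apply: CdirM; first exact: Cdir_cst.
  by apply: (IH ('D_1 f)) => m; have := sf m.+1; move=> [_ /(_ 1 erefl)] [].
apply/funext => x; rewrite derive_coord mxE eqxx/=.
case: eqVneq => _ /=; first by rewrite mul1r.
by rewrite mul0r; have [_ ->] := derivable_dir0 f (x ord0 i).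
Qed.

End smooth_coordinate.

(** * Flat exponentials, bump functions and smooth steps *)

Section flat_exponential.
Context (R : realType).
Implicit Types (p : {poly R}) (x t : R).

(* The derivatives of [exp (- 1 / x)] stay in this family. *)
Definition flat_exp p x : R :=
  if 0 < x then p.[x^-1] * expR (- x^-1) else 0.

(** The inequality [s <= expR s] at [s = t / n.+1], raised to the power [n.+1], bounds [expR t] from
    below by [(t / n.+1) ^+ n.+1]. *)
Lemma pow_expRN_le (n : nat) t : 0 < t ->
  t ^+ n * expR (- t) <= n.+1%:R ^+ n.+1 * t^-1.
Proof.
move=> t0; rewrite ler_pdivlMr// mulrAC -exprSr expRN ler_pdivrMr ?expR_gt0//.
have h : t / n.+1%:R <= expR (t / n.+1%:R).
  by rewrite (le_trans _ (expR_ge1Dx _))// lerDr.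
rewrite -{2}[t](@divfK _ n.+1%:R) ?pnatr_eq0// expRM_natr.
rewrite -ler_pdivrMl ?exprn_gt0// mulrC -exprVn -exprMn.
by rewrite lerXn2r ?nnegrE// ?expR_ge0// divr_ge0// ltW.
Qed.

Lemma flat_exp_le p : exists2 C : R, 0 <= C &
  forall x, `|flat_exp p x| <= C * `|x|.
Proof.
exists (\sum_(i < size p) `|p`_i| * i.+1%:R ^+ i.+1).
  by apply: sumr_ge0 => i _; rewrite mulr_ge0// exprn_ge0.
move=> x; rewrite /flat_exp; case: ifPn => x0; last first.
  by rewrite normr0 mulr_ge0// sumr_ge0// => i _; rewrite mulr_ge0// exprn_ge0.
rewrite horner_coef mulr_suml mulr_suml (le_trans (ler_norm_sum _ _ _))//.
apply: ler_sum => i _; rewrite -mulrA normrM -mulrA ler_wpM2l//.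
rewrite ger0_norm ?mulr_ge0 ?expR_ge0 ?exprn_ge0 ?invr_ge0 ?(ltW x0)//.
rewrite (gtr0_norm x0).
by have := @pow_expRN_le i x^-1; rewrite invr_gt0 invrK; exact.
Qed.

Lemma flat_exp_cvg0 p : flat_exp p x @[x --> 0] --> 0.
Proof.
have [C C0 hC] := flat_exp_le p.
apply: norm_cvg0; apply: (@squeeze_cvgr _ _ _ _ (cst 0) (fun x => C * `|x|)).
- by apply: nearW => x; rewrite normr_ge0 hC.
- exact: cvg_cst.
- rewrite -[X in _ --> X](mulr0 C); apply: cvgM; first exact: cvg_cst.
  by rewrite -[X in _ --> X](@normr0 R R); apply: cvg_norm; exact: cvg_id.
Qed.

(** With [y = x^-1] one has [d/dx = - y^2 d/dy], and the [y]-derivative of [p(y) exp(-y)] is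
    [(p' - p)(y) exp(-y)]. *)
Lemma is_derive_flat_exp p x :
  is_derive x (1 : R) (flat_exp p) (flat_exp ('X^2 * (p - p^`())) x).
Proof.
have [x0|x0|->] := ltgtP x 0.
- have e : \near x, cst 0 x = flat_exp p x.
    near=> y; rewrite /flat_exp; case: ifPn => // y0.
    suff: y < 0 by move/(lt_trans y0); rewrite ltxx.
    by near: y; exact: lt_nbhsl.
  rewrite [X in is_derive _ _ _ X]/flat_exp ltNge (ltW x0)/=.
  apply: (near_eq_is_derive e).
- pose g y := p.[y^-1] * expR (- y^-1).
  have e : \near x, g x = flat_exp p x.
    near=> y; rewrite /flat_exp ifT//.
    by near: y; exact: lt_nbhsr.
  apply: (near_eq_is_derive e).
  rewrite /g /flat_exp x0.
  have xn0 : x != 0 by rewrite gt_eqF.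
  have dinv : is_derive x (1 : R) (fun y : R => y^-1) (- x ^- 2).
    apply: is_derive_eq; first exact: is_deriveV.
    by rewrite [_ *: _]mulr1.
  have dp : is_derive x (1 : R) (fun y => p.[y^-1]) (p^`().[x^-1] * - x ^- 2).
    have h := is_derive_poly p x^-1.
    exact: (is_derive1_comp h dinv).
  have de : is_derive x (1 : R) (fun y => expR (- y^-1)) (expR (- x^-1) * x ^- 2).
    have dn : is_derive x (1 : R) (fun y : R => - y^-1) (x ^- 2).
      by apply: is_derive_eq; rewrite opprK.
    exact: (is_derive1_comp (is_derive_expR _) dn).
  apply: (is_derive_eq (is_deriveM dp de)).
  rewrite !hornerE /=.
  rewrite -![_ *: _]/(_ * _) exprVn.
  ring.
(* At 0 the difference quotient is again a flat exponential, with the polynomial multiplied by ['X],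
   so its limit is already known to be 0. *)
- have E : (fun h : R => h^-1 *: ((flat_exp p \o shift 0) (h *: 1) - flat_exp p 0))
      = flat_exp ('X * p).
    apply/funext => h /=; rewrite addr0 [h *: 1]mulr1 /flat_exp ltxx subr0.
    case: ifPn => h0; last by rewrite scaler0.
    by rewrite !hornerE -[_ *: _]/(_ * _) mulrA.
  have cv : flat_exp ('X * p) h @[h --> 0^'] --> 0.
    exact: cvg_within_filter (flat_exp_cvg0 _).
  split; first by rewrite /derivable E; apply/cvg_ex; exists 0.
  by rewrite /derive E {2}/flat_exp ltxx; apply: cvg_lim.
Unshelve. all: end_near.
Qed.

Lemma smooth1_flat_exp p : smooth1 (flat_exp p).
Proof.
move=> k; elim: k p => [|k IH] p; split=> //;
  try by move=> x; apply/differentiable_continuous/derivable1_diffP;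
    have [] := is_derive_flat_exp p x.
move=> _ ->; split=> [x|]; first by have [] := is_derive_flat_exp p x.
rewrite (_ : 'D_1 (flat_exp p) = flat_exp ('X^2 * (p - p^`()))) ?IH//.
by apply/funext => x; have [_ ->] := is_derive_flat_exp p x.
Qed.

End flat_exponential.

Section bump.
Context (R : realType).
Implicit Types (al be x : R) (n : nat).

(** The offset 3 keeps the two margins of an interval apart already for [n = 0], so that the bump is
    positive at the midpoint; the margin tends to 0, so that the bumps exhaust the interval. *)
Definition bump_margin al be n : R := (be - al) / n.+3%:R.

(* The factors vanish where [x - al] or [be - x] is at most the margin. *)
Definition sbump al be n x : R :=
  flat_exp 1 ((bump_margin al be n)^-1 * x + (- (bump_margin al be n)^-1 * al - 1)) *
  flat_exp 1 (- (bump_margin al be n)^-1 * x + ((bump_margin al be n)^-1 * be - 1)).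

Lemma smooth1_bump al be n : smooth1 (sbump al be n).
Proof.
by apply: smooth1M; apply: smooth1_affine; exact: smooth1_flat_exp.
Qed.

Lemma flat_exp1_ge0 x : 0 <= flat_exp 1 x.
Proof. by rewrite /flat_exp; case: ifP => // _; rewrite hornerE mul1r expR_ge0. Qed.

Lemma flat_exp1_le1 x : flat_exp 1 x <= 1.
Proof.
rewrite /flat_exp; case: ifPn => // x0; rewrite hornerE mul1r.
by rewrite expR_le1 oppr_le0 invr_ge0 ltW.
Qed.

Lemma bump_ge0 al be n x : 0 <= sbump al be n x.
Proof. by rewrite mulr_ge0 ?flat_exp1_ge0. Qed.

Lemma bump_le1 al be n x : sbump al be n x <= 1.
Proof. by rewrite mulr_ile1 ?flat_exp1_ge0 ?flat_exp1_le1. Qed.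

Lemma bump_normr_le1 al be n x : `|sbump al be n x| <= 1.
Proof. by rewrite ger0_norm ?bump_ge0// bump_le1. Qed.

Lemma bump_margin_gt0 al be n : al < be -> 0 < bump_margin al be n.
Proof. by move=> ab; rewrite divr_gt0 ?subr_gt0. Qed.

Lemma bump_left al be n x : al < be -> x <= al + bump_margin al be n ->
  sbump al be n x = 0.
Proof.
move=> ab xa; have e0 := bump_margin_gt0 n ab.
rewrite /sbump {1}/flat_exp ltNge [X in ~~ X](_ : _ = true) ?mul0r//.
set e := bump_margin al be n in e0 xa *.
rewrite addrA mulNr -mulrBr subr_le0 ler_pdivrMl// mulr1 lerBlDl.
exact: xa.
Qed.

Lemma bump_right al be n x : al < be -> be - bump_margin al be n <= x ->
  sbump al be n x = 0.
Proof.
move=> ab xa; have e0 := bump_margin_gt0 n ab.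
rewrite /sbump {2}/flat_exp ltNge [X in ~~ X](_ : _ = true) ?mulr0//.
set e := bump_margin al be n in e0 xa *.
rewrite addrA mulNr [- _ + _]addrC -mulrBr subr_le0 ler_pdivrMl// mulr1.
by rewrite lerBlDr addrC -lerBlDr.
Qed.

Lemma bump_out al be n x : al < be -> x \notin `]al, be[ -> sbump al be n x = 0.
Proof.
move=> ab; rewrite in_itv/= negb_and -!leNgt => /orP[xa|xb].
  by apply: bump_left => //; rewrite (le_trans xa)// lerDl ltW// bump_margin_gt0.
apply: bump_right => //; rewrite (le_trans _ xb)// gerBl.
by rewrite ltW// bump_margin_gt0.
Qed.

Lemma bump_mid_gt0 al be n : al < be -> 0 < sbump al be n ((al + be) / 2).
Proof.
move=> ab; have ba : 0 < be - al by rewrite subr_gt0.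
have ban : be - al != 0 by rewrite gt_eqF.
have n3 : (n.+3%:R : R) != 0 by rewrite pnatr_eq0.
have pos : 0 < (n.+1%:R : R) / 2 by rewrite divr_gt0.
have e1 : (bump_margin al be n)^-1 * ((al + be) / 2) +
   (- (bump_margin al be n)^-1 * al - 1) = n.+1%:R / 2.
  rewrite /bump_margin invf_div.
  have -> : (n.+3%:R : R) = n.+1%:R + 2 by rewrite -natrD addn2.
  by field.
have e2 : - (bump_margin al be n)^-1 * ((al + be) / 2) +
   ((bump_margin al be n)^-1 * be - 1) = n.+1%:R / 2.
  rewrite /bump_margin invf_div.
  have -> : (n.+3%:R : R) = n.+1%:R + 2 by rewrite -natrD addn2.
  by field.
have h : 0 < flat_exp 1 (n.+1%:R / 2 : R).
  by rewrite /flat_exp pos hornerE mul1r expR_gt0.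
by rewrite /sbump e1 e2 mulr_gt0.
Qed.

Lemma flat_exp1_cvg1 (p q : R) : 0 < p ->
  flat_exp 1 (p * n%:R + q) @[n --> \oo] --> (1 : R).
Proof.
move=> p0.
have cy : (p * n%:R + q) @[n --> \oo] --> +oo.
  apply/cvgryPge => A.
  near=> n; rewrite -lerBlDr -ler_pdivrMl//.
  by near: n; apply: nbhs_infty_ger.
have ci : (- (p * n%:R + q)^-1) @[n --> \oo] --> (0 : R).
  rewrite -[X in _ --> X]oppr0; apply: cvgN.
  apply/gtr0_cvgV0; first by near=> n; near: n; move/cvgryPgt : cy; exact.
  exact: cy.
have ce : expR (- (p * n%:R + q)^-1) @[n --> \oo] --> (1 : R).
  rewrite -[X in _ --> X](@expR0 R).
  by apply: continuous_cvg => //; exact: continuous_expR.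
apply: cvg_trans ce; apply: near_eq_cvg; near=> n.
rewrite /flat_exp hornerE mul1r ifT//.
by near: n; move/cvgryPgt : cy; exact.
Unshelve. all: end_near. Qed.

Lemma bump_cvg al be x : al < be ->
  sbump al be n x @[n --> \oo] --> (\1_(`]al, be[%classic) x : R).
Proof.
move=> ab; rewrite indicE; case: (boolP (x \in _)) => [|xab].
  rewrite inE/= in_itv/= => /andP[ax xb].
  rewrite -[X in _ --> X](mulr1 (1 : R)); apply: cvgM.
  - have := @flat_exp1_cvg1 ((x - al) / (be - al)) (3 * ((x - al) / (be - al)) - 1).
    rewrite divr_gt0 ?subr_gt0// => /(_ isT).
    apply: cvg_trans; apply: near_eq_cvg; apply: nearW => n; congr flat_exp.
    rewrite /bump_margin invf_div.
    have -> : (n.+3%:R : R) = n%:R + 3 by rewrite -natrD addn3.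
    by field; rewrite subr_eq0 gt_eqF.
  - have := @flat_exp1_cvg1 ((be - x) / (be - al)) (3 * ((be - x) / (be - al)) - 1).
    rewrite divr_gt0 ?subr_gt0// => /(_ isT).
    apply: cvg_trans; apply: near_eq_cvg; apply: nearW => n; congr flat_exp.
    rewrite /bump_margin invf_div.
    have -> : (n.+3%:R : R) = n%:R + 3 by rewrite -natrD addn3.
    by field; rewrite subr_eq0 gt_eqF.
have xab' : x \notin `]al, be[ by move: xab; rewrite notin_setE/= => /negP.
by under eq_fun do rewrite bump_out//; exact: cvg_cst.
Qed.

Let mu := @lebesgue_measure R.

(** For [x < al] the interval is empty and the value 0 is the right one, the bump being 0 there. *)
Definition bump_primitive al be n x : R := \int[mu]_(t in `[al, x]) sbump al be n t.

Definition bump_mass al be n : R := bump_primitive al be n be.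

Lemma integrable_bump al be n (x y : R) :
  mu.-integrable `[x, y] (EFin \o sbump al be n).
Proof.
apply: continuous_compact_integrable; first exact: segment_compact.
by apply: continuous_subspaceT => z; apply: smooth1_continuous; exact: smooth1_bump.
Qed.

Lemma bump_primitive_ge0 al be n x : 0 <= bump_primitive al be n x.
Proof. by apply: Rintegral_ge0 => t _; exact: bump_ge0. Qed.

Lemma bump_primitive_left al be n x : al < be ->
  x <= al + bump_margin al be n -> bump_primitive al be n x = 0.
Proof.
move=> ab xa; rewrite /bump_primitive (@eq_Rintegral _ _ _ _ _ (cst 0)).
  by rewrite Rintegral_cst// mul0r.
move=> t; rewrite inE/= in_itv/= => /andP[_ tx].
by apply: bump_left => //; exact: le_trans xa.
Qed.

Lemma bump_primitive_le al be n x : al < be ->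
  bump_primitive al be n x <= bump_mass al be n.
Proof.
move=> ab; rewrite /bump_mass /bump_primitive.
rewrite Rintegral_mkcond [leRHS]Rintegral_mkcond; apply: le_Rintegral => //.
- by rewrite -restrict_EFin -integrable_mkcond//; exact: integrable_bump.
- by rewrite -restrict_EFin -integrable_mkcond//; exact: integrable_bump.
- move=> t _; rewrite !patchE; case: ifPn; rewrite ?inE/=; last first.
    by move=> _; case: ifPn => // _; exact: bump_ge0.
  rewrite in_itv/= => /andP[at0 _]; case: ifPn => //.
  rewrite notin_setE/= in_itv/= at0/= => /negP; rewrite -ltNge => tb.
  by rewrite bump_out// in_itv/= (ltNge t be) (ltW tb) andbF.
Qed.

Lemma bump_primitive_right al be n x : al < be ->
  be - bump_margin al be n <= x -> bump_primitive al be n x = bump_mass al be n.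
Proof.
move=> ab bx; rewrite /bump_mass /bump_primitive.
rewrite Rintegral_mkcond [RHS]Rintegral_mkcond; apply: eq_Rintegral => t _.
rewrite !patchE; have [tb|tb] := lerP (be - bump_margin al be n) t.
  by rewrite bump_right// !if_same.
have tx : t <= x by rewrite ltW// (lt_le_trans tb).
have tbe : t <= be by rewrite ltW// (lt_le_trans tb)// gerBl ltW// bump_margin_gt0.
by congr (if _ then _ else _); apply/idP/idP; rewrite !inE/= !in_itv/= tx tbe.
Qed.

Lemma is_derive_bump_primitive al be n x : al < be ->
  is_derive x (1 : R) (bump_primitive al be n) (sbump al be n x).
Proof.
(* The fundamental theorem is applied on an interval starting at [al], which requires [al < x]; up
   to the margin the primitive is locally 0 instead. *)
move=> ab; have [xa|xa] := ltP x (al + bump_margin al be n).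
  have e : \near x, cst 0 x = bump_primitive al be n x.
    near=> y; rewrite bump_primitive_left//.
    by apply: ltW; near: y; exact: lt_nbhsl.
  rewrite bump_left ?(ltW xa)//.
  exact: (near_eq_is_derive e).
have ax : al < x by rewrite (lt_le_trans _ xa)// ltrDl bump_margin_gt0.
have [] := @continuous_FTC1 R (sbump al be n) (BLeft al) x (x + 1).
- by rewrite ltrDl.
- exact: integrable_bump.
- by rewrite lte_fin.
- by apply: smooth1_continuous; exact: smooth1_bump.
move=> d1 d2; split; first exact: d1.
by rewrite -derive1E; exact: d2.
Unshelve. all: end_near. Qed.

(** The primitive lies between 0 and the mass. Were the mass 0, it would be constant, against its
    positive derivative at the midpoint. *)
Lemma bump_mass_gt0 al be n : al < be -> 0 < bump_mass al be n.
Proof.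
move=> ab; rewrite lt_neqAle bump_primitive_ge0 andbT eq_sym; apply/negP => /eqP m0.
have P0 : bump_primitive al be n = cst 0.
  apply/funext => x; apply/eqP; rewrite eq_le bump_primitive_ge0 andbT.
  by rewrite -m0 bump_primitive_le.
have := @is_derive_bump_primitive al be n ((al + be) / 2) ab.
rewrite P0 => -[_]; rewrite derive_cst => /esym/eqP.
by rewrite gt_eqF// bump_mid_gt0.
Qed.

(** In the limit, division by the mass becomes division by the length of the cell; this is how
    difference quotients arise from derivatives of [bump_step]. *)
Lemma bump_mass_cvg al be : al < be ->
  bump_mass al be n @[n --> \oo] --> be - al.
Proof.
move=> ab.
have E : (\int[mu]_(x in `[al, be]) (\1_(`]al, be[%classic) x)%:E = (be - al)%:E)%E.
  rewrite integral_indic//= setIidl; last exact: subset_itv_oo_cc.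
  by have /= := lebesgue_measure_itv `]al, be[ => ->; rewrite lte_fin ab EFinB.
have : (\int[mu]_(x in `[al, be]) (sbump al be n x)%:E)%E @[n --> \oo] --> (be - al)%:E.
  rewrite -E; apply: (@dominated_cvg _ _ _ mu _ _ _ _ (cst 1%:E)) => //.
  - by move=> n; have /integrableP[] := integrable_bump al be n al be; exact.
  - by move=> x _; apply/cvg_EFin; [exact: nearW|exact: bump_cvg].
  - apply: (@continuous_compact_integrable R (cst 1)).
      exact: segment_compact.
    by apply: continuous_subspaceT => z; exact: cst_continuous.
  - by move=> n x _; rewrite /= lee_fin bump_normr_le1.
by move/fine_cvg; apply.
Qed.

(** Normalizing by the mass rather than by the length makes the step exactly 1 to the right of its
    cell, so that differences of consecutive steps telescope. *)
Definition bump_step al be n x : R := bump_primitive al be n x / bump_mass al be n.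

Lemma bump_step_ge0 al be n x : al < be -> 0 <= bump_step al be n x.
Proof. by move=> ab; rewrite divr_ge0 ?bump_primitive_ge0. Qed.

Lemma bump_step_le1 al be n x : al < be -> bump_step al be n x <= 1.
Proof.
by move=> ab; rewrite ler_pdivrMr ?bump_mass_gt0// mul1r bump_primitive_le.
Qed.

Lemma bump_step_left al be n x : al < be ->
  x <= al + bump_margin al be n -> bump_step al be n x = 0.
Proof. by move=> ab xa; rewrite /bump_step bump_primitive_left// mul0r. Qed.

Lemma bump_step_right al be n x : al < be ->
  be - bump_margin al be n <= x -> bump_step al be n x = 1.
Proof.
by move=> ab xa; rewrite /bump_step bump_primitive_right// divff// gt_eqF// bump_mass_gt0.
Qed.

Lemma is_derive_bump_step al be n x : al < be ->
  is_derive x (1 : R) (bump_step al be n) (sbump al be n x / bump_mass al be n).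
Proof.
move=> ab; have h := @is_derive_bump_primitive al be n x ab.
have := is_deriveM h (is_derive_cst (bump_mass al be n)^-1 x (1 : R)).
move=> /is_derive_eq; apply.
by rewrite scaler0 add0r [LHS]mulrC.
Qed.

Lemma smooth1_bump_step al be n : al < be -> smooth1 (bump_step al be n).
Proof.
move=> ab; apply: (@smooth1_primitive _ _ (sbump al be n \* cst (bump_mass al be n)^-1)).
  by move=> x; exact: is_derive_bump_step.
by apply: smooth1M; [exact: smooth1_bump|exact: smooth1_cst].
Qed.

End bump.

(** * Lebesgue measure on products *)

Section rV_measurability.
Context (R : realType) (d : nat).
Implicit Types (x y : 'rV[R]_d) (A O : set 'rV[R]_d).

Let coord (i : 'I_d) : 'rV[R]_d -> measurableTypeR R := fun x => x ord0 i.

Definition rat_cube (pn : 'rV[rat]_d * nat) : set 'rV[R]_d :=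
  [set x | forall i, ratr (pn.1 ord0 i) - pn.2.+1%:R^-1 < x ord0 i
                     < ratr (pn.1 ord0 i) + pn.2.+1%:R^-1].

Lemma measurable_rat_cube pn : measurable (rat_cube pn).
Proof.
have -> : rat_cube pn = hyperrect
    (\row_i (ratr (pn.1 ord0 i) - pn.2.+1%:R^-1)) (\row_i (2 * pn.2.+1%:R^-1)).
  apply/seteqP; split=> x /= H i; have := H i; rewrite !mxE.
    by rewrite (_ : _ - _ + _ = ratr (pn.1 ord0 i) + pn.2.+1%:R^-1)//; ring.
  by rewrite (_ : _ - _ + _ = ratr (pn.1 ord0 i) + pn.2.+1%:R^-1)//; ring.
exact: measurable_hyperrect.
Qed.

(** The sigma-algebra is generated by the coordinates, so an open set has to be written as a
    countable union of boxes: around each point there is a cube with rational center and half side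
    [n.+1%:R^-1] inside the set. *)
Lemma open_measurable_rV O : open O -> measurable O.
Proof.
move=> oO.
pose D := [set pn | rat_cube pn `<=` O].
have -> : O = \bigcup_pn (if pn \in D then rat_cube pn else set0).
  apply/seteqP; split; last first.
    by move=> x [pn _]; case: ifPn => //; rewrite inE; exact.
  move=> x Ox; have /nbhs_ballP[e /= e0 xeO] : nbhs x O by exact: open_nbhs_nbhs.
  have [n ne] : exists n, 2 * n.+1%:R^-1 < e.
    exists (Num.trunc (2 / e)); rewrite -ltr_pdivlMl//.
    rewrite -[ltRHS]invrK ltf_pV2 ?posrE ?invr_gt0 ?mulr_gt0 ?invr_gt0//.
    by rewrite invfM invrK; exact: truncnS_gt.
  have n0 : 0 < n.+1%:R^-1 :> R by rewrite invr_gt0.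
  have rx i : exists q : rat, x ord0 i - n.+1%:R^-1 < ratr q < x ord0 i + n.+1%:R^-1.
    have [|q] := @rat_in_itvoo R (x ord0 i - n.+1%:R^-1) (x ord0 i + n.+1%:R^-1).
      by rewrite ltrBlDr -addrA ltrDl addr_gt0.
    by rewrite in_itv/=; exists q.
  pose p : 'rV[rat]_d := \row_i (projT1 (cid (rx i))).
  have px i : x ord0 i - n.+1%:R^-1 < ratr (p ord0 i) < x ord0 i + n.+1%:R^-1.
    by rewrite mxE; case: cid.
  exists (p, n) => //; rewrite ifT.
    move=> i /=; have /andP[h1 h2] := px i.
    by rewrite ltrBlDr h2 -ltrBlDr h1.
  rewrite inE /D/= => y yp; apply: xeO; split=> // i j; have -> : i = ord0 by rewrite (ord1 i).
  have /andP[/= h1 h2] := px j; have /andP[/= h3 h4] := yp j.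
  rewrite /ball/= ltr_norml; apply/andP; split.
    move: ne h1 h2 h3 h4; move: (x ord0 j) (y ord0 j) (n.+1%:R^-1 : R) (ratr _ : R).
    by move=> r1 r2 r3 r4; lra.
  move: ne h1 h2 h3 h4; move: (x ord0 j) (y ord0 j) (n.+1%:R^-1 : R) (ratr _ : R).
  by move=> r1 r2 r3 r4; lra.
apply: countable_bigcupT_measurable => [|pn]; first exact: countableP.
by case: ifPn => // _; exact: measurable_rat_cube.
Qed.

Lemma continuous_measurable_rV (f : 'rV[R]_d -> R) : continuous f ->
  measurable_fun setT (f : _ -> measurableTypeR R).
Proof.
move=> /continuousP cf; apply: (measurability _ (RGenOpens.measurableE R)).
move=> _ [_ [a [b ->] <-]]; rewrite setTI; apply: open_measurable_rV.
exact/cf/interval_open.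
Qed.

(* On the sigma-algebra generated by the boxes every coordinate is measurable, since an open
   half-space is a countable union of boxes. *)
Lemma measurable_rV_boxes :
  (@measurable _ 'rV[R]_d) = <<s range (fun al : 'rV[R]_d * 'rV[R]_d => hyperrect al.1 al.2) >>.
Proof.
set G := range _.
apply/seteqP; split; last first.
  apply: smallest_sub; first exact: sigma_algebra_measurable.
  by move=> _ [[a l] _ <-]; exact: measurable_hyperrect.
apply: smallest_sub; first exact: smallest_sigma_algebra.
move=> A; rewrite -bigcup_seq => -[i /= _ [B mB <-]].
pose T' := g_sigma_algebraType G.
have mc : measurable_fun (setT : set T') (coord i : T' -> measurableTypeR R).
  apply: (measurability _ (RGenOInfty.measurableE R)).
  move=> _ [_ [x ->] <-]; rewrite setTI.
  have -> : coord i @^-1` `]x, +oo[%classic = \bigcup_n hyperrect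
     (\row_j (if j == i then x else - n%:R)) (\row_j (2 * n%:R)).
    apply/seteqP; split=> y.
      rewrite /= in_itv/= andbT => xy.
      exists (Num.trunc (\sum_j `|y ord0 j| + `|x|)).+1 => // j; rewrite !mxE.
      set N : R := (Num.trunc (\sum_j `|y ord0 j| + `|x|)).+1%:R.
      have hN : \sum_j `|y ord0 j| + `|x| < N by exact: truncnS_gt.
      have hy : `|y ord0 j| <= \sum_j `|y ord0 j|.
        by rewrite (bigD1 j)//= lerDl sumr_ge0.
      have : `|y ord0 j| < N by rewrite (le_lt_trans _ hN)// (le_trans hy)// lerDl.
      have : `|x| < N by rewrite (le_lt_trans _ hN)// lerDr sumr_ge0.
      rewrite !ltr_norml => /andP[? ?] /andP[? ?].
      have xy' : x < y ord0 i := xy.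
      case: eqVneq => [ji|_]; first by subst j; apply/andP; split=> //; lra.
      by apply/andP; split; lra.
    move=> [n _ /(_ i)]; rewrite !mxE eqxx => /andP[xy _] /=.
    by rewrite in_itv/= xy.
  apply: (@bigcupT_measurable _ T') => n.
  apply: sub_sigma_algebra.
  by exists (\row_j (if j == i then x else - n%:R), \row_j (2 * n%:R)).
have := mc measurableT B mB.
by rewrite !setTI.
Qed.

Lemma hyperrect_empty (a l : 'rV[R]_d) i : l ord0 i <= 0 -> hyperrect a l = set0.
Proof.
move=> l0; apply/seteqP; split=> // x /(_ i) /andP[h1 h2].
by have := lt_trans h1 h2; rewrite ltrDl ltNge l0.
Qed.

(** Boxes are stable under intersection because a box with a nonpositive side length is empty; so
    they form a generating pi-system on which only proper boxes have to be compared. *)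
Lemma hyperrect_measure_unique (m1 m2 : {measure set 'rV[R]_d -> \bar R}) :
  (forall a l : 'rV[R]_d, (forall i, 0 < l ord0 i) ->
     m1 (hyperrect a l) = m2 (hyperrect a l)) ->
  (forall a l : 'rV[R]_d, (forall i, 0 < l ord0 i) ->
     (m1 (hyperrect a l) < +oo)%E) ->
  forall A, measurable A -> m1 A = m2 A.
Proof.
move=> m12 m1oo;
 apply: (measure_unique (range (fun al : 'rV[R]_d * 'rV[R]_d => hyperrect al.1 al.2))
  (fun n => hyperrect (const_mx (- n.+1%:R)) (const_mx (2 * n.+1%:R)))).
- exact: measurable_rV_boxes.
- move=> _ _ [[a l] _ <-] [[b m] _ <-] /=.
  exists (\row_i Num.max (a ord0 i) (b ord0 i),
    \row_i (Num.min (a ord0 i + l ord0 i) (b ord0 i + m ord0 i)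
            - Num.max (a ord0 i) (b ord0 i))) => //.
  apply/seteqP; split=> x /=.
    move=> H; split=> i; have := H i; rewrite !mxE addrC subrK gt_max lt_min.
      by move=> /andP[/andP[-> _] /andP[-> _]].
    by move=> /andP[/andP[_ ->] /andP[_ ->]].
  move=> [H1 H2] i; rewrite !mxE addrC subrK gt_max lt_min.
  by have /andP[-> ->] := H1 i; have /andP[-> ->] := H2 i.
- by move=> n; exists (const_mx (- n.+1%:R), const_mx (2 * n.+1%:R)).
- apply/seteqP; split=> // x _.
  exists (Num.trunc (\sum_j `|x ord0 j|)) => // j; rewrite !mxE.
  set N : R := (Num.trunc (\sum_j `|x ord0 j|)).+1%:R.
  have hN : \sum_j `|x ord0 j| < N by exact: truncnS_gt.
  have hy : `|x ord0 j| <= \sum_j `|x ord0 j|.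
    by rewrite (bigD1 j)//= lerDl sumr_ge0.
  have : `|x ord0 j| < N by rewrite (le_lt_trans _ hN).
  by rewrite !ltr_norml => /andP[? ?]; apply/andP; split; lra.
- move=> _ [[a l] _ <-]/=.
  have [l0|] := pselect (forall i, 0 < l ord0 i); first exact: m12.
  move=> /existsNP[i /negP]; rewrite -leNgt => li.
  by rewrite (hyperrect_empty a li) !measure0.
- by move=> n; apply: m1oo => i; rewrite mxE mulr_gt0.
Qed.

End rV_measurability.

(** * Splitting off one coordinate and integrating along an axis *)

Section insertion.
Context (R : realType) (n : nat) (i : 'I_n.+1).

Definition rV_ins (p : measurableTypeR R * 'rV[R]_n) : 'rV[R]_n.+1 :=
  \row_j (if unlift i j is Some k then p.2 ord0 k else p.1).

Lemma rV_ins_at p : rV_ins p ord0 i = p.1.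
Proof. by rewrite mxE unlift_none. Qed.

Lemma rV_ins_lift p j : rV_ins p ord0 (lift i j) = p.2 ord0 j.
Proof. by rewrite mxE liftK. Qed.

Lemma measurable_rV_ins : measurable_fun setT rV_ins.
Proof.
apply/measurable_fun_rVP => j; case: (unliftP i j) => [k ->|->].
  under eq_fun do rewrite rV_ins_lift.
  exact: (measurableT_comp (measurable_rV_coord k) measurable_snd).
by under eq_fun do rewrite rV_ins_at; exact: measurable_fst.
Qed.

Definition rV_del (x : 'rV[R]_n.+1) : 'rV[R]_n := \row_j x ord0 (lift i j).

Lemma rV_ins_hyperrect (a l : 'rV[R]_n.+1) :
  rV_ins @^-1` hyperrect a l =
  `]a ord0 i, a ord0 i + l ord0 i[ `*` hyperrect (rV_del a) (rV_del l).
Proof.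
apply/seteqP; split=> [p /= H|p /= [Hx Hy] j].
  split; first by have := H i; rewrite rV_ins_at in_itv.
  by move=> j; have := H (lift i j); rewrite rV_ins_lift !mxE.
case: (unliftP i j) => [k ->|->].
  by have := Hy k; rewrite rV_ins_lift !mxE.
by rewrite rV_ins_at; move: Hx; rewrite in_itv.
Qed.

(** [lebesgue_rV] splits off the first coordinate by definition; any other coordinate may be split
    off because both measures agree on boxes. *)
Lemma lebesgue_rV_ins A : measurable A ->
  lebesgue_rV A = pushforward (lebesgue_measure \x @lebesgue_rV R n)%E rV_ins A.
Proof.
pose m2 := measure_function_pushforward__canonical__measure_function_Measure
  (lebesgue_measure \x @lebesgue_rV R n)%E measurable_rV_ins.
apply: (@hyperrect_measure_unique _ _ _ m2).
- move=> a l l0; rewrite [LHS]lebesgue_rV_hyperrect; last by move=> j; exact: ltW.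
  rewrite /= /pushforward rV_ins_hyperrect product_measure1E//; last exact: measurable_hyperrect.
  rewrite [X in (_ * X)%E]lebesgue_rV_hyperrect; last by move=> j; rewrite mxE ltW.
  rewrite (bigD1_ord i)//= EFinM.
  have := @lebesgue_measure_itv R
    `]a ord0 i, a ord0 i + l ord0 i[%R.
  rewrite /= lte_fin ltrDl l0 => ->.
  congr (_ * _)%E; first by rewrite -EFinD addrAC subrr add0r.
  by congr EFin; apply: eq_bigr => j _; rewrite mxE.
- by move=> a l l0; rewrite [ltLHS]lebesgue_rV_hyperrect ?ltry// => j; exact: ltW.
Qed.

End insertion.

Lemma continuous_hyperrect_bounded (R : realType) d (a l : 'rV[R]_d) (f : 'rV[R]_d -> R) :
  continuous f ->
  exists2 M : R, 0 <= M & forall x : 'rV[R]_d,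
    (forall i, a ord0 i <= x ord0 i <= a ord0 i + l ord0 i) ->
    `|f x| <= M.
Proof.
move=> cf.
pose K := [set x : 'rV[R]_d | forall i, `[a ord0 i, a ord0 i + l ord0 i]%classic (x ord0 i)].
have cK : compact K.
  apply: (@rV_compact _ _ (fun i => `[a ord0 i, a ord0 i + l ord0 i]%classic)) => i.
  exact: segment_compact.
have cfK : compact (f @` K).
  by apply: continuous_compact => //; exact: continuous_subspaceT.
have [M [_ hM]] := compact_bounded cfK.
exists (`|M| + 1) => [|x Kx]; first by rewrite addr_ge0.
apply: (hM (`|M| + 1)); first by rewrite (le_lt_trans (ler_norm _))// ltrDl.
by exists x => // i; rewrite /= in_itv/=.
Qed.

Section fubini.
Context (R : realType) (n : nat) (i : 'I_n.+1).
Implicit Types (a l x : 'rV[R]_n.+1) (y : 'rV[R]_n) (f g : 'rV[R]_n.+1 -> R).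

Let ei : 'rV[R]_n.+1 := delta_mx ord0 i.

Lemma integral_hyperrect_ins a l f : (forall j, 0 < l ord0 j) ->
  measurable_fun setT f ->
  (exists M : R, forall x, hyperrect a l x -> `|f x| <= M) ->
  (\int[@lebesgue_rV R n.+1]_(x in hyperrect a l) (f x)%:E =
   \int[@lebesgue_rV R n]_(y in hyperrect (rV_del i a) (rV_del i l))
     \int[lebesgue_measure]_(t in `]a ord0 i, (a ord0 i + l ord0 i)%R[)
       (f (rV_ins i (t, y)))%:E)%E.
Proof.
move=> l0 mf [M fM]; have mB := measurable_hyperrect a l.
pose g : 'rV[R]_n.+1 -> \bar R := (EFin \o f) \_ (hyperrect a l).
pose m1 := (lebesgue_measure \x @lebesgue_rV R n)%E.
pose m2 := measure_function_pushforward__canonical__measure_function_Measure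
  m1 (@measurable_rV_ins R n i).
have mg : measurable_fun [set: 'rV[R]_n.+1] g.
  by apply/(measurable_restrictT _ mB)/measurable_funTS/measurable_EFinP.
have ig : m1.-integrable setT (g \o rV_ins i).
  have -> : g \o rV_ins i = (EFin \o (f \o rV_ins i)) \_ (rV_ins i @^-1` hyperrect a l).
    by apply/funext => p; rewrite /g /= !patchE.
  rewrite -integrable_mkcond; last first.
    by rewrite -[X in measurable X]setTI; exact: measurable_rV_ins.
  apply: measurable_bounded_integrable.
  - by rewrite -[X in measurable X]setTI; exact: measurable_rV_ins.
  - rewrite -[ltLHS]/(pushforward m1 (rV_ins i) (hyperrect a l)) -lebesgue_rV_ins//.
    by rewrite [ltLHS]lebesgue_rV_hyperrect ?ltry// => j; exact: ltW.
  - apply: measurable_funTS; apply: measurableT_comp => //; exact: measurable_rV_ins.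
  - exists M; split; first exact: num_real.
    by move=> N MN p /= /fM h; rewrite (le_trans h)// ltW.
rewrite integral_mkcond.
transitivity (\int[m2]_x g x)%E.
  by apply: eq_measure_integral => A mA _; exact: lebesgue_rV_ins.
rewrite /m2 integral_pushforward//; last exact: measurable_rV_ins.
rewrite preimage_setT -integral21_prod_meas1// [RHS]integral_mkcond.
apply: eq_integral => y _; rewrite /fubini_G patchE.
case: ifPn => yB.
  rewrite [RHS]integral_mkcond; apply: eq_integral => t _.
  rewrite /g /= !patchE; congr (if _ then _ else _).
  apply/idP/idP; rewrite !inE => h.
    have : (rV_ins i @^-1` hyperrect a l) (t, y) by [].
    by rewrite rV_ins_hyperrect => -[].
  change ((rV_ins i @^-1` hyperrect a l) (t, y)).
  by rewrite rV_ins_hyperrect; split=> //; move: yB; rewrite inE.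
apply: integral0_eq => t _; rewrite /g /= patchE ifF//.
apply/negP; rewrite inE => h.
have : (rV_ins i @^-1` hyperrect a l) (t, y) by [].
rewrite rV_ins_hyperrect => -[_ /= h2].
by move: yB; rewrite notin_setE.
Qed.

Lemma rV_ins_quotient g t y :
  (fun h : R => h^-1 *: ((g \o shift (rV_ins i (t, y))) (h *: ei) - g (rV_ins i (t, y)))) =
  (fun h : R => h^-1 *: (((fun s => g (rV_ins i (s, y))) \o shift t) (h *: (1 : R))
     - g (rV_ins i (t, y)))).
Proof.
apply/funext => h /=; congr (_ *: (g _ - _)).
apply/rowP => j; rewrite !mxE eqxx/=; case: (unliftP i j) => [k ->|->].
  by rewrite eq_sym (negbTE (neq_lift _ _)) mulr0 add0r.
by rewrite eqxx.
Qed.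

(** Fubini's theorem along the axis [i] leaves the fundamental theorem of calculus on each line
    parallel to it, where [rV_ins_quotient] identifies the partial derivative with an ordinary
    one. *)
Lemma integral_partial a l g : (forall j, 0 < l ord0 j) ->
  continuous g -> (forall x, derivable g x ei) -> continuous ('D_ei g) ->
  (\int[@lebesgue_rV R n.+1]_(x in hyperrect a l) ('D_ei g x)%:E =
   \int[@lebesgue_rV R n]_(y in hyperrect (rV_del i a) (rV_del i l))
     (g (rV_ins i (a ord0 i + l ord0 i, y)%R) - g (rV_ins i (a ord0 i, y)))%:E)%E.
Proof.
move=> l0 cg dg cDg.
have [M' M'0 DgM] := continuous_hyperrect_bounded a l cDg.
rewrite (integral_hyperrect_ins l0); last 2 first.
- exact: continuous_measurable_rV.
- exists M' => x Hx; apply: DgM => j.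
  by have /andP[/ltW -> /ltW ->] := Hx j.
apply: eq_integral => y; rewrite inE => Hy.
have cins : continuous (fun t : R => rV_ins i (t, y)).
  have -> : (fun t : R => rV_ins i (t, y)) = (fun t : R => t *: ei + rV_ins i (0, y)).
    apply/funext => t; apply/rowP => j; rewrite !mxE eqxx/=.
    case: (unliftP i j) => [k ->|->].
      by rewrite eq_sym (negbTE (neq_lift _ _)) mulr0 add0r.
    by rewrite eqxx mulr1 addr0.
  move=> t; apply: cvgD; last exact: cvg_cst.
  by apply: cvgZr_tmp; exact: cvg_id.
have cDgi : continuous (fun t : R => 'D_ei g (rV_ins i (t, y))).
  by move=> t; exact: (continuous_comp (cins t) (cDg _)).
have cgi : continuous (fun t : R => g (rV_ins i (t, y))).
  by move=> t; exact: (continuous_comp (cins t) (cg _)).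
rewrite -(@integral_itv_bndoo R _ _ _ true false); last first.
  by apply/measurable_EFinP/measurable_funTS; exact: continuous_measurable_fun.
rewrite (@continuous_FTC2 R _ (fun t : R => g (rV_ins i (t, y)))).
- by rewrite -EFinB.
- by rewrite ltrDl.
- exact: continuous_subspaceT.
- split.
  + by move=> t _; have := dg (rV_ins i (t, y)); rewrite /derivable rV_ins_quotient.
  + exact/cvg_at_right_filter/cgi.
  + exact/cvg_at_left_filter/cgi.
- by move=> t _; rewrite derive1E /derive rV_ins_quotient.
Qed.

End fubini.

Lemma cvg_bigprod (R : realType) (I : Type) (r : seq I) (f : I -> nat -> R) (g : I -> R) :
  (forall i, f i n @[n --> \oo] --> g i) ->
  (\prod_(i <- r) f i n) @[n --> \oo] --> \prod_(i <- r) g i.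
Proof.
move=> fg; elim: r => [|i r IH].
  by rewrite big_nil; under eq_fun do rewrite big_nil; exact: cvg_cst.
rewrite big_cons; under eq_fun do rewrite big_cons.
by apply: cvgM; [exact: fg|exact: IH].
Qed.

Lemma cvg_bigsum (R : realType) (I : Type) (r : seq I) (f : I -> nat -> R) (g : I -> R) :
  (forall i, f i n @[n --> \oo] --> g i) ->
  (\sum_(i <- r) f i n) @[n --> \oo] --> \sum_(i <- r) g i.
Proof.
move=> fg; elim: r => [|i r IH].
  by rewrite big_nil; under eq_fun do rewrite big_nil; exact: cvg_cst.
rewrite big_cons; under eq_fun do rewrite big_cons.
by apply: cvgD; [exact: fg|exact: IH].
Qed.

Lemma is_derive_bigsum (R : realType) (V : normedModType R) (x v : V) (I : Type)
    (r : seq I) (F : I -> V -> R) (dF : I -> R) :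
  (forall i, is_derive x v (F i) (dF i)) ->
  is_derive x v (fun y => \sum_(i <- r) F i y) (\sum_(i <- r) dF i).
Proof.
move=> h; elim: r => [|i r IH].
  rewrite big_nil; under eq_fun do rewrite big_nil; exact: is_derive_cst.
rewrite big_cons; under eq_fun do rewrite big_cons.
exact: is_deriveD.
Qed.

Lemma Lfun_measurable d (T : measurableType d) (R : realType) (mu : {measure set T -> \bar R})
    q (u : T -> R) : u \in Lfun mu q -> measurable_fun setT u.
Proof. by rewrite inE => /andP[]; rewrite inE. Qed.

Section rect_measure.
Context (R : realType) (d : nat) (a l : 'rV[R]_d).
Hypothesis l0 : forall i, 0 < l ord0 i.
Let Omega := hyperrect a l.
Let mu : {measure set 'rV[R]_d -> \bar R} := lebesgue_on_rect a l.

Lemma rect_measureT : mu setT = (\prod_(i < d) l ord0 i)%:E.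
Proof.
by rewrite /mu /= /lebesgue_on_rect /mrestr setTI lebesgue_rV_hyperrect// => i; exact: ltW.
Qed.

Lemma rect_measure_fin : mu setT \is a fin_num.
Proof. by rewrite rect_measureT. Qed.

Lemma rect_measure_lty A : measurable A -> (mu A < +oo)%E.
Proof.
move=> mA; apply: (@le_lt_trans _ _ (mu setT)); last by rewrite rect_measureT ltry.
by apply: le_measure; rewrite ?inE.
Qed.

Lemma rect_ae : {ae mu, forall x, Omega x}.
Proof.
exists (~` Omega); split=> //.
- by apply: measurableC; exact: measurable_hyperrect.
- by rewrite /mu /= /lebesgue_on_rect /mrestr setICl measure0.
Qed.

(** [aniso_tv] integrates over the rectangle, whereas the norms use the measure restricted to it;
    this passes from one form to the other. *)
Lemma integral_rectE (f : 'rV[R]_d -> \bar R) : measurable_fun setT f ->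
  (\int[@lebesgue_rV R d]_(x in Omega) f x = \int[mu]_x f x)%E.
Proof.
move=> mf; have mO := measurable_hyperrect a l.
transitivity (\int[mu]_(x in Omega) f x)%E.
  apply: eq_measure_integral => A mA AO.
  by rewrite /mu /= /lebesgue_on_rect /mrestr setIidl.
rewrite integral_mkcond; apply: ae_eq_integral => //.
  by apply/(measurable_restrictT _ mO)/measurable_funTS.
apply: filterS rect_ae => x Ox _.
by rewrite patchE mem_set.
Qed.

Lemma Lfun2_integrable_rect (u : 'rV[R]_d -> R) : u \in Lfun mu 2%:E ->
  mu.-integrable setT (EFin \o u).
Proof.
move=> u2; apply/Lfun1_integrable; apply: Lfun_subset12 => //.
exact: rect_measure_fin.
Qed.

Lemma integrable_rect_mul (u v : 'rV[R]_d -> R) (M : R) : mu.-integrable setT (EFin \o u) ->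
  measurable_fun setT v -> 0 <= M -> (forall x, Omega x -> `|v x| <= M) ->
  mu.-integrable setT (EFin \o (u \* v)).
Proof.
move=> iu mv M0 vM.
have mu_ : measurable_fun setT u by case/integrableP: iu => /measurable_EFinP.
have muv : measurable_fun setT (u \* v) by exact: measurable_funM.
apply/integrableP; split; first exact/measurable_EFinP.
rewrite -integral_rectE; last by apply/measurableT_comp => //; exact/measurable_EFinP.
apply: (@le_lt_trans _ _ (\int[@lebesgue_rV R d]_(x in Omega) (M%:E * `|(u x)%:E|))%E).
  apply: ge0_le_integral => //; first exact: measurable_hyperrect.
  - by apply/measurable_funTS/measurableT_comp => //; exact/measurable_EFinP.
  - by apply/measurable_funTS/measurable_funeM/measurableT_comp => //; exact/measurable_EFinP.
  - by move=> x Ox; rewrite lee_fin normrM mulrC ler_wpM2r// vM.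
rewrite integral_rectE; last first.
  by apply/measurable_funeM/measurableT_comp => //; exact/measurable_EFinP.
rewrite ge0_integralZl//; last by apply/measurableT_comp => //; exact/measurable_EFinP.
by rewrite lte_mul_pinfty// ?ge0_fin_numE//; case/integrableP: iu.
Qed.

Lemma integrable_rect_bounded (v : 'rV[R]_d -> R) (M : R) :
  measurable_fun setT v -> 0 <= M -> (forall x, Omega x -> `|v x| <= M) ->
  mu.-integrable setT (EFin \o v).
Proof.
move=> mv M0 vM; have -> : v = cst 1 \* v by apply/funext => x /=; rewrite mul1r.
apply: (@integrable_rect_mul _ _ M) => //.
apply: measurable_bounded_integrable => //; first exact: rect_measure_lty.
by exists 1; split; [exact: num_real|move=> N N1 x _ /=; rewrite normr1 ltW].
Qed.

End rect_measure.

(** * A discrete lower bound for the total variation *)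

Section cutting.
Context (R : realType) (d : nat) (a l : 'rV[R]_d).

(* The cut points of each axis continue beyond the rectangle, so that all axes can be indexed by
   the same range; the cells beyond it do not meet the rectangle. *)
Record cutting := Cutting {
  cutpt : 'I_d -> nat -> R;
  ncell : 'I_d -> nat;
  cut_ltS : forall i m, cutpt i m < cutpt i m.+1;
  cut0 : forall i, cutpt i 0 = a ord0 i;
  cut_ncell : forall i, cutpt i (ncell i) = a ord0 i + l ord0 i }.

Variable C : cutting.

Definition ncells : nat := \max_i ncell C i.

Definition cut_len i m : R := cutpt C i m.+1 - cutpt C i m.

Definition cell (k : 'I_d -> nat) : set 'rV[R]_d :=
  [set x | forall i, cutpt C i (k i) < x ord0 i < cutpt C i (k i).+1].

Definition cell_index := {ffun 'I_d -> 'I_ncells}.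

Definition idx (k : cell_index) : 'I_d -> nat := fun i => k i.

(** Acts on plain functions, since a shifted index may leave the range of [cell_index]. *)
Definition shift_at (i : 'I_d) (k : 'I_d -> nat) : 'I_d -> nat :=
  fun j => if j == i then (k j).+1 else k j.

Lemma cut_len_gt0 i m : 0 < cut_len i m.
Proof. by rewrite subr_gt0 cut_ltS. Qed.

Lemma cut_le i m n : (m <= n)%N -> cutpt C i m <= cutpt C i n.
Proof.
move=> /subnK <-; elim: (n - m)%N => // k IH.
by rewrite addSn (le_trans IH)// ltW// cut_ltS.
Qed.

Lemma cut_lt i m n : (m < n)%N -> cutpt C i m < cutpt C i n.
Proof. by move=> mn; rewrite (lt_le_trans (cut_ltS _ _ _))// cut_le. Qed.

Lemma cellE k : cell k =
  hyperrect (\row_i cutpt C i (k i)) (\row_i cut_len i (k i)).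
Proof.
by apply/seteqP; split=> x H i; have := H i; rewrite !mxE addrC subrK.
Qed.

Lemma measurable_cell k : measurable (cell k).
Proof. by rewrite cellE; exact: measurable_hyperrect. Qed.

Lemma ncell_le i : (ncell C i <= ncells)%N.
Proof. by rewrite /ncells (bigD1 i)//= leq_maxl. Qed.

Lemma shift_atE i k : shift_at i k i = (k i).+1.
Proof. by rewrite /shift_at eqxx. Qed.

Lemma shift_at_neq i j k : j != i -> shift_at i k j = k j.
Proof. by rewrite /shift_at => /negbTE ->. Qed.

(** Wrapping the axis [i] around cyclically turns the shift into a permutation of the indices; where
    the two differ, namely at the last cell, both summands vanish by the two hypotheses on [g]. *)
Lemma sum_shift_at i (g : ('I_d -> nat) -> R) :
  (forall k, k i = 0%N -> g k = 0) -> (forall k, k i = ncells -> g k = 0) ->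
  \sum_(k : cell_index) g (shift_at i (idx k)) = \sum_(k : cell_index) g (idx k).
Proof.
rewrite /idx /cell_index; case: ncells => [|m] g0 gM.
  by rewrite !big1// => k; have [] := k i.
pose phi (k : {ffun 'I_d -> 'I_m.+1}) : {ffun 'I_d -> 'I_m.+1} :=
  [ffun j => if j == i then ordS (k j) else k j].
pose psi (k : {ffun 'I_d -> 'I_m.+1}) : {ffun 'I_d -> 'I_m.+1} :=
  [ffun j => if j == i then ord_pred (k j) else k j].
have phib : bijective phi.
  exists psi => k; apply/ffunP => j; rewrite !ffunE; case: eqVneq => // _.
    by rewrite ordSK.
  by rewrite ord_predK.
rewrite [RHS](reindex phi) /=; last exact: onW_bij.
apply: eq_bigr => k _.
have [kim|kim] := eqVneq (k i : nat) m.
  rewrite gM ?shift_atE ?kim// g0// ffunE eqxx /= kim.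
  by rewrite modnn.
congr g; apply/funext => j; rewrite /shift_at ffunE; case: eqVneq => // ->.
by rewrite /= modn_small// ltnS ltn_neqAle kim -ltnS ltn_ord.
Qed.

End cutting.

(** * Smooth test fields built from values on the faces of cells *)

Section test_field.
Context (R : realType) (d : nat) (a l : 'rV[R]_d) (C : cutting a l) (n : nat).
Hypothesis l0 : forall i, 0 < l ord0 i.
Implicit Types (i j : 'I_d) (x : 'rV[R]_d) (k : 'I_d -> nat).

Variable F : 'I_d -> ('I_d -> nat) -> R.
Hypothesis F1 : forall i k, `|F i k| <= 1.
Hypothesis F0 : forall i k, k i = 0%N -> F i k = 0.
Hypothesis FN : forall i j k, (ncell C j <= k j)%N -> F i k = 0.

Let cc := cutpt C.
Let b (j : 'I_d) m := sbump (cc j m) (cc j m.+1) n.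
Let s (j : 'I_d) m := bump_step (cc j m) (cc j m.+1) n.
Let e (j : 'I_d) m := bump_margin (cc j m) (cc j m.+1) n.

Definition cell_bump (k : 'I_d -> nat) x : R := \prod_j b j (k j) (x ord0 j).

(* Abel summation shows that the i-th component is a combination of the values [F i] with weights
   of sum at most one, cf. [test_field_hat]. *)
Definition test_field x : 'rV[R]_d := \row_i
  \sum_(k : cell_index C) (F i (shift_at i (idx k)) - F i (idx k)) *
     (s i (idx k i) (x ord0 i) * \prod_(j | j != i) b j (idx k j) (x ord0 j)).

Let lt_cc j m : cc j m < cc j m.+1. Proof. exact: cut_ltS. Qed.

Lemma test_fieldE i : (fun x => test_field x ord0 i) = fun x =>
  \sum_(k : cell_index C) (F i (shift_at i (idx k)) - F i (idx k)) *
     (s i (idx k i) (x ord0 i) * \prod_(j | j != i) b j (idx k j) (x ord0 j)).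
Proof. by apply/funext => x; rewrite mxE. Qed.

Lemma smooth_test_field i : smooth (fun x => test_field x ord0 i).
Proof.
move=> m; rewrite test_fieldE; apply/CkE.
apply: Cdir_sum => k; apply: CdirM; first exact: Cdir_cst.
apply: CdirM.
  by apply/CkE; apply: (@smooth_coord _ _ (s i (idx k i)) i); exact: smooth1_bump_step.
apply: Cdir_prod => j; apply/CkE.
by apply: (@smooth_coord _ _ (b j (idx k j)) j); exact: smooth1_bump.
Qed.

(** Of each product only the step depends on the coordinate [i]; its derivative is a bump over its
    mass, and this bump completes the remaining ones to [cell_bump]. *)
Lemma derive_test_field i x :
  'D_(delta_mx ord0 i) (fun y => test_field y ord0 i) x =
  \sum_(k : cell_index C) (F i (shift_at i (idx k)) - F i (idx k)) /
     bump_mass (cc i (idx k i)) (cc i (idx k i).+1) n * cell_bump (idx k) x.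
Proof.
have h (k : cell_index C) : is_derive x (delta_mx ord0 i : 'rV[R]_d)
     (fun y => (F i (shift_at i (idx k)) - F i (idx k)) *
     (s i (idx k i) (y ord0 i) * \prod_(j | j != i) b j (idx k j) (y ord0 j)))
     ((F i (shift_at i (idx k)) - F i (idx k)) /
     bump_mass (cc i (idx k i)) (cc i (idx k i).+1) n * cell_bump (idx k) x).
  move: (idx k) => {}k.
  have hs : is_derive x (delta_mx ord0 i : 'rV[R]_d) (fun y => s i (k i) (y ord0 i))
      (b i (k i) (x ord0 i) / bump_mass (cc i (k i)) (cc i (k i).+1) n).
    have [d1 d2] :=
      @is_derive_bump_step R (cc i (k i)) (cc i (k i).+1) n (x ord0 i) (lt_cc i (k i)).
    split; first by apply/derivable_coord; rewrite mxE !eqxx.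
    by rewrite derive_coord mxE !eqxx.
  have hp : is_derive x (delta_mx ord0 i : 'rV[R]_d)
      (fun y => \prod_(j | j != i) b j (k j) (y ord0 j)) 0.
    have E : (fun h : R => h^-1 *: (((fun y : 'rV[R]_d => \prod_(j | j != i) b j (k j) (y ord0 j))
        \o shift x) (h *: (delta_mx ord0 i : 'rV[R]_d)) - \prod_(j | j != i) b j (k j) (x ord0 j)))
        = cst 0.
      apply/funext => h /=; rewrite (_ : \prod_(j | _) _ = \prod_(j | j != i) b j (k j) (x ord0 j)).
        by rewrite subrr scaler0.
      by apply: eq_bigr => j ji; rewrite !mxE (negbTE ji) andbF mulr0 add0r.
    split; first by rewrite /derivable E; exact: is_cvg_cst.
    by rewrite /derive E; exact: lim_cst.
  have := is_deriveM (is_derive_cst (F i (shift_at i k) - F i k) x (delta_mx ord0 i))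
    (is_deriveM hs hp).
  move=> /is_derive_eq; apply.
  rewrite /cell_bump [in RHS](bigD1 i)//=.
  set D := _ - _; set S := s i _ _; set P := \prod_(j | _) _.
  set B := b i _ _; set m := bump_mass _ _ _.
  change (D * (S * 0 + P * (B / m)) + (S * P) * 0 = D / m * (B * P)).
  rewrite !mulr0 add0r addr0.
  by move: m^-1 => m'; ring.
have := @is_derive_bigsum R _ x (delta_mx ord0 i : 'rV[R]_d) _ (index_enum _) _ _ h.
by move=> [_ <-]; rewrite test_fieldE.
Qed.

(** Along the axis [i] a smooth hat around the cut point [m], rising in the cell [m.-1] and falling
    in the cell [m]; along the other axes the bump of the cell. The case [m = 0] belongs to the
    boundary, where [F] is 0. *)
Let w (i j : 'I_d) (m : nat) (t : R) : R :=
  if j == i then (if m == 0%N then 0 else s i m.-1 t - s i m t) else b j m t.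

Lemma test_field_hat i x : test_field x ord0 i =
  \sum_(k : cell_index C) F i (idx k) * \prod_j w i j (idx k j) (x ord0 j).
Proof.
rewrite mxE.
pose g (k : 'I_d -> nat) :=
  F i k * (s i (k i).-1 (x ord0 i) * \prod_(j | j != i) b j (k j) (x ord0 j)).
transitivity (\sum_(k : cell_index C) (g (shift_at i (idx k)) -
  F i (idx k) * (s i (idx k i) (x ord0 i) * \prod_(j | j != i) b j (idx k j) (x ord0 j)))).
  apply: eq_bigr => k _; rewrite mulrBl; congr (_ - _).
  rewrite /g shift_atE/=; congr (_ * (_ * _)).
  by apply: eq_bigr => j ji; rewrite shift_at_neq.
rewrite sumrB (@sum_shift_at R d a l C i g); last 2 first.
- by move=> k ki; rewrite /g F0// mul0r.
- by move=> k ki; rewrite /g (@FN i i) ?mul0r// ki ncell_le.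
rewrite -sumrB; apply: eq_bigr => k _; rewrite /g -mulrBr.
have [ki|ki] := eqVneq (idx k i) 0%N; first by rewrite F0// !mul0r.
rewrite [in RHS](bigD1 i)//= {1}/w eqxx (negbTE ki) -mulrBl.
by congr (_ * (_ * _)); apply: eq_bigr => j ji; rewrite /w (negbTE ji).
Qed.

(** Left of the cut point between the two cells the later step is still 0, right of it the earlier
    one is already 1. *)
Let step_le j m t : s j m.+1 t <= s j m t.
Proof.
have [tm|tm] := lerP t (cc j m.+1).
  rewrite {1}/s bump_step_left//; first exact: bump_step_ge0.
  by rewrite (le_trans tm)// lerDl ltW// bump_margin_gt0.
rewrite {2}/s bump_step_right//; first exact: bump_step_le1.
by rewrite (le_trans _ (ltW tm))// gerBl ltW// bump_margin_gt0.
Qed.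

Let w_ge0 i j m t : 0 <= w i j m t.
Proof.
rewrite /w; case: ifP => _; last exact: bump_ge0.
by case: m => //= m; rewrite subr_ge0 step_le.
Qed.

Let sum_step_le1 j M t : \sum_(m < M) (if (m : nat) == 0%N then 0 else s j m.-1 t - s j m t) <= 1.
Proof.
case: M => [|M]; first by rewrite big_ord0.
rewrite big_ord_recl/= add0r.
rewrite (_ : \sum_(m < M) _ = s j 0 t - s j M t).
  rewrite -[leRHS]subr0; apply: lerB; first exact: bump_step_le1.
  exact: bump_step_ge0.
elim: M => [|M IH]; first by rewrite big_ord0 subrr.
by rewrite big_ord_recr/= IH addrA subrK.
Qed.

Let sum_bump_le1 j M t : \sum_(m < M) b j m t <= 1.
Proof.
have H0 K : cc j K <= t -> \sum_(m < K) b j m t = 0.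
  move=> Kt; apply: big1 => m _; apply: bump_out => //.
  rewrite in_itv/= negb_and -!leNgt; apply/orP; right.
  by rewrite (le_trans _ Kt)// cut_le.
elim: M => [|M IH]; first by rewrite big_ord0.
rewrite big_ord_recr/=; have [Mt|tM] := lerP (cc j M) t.
  by rewrite H0// add0r bump_le1.
rewrite [X in _ + X]bump_out ?addr0// in_itv/= negb_and -!leNgt.
by rewrite (ltW tM).
Qed.

(** The sum of the weights over all cells factors into one-dimensional sums. Along the axis [i] the
    hats telescope to a difference of two steps; along the other axes at most one bump is nonzero.
    So each factor is at most 1. *)
Lemma test_field_le1 i x : `|test_field x ord0 i| <= 1.
Proof.
rewrite test_field_hat (le_trans (ler_norm_sum _ _ _))//.
apply: (@le_trans _ _ (\sum_(k : cell_index C) \prod_j w i j (k j) (x ord0 j))).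
  apply: ler_sum => k _; rewrite normrM [X in _ * X]ger0_norm ?prodr_ge0//.
  by rewrite ler_piMl ?prodr_ge0.
rewrite -(@bigA_distr_bigA _ _ _ _ _ _ _ (fun j (m : 'I_(ncells C)) => w i j m (x ord0 j))).
apply: (@le_trans _ _ (\prod_(j < d) (1 : R))); last by rewrite big1.
apply: ler_prod => j _; rewrite sumr_ge0//= /w.
by case: eqVneq => [->|_]; [exact: sum_step_le1|exact: sum_bump_le1].
Qed.

Let lo j := cc j 0 + e j 0.
Let hi j := cc j (ncell C j) - e j (ncell C j).-1.

(** A margin is at most a third of its cell, so the margin of the first cell ends before the second
    cell begins. *)
Let lo_le j m : lo j <= cc j m + e j m.
Proof.
case: m => // m; rewrite /lo (@le_trans _ _ (cc j m.+1))//; last first.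
  by rewrite lerDl ltW// bump_margin_gt0.
rewrite (@le_trans _ _ (cc j 1))// ?cut_le// -lerBrDl.
rewrite /e /bump_margin ler_pdivrMr//.
by rewrite ler_peMr ?subr_ge0 ?(ltW (lt_cc _ _))// ler1n.
Qed.

Let le_hi j m : (m < ncell C j)%N -> cc j m.+1 - e j m <= hi j.
Proof.
rewrite /hi; case: (ncell C j) => // N; rewrite ltnS leq_eqVlt => /predU1P[->//|mN] /=.
rewrite (@le_trans _ _ (cc j N))//.
  rewrite (@le_trans _ _ (cc j m.+1))// ?cut_le//.
  by rewrite gerBl ltW// bump_margin_gt0.
rewrite lerBrDr -lerBrDl /e /bump_margin ler_pdivrMr//.
by rewrite ler_peMr ?subr_ge0 ?(ltW (lt_cc _ _))// ler1n.
Qed.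

Let ncell_gt0 j : (0 < ncell C j)%N.
Proof.
rewrite lt0n; apply/negP => /eqP N0; have := cut_ncell C j.
by rewrite N0 cut0 => /eqP; rewrite addrC -subr_eq subrr eq_sym gt_eqF.
Qed.

(** Left of [lo] all steps and bumps are 0. Right of [hi] the bumps of the cells in range are 0 and
    their steps are all 1, so the hats cancel; beyond the range [F] itself vanishes. *)
Lemma test_field_support x : ~ (forall j, lo j <= x ord0 j <= hi j) -> test_field x = 0.
Proof.
move=> /existsNP[p /negP hp]; apply/rowP => i; rewrite test_field_hat mxE.
apply: big1 => k _.
have [kp|kp] := leqP (ncell C p) (idx k p); first by rewrite (FN i kp) mul0r.
rewrite (bigD1 p)//= [w _ _ _ _](_ : _ = 0) ?mul0r ?mulr0//.
move: hp; rewrite negb_and -!ltNge /w => /orP[xl|hx].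
  have s0 m : s p m (x ord0 p) = 0.
    by rewrite /s bump_step_left// (le_trans (ltW xl))// lo_le.
  case: eqVneq => [<-|_]; first by rewrite !s0 subrr if_same.
  by rewrite /b bump_left// (le_trans (ltW xl))// lo_le.
have s1 m : (m < ncell C p)%N -> s p m (x ord0 p) = 1.
  by move=> mp; rewrite /s bump_step_right// (le_trans _ (ltW hx))// le_hi.
case: eqVneq => [<-|_].
  case: eqVneq => // k0; rewrite !s1 ?subrr//.
  by rewrite (leq_ltn_trans (leq_pred _)).
by rewrite /b bump_right// (le_trans _ (ltW hx))// le_hi.
Qed.

Lemma tv_test_field_test_field : tv_test_field (hyperrect a l) test_field.
Proof.
split; first exact: smooth_test_field.
  exists [set x : 'rV[R]_d | forall j, `[lo j, hi j]%classic (x ord0 j)]; split.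
  - apply: (@rV_compact _ _ (fun j => `[lo j, hi j]%classic)) => j.
    exact: segment_compact.
  - move=> x H j; have := H j; rewrite /= in_itv/= => /andP[xl xh].
    apply/andP; split.
      by rewrite (lt_le_trans _ xl)// /lo /cc cut0 ltrDl bump_margin_gt0.
    by rewrite (le_lt_trans xh)// /hi /cc cut_ncell gtrBl bump_margin_gt0.
  - move=> x H; apply: test_field_support => H'; apply: H => j.
    by rewrite /= in_itv/=.
move=> x _; rewrite [leLHS]/Num.norm/= mx_normrE.
apply/bigmax_leP; split=> // -[i j] _ /=.
by rewrite (ord1 i); exact: test_field_le1.
Qed.

Lemma divergence_test_field x : divergence test_field x =
  \sum_i \sum_(k : cell_index C) (F i (shift_at i (idx k)) - F i (idx k)) /
     bump_mass (cc i (idx k i)) (cc i (idx k i).+1) n * cell_bump (idx k) x.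
Proof. by rewrite /divergence; apply: eq_bigr => i _; exact: derive_test_field. Qed.

End test_field.

Section discrete_tv.
Context (R : realType) (d : nat) (a l : 'rV[R]_d) (C : cutting a l).
Hypothesis l0 : forall i, 0 < l ord0 i.
Let Omega := hyperrect a l.
Let mu : {measure set 'rV[R]_d -> \bar R} := lebesgue_on_rect a l.
Implicit Types (i j : 'I_d) (x : 'rV[R]_d) (k : 'I_d -> nat) (u : 'rV[R]_d -> R).

Definition cell_int u k : R := \int[mu]_(x in cell C k) u x.

Lemma indic_cell k x :
  \1_(cell C k) x = \prod_j (\1_(`]cutpt C j (k j), cutpt C j (k j).+1[%classic) (x ord0 j)) :> R.
Proof.
rewrite indicE; case: (boolP (x \in _)) => [|]; rewrite ?inE ?notin_setE => H.
  by rewrite big1// => j _; rewrite indicE mem_set//= in_itv/= H.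
have /existsNP[j hj] := H.
by rewrite (bigD1 j)//= indicE memNset ?mul0r//= in_itv.
Qed.

Lemma measurable_cell_bump n k : measurable_fun setT (cell_bump C n k).
Proof.
apply: continuous_measurable_rV.
suff /(_ 0%N)/CkE[] : smooth (cell_bump C n k) by [].
move=> m; apply/CkE; apply: Cdir_prod => j; apply/CkE.
apply: (@smooth_coord _ _ (sbump (cutpt C j (k j)) (cutpt C j (k j).+1) n) j).
exact: smooth1_bump.
Qed.

Lemma cell_bump_le1 n k x : `|cell_bump C n k x| <= 1.
Proof.
rewrite normr_prod; apply: (@le_trans _ _ (\prod_(j < d) (1 : R))); last by rewrite big1.
by apply: ler_prod => j _; rewrite normr_ge0 bump_normr_le1.
Qed.

Lemma cvg_cell_bump u k : mu.-integrable setT (EFin \o u) ->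
  (\int[mu]_x (u x * cell_bump C n k x)) @[n --> \oo] --> cell_int u k.
Proof.
move=> iu; have mu_ : measurable_fun setT u by case/integrableP: iu => /measurable_EFinP.
have E : (\int[mu]_x (u x * \1_(cell C k) x)%:E)%E = (\int[mu]_(x in cell C k) (u x)%:E)%E.
  rewrite [RHS]integral_mkcond; apply: eq_integral => x _.
  by rewrite patchE indicE; case: ifPn => _; rewrite ?mulr1 ?mulr0.
have : (\int[mu]_x (u x * cell_bump C n k x)%:E)%E @[n --> \oo] -->
    (\int[mu]_(x in cell C k) (u x)%:E)%E.
  rewrite -E; apply: (@dominated_cvg _ _ _ mu _ _ _ _ (fun x => `|u x|%:E)) => //.
  - move=> n; apply/measurable_EFinP; apply: measurable_funM => //.
    exact: measurable_cell_bump.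
  - move=> x _; apply/cvg_EFin; first exact: nearW.
    apply: cvgM; first exact: cvg_cst.
    rewrite indic_cell; apply: cvg_bigprod => j.
    by apply: bump_cvg; exact: cut_ltS.
  - exact: (integrable_abse iu).
  - move=> n x _ /=; rewrite lee_fin normrM -[leRHS]mulr1 ler_wpM2l//.
    exact: cell_bump_le1.
have ic : mu.-integrable (cell C k) (EFin \o u).
  by apply: (integrableS _ _ _ iu) => //; exact: measurable_cell.
rewrite -(fineK (integrable_fin_num _ ic)); last exact: measurable_cell.
by move/fine_cvg; apply.
Qed.

(** [S n] is the pairing of [u] with the divergence of the test field of parameter [n], hence below
    the supremum. As [n] grows, the bumps tend to the indicators of the cells and the masses to the
    cell lengths. *)
Theorem discrete_tv_le u (F : 'I_d -> ('I_d -> nat) -> R) :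
  u \in Lfun mu 2%:E ->
  (forall i k, `|F i k| <= 1) -> (forall i k, k i = 0%N -> F i k = 0) ->
  (forall i j k, (ncell C j <= k j)%N -> F i k = 0) ->
  ((\sum_i \sum_(k : cell_index C)
     cell_int u (idx k) * ((F i (shift_at i (idx k)) - F i (idx k)) / cut_len C i (idx k i)))%:E
   <= aniso_tv Omega u)%E.
Proof.
move=> u2 F1 F0 FN.
have iu := Lfun2_integrable_rect l0 u2.
have mu_ := Lfun_measurable u2.
pose S n := \sum_i \sum_(k : cell_index C)
  (F i (shift_at i (idx k)) - F i (idx k)) /
     bump_mass (cutpt C i (idx k i)) (cutpt C i (idx k i).+1) n *
   \int[mu]_x (u x * cell_bump C n (idx k) x).
have ib n k : mu.-integrable setT (EFin \o (u \* cell_bump C n k)).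
  apply: (@integrable_rect_mul _ _ _ _ _ _ 1 iu) => //.
    exact: measurable_cell_bump.
  by move=> x _; exact: cell_bump_le1.
have SJ n : ((S n)%:E <= aniso_tv Omega u)%E.
  have <- : (\int[@lebesgue_rV R d]_(x in Omega)
      (u x * divergence (test_field C n F) x)%:E)%E = (S n)%:E.
    have -> : (fun x : 'rV[R]_d => (u x * divergence (test_field C n F) x)%:E) =
      (fun x => (\sum_i \sum_(k : cell_index C) (((F i (shift_at i (idx k)) - F i (idx k)) /
       bump_mass (cutpt C i (idx k i)) (cutpt C i (idx k i).+1) n)%R%:E *
       (EFin \o (u \* cell_bump C n (idx k))%R) x))%E).
      apply/funext => x; rewrite divergence_test_field mulr_sumr -sumEFin.
      apply: eq_bigr => i _; rewrite mulr_sumr -sumEFin; apply: eq_bigr => k _.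
      by rewrite /= -EFinM mulrCA.
    rewrite integral_rectE; last first.
      apply: emeasurable_sum => i; apply: emeasurable_sum => k.
      by apply: measurable_funeM; case/integrableP: (ib n (idx k)).
    rewrite integral_sum//; last first.
      move=> i; apply: integrable_sum => // k _; apply: integrableZl => //; exact: ib.
    rewrite /S -sumEFin; apply: eq_bigr => i _.
    rewrite integral_sum//; last first.
      by move=> k; apply: integrableZl => //; exact: ib.
    rewrite -sumEFin; apply: eq_bigr => k _.
    rewrite integralZl//; last exact: ib.
    rewrite [RHS]EFinM; congr (_ * _)%E.
    rewrite /Rintegral fineK//; apply: integrable_fin_num => //; exact: ib.
  apply: ereal_sup_ubound; exists (test_field C n F) => //.
  exact: tv_test_field_test_field.
have SC : S n @[n --> \oo] --> \sum_i \sum_(k : cell_index C)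
     cell_int u (idx k) * ((F i (shift_at i (idx k)) - F i (idx k)) / cut_len C i (idx k i)).
  apply: cvg_bigsum => i; apply: cvg_bigsum => k; rewrite mulrC; apply: cvgM.
    apply: cvgM; first exact: cvg_cst.
    apply: cvgV; first by rewrite gt_eqF// cut_len_gt0.
    by apply: bump_mass_cvg; exact: cut_ltS.
  exact: cvg_cell_bump.
move: SJ; case: (aniso_tv Omega u) => [j| |] SJ; last 2 first.
- by rewrite leey.
- by have := SJ 0%N; rewrite leNgt ltNyr.
rewrite lee_fin -(cvg_lim _ SC)//; apply: limr_le.
  by apply/cvg_ex; eexists; exact: SC.
by apply: nearW => n; have := SJ n; rewrite lee_fin.
Qed.

End discrete_tv.

Lemma lebesgue_rV_axis (R : realType) d (j : 'I_d) (c : R) :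
  lebesgue_rV [set x : 'rV[R]_d | x ord0 j = c] = 0%E.
Proof.
case: d j => [[]//|n] j.
have mA : measurable [set x : 'rV[R]_n.+1 | x ord0 j = c].
  rewrite (_ : [set _ | _] = (fun x : 'rV[R]_n.+1 => x ord0 j : measurableTypeR R) @^-1` [set c]).
    by rewrite -[X in measurable X]setTI; exact: measurable_rV_coord.
  by apply/seteqP; split.
rewrite (lebesgue_rV_ins j mA) /pushforward.
rewrite (_ : _ @^-1` _ = [set c] `*` setT).
  rewrite product_measure1E//.
  by rewrite [X in (X * _)%E](_ : _ = 0%E) ?mul0e//; exact: lebesgue_measure_set1.
by apply/seteqP; split=> -[t y] /=; rewrite rV_ins_at// => -[].
Qed.

(** * Averages over the cells of a cutting *)

Section cells.
Context (R : realType) (d : nat) (a l : 'rV[R]_d) (C : cutting a l).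
Hypothesis l0 : forall i, 0 < l ord0 i.
Let Omega := hyperrect a l.
Let mu : {measure set 'rV[R]_d -> \bar R} := lebesgue_on_rect a l.
Implicit Types (i j : 'I_d) (x : 'rV[R]_d) (k : 'I_d -> nat) (u g : 'rV[R]_d -> R).

Lemma ncell_gt0 i : (0 < ncell C i)%N.
Proof.
rewrite lt0n; apply/negP => /eqP N0; have := cut_ncell C i.
by rewrite N0 cut0 => /eqP; rewrite addrC -subr_eq subrr eq_sym gt_eqF.
Qed.

Lemma ae_axis j (c : R) : {ae mu, forall x, x ord0 j <> c}.
Proof.
have mA : measurable [set x : 'rV[R]_d | x ord0 j = c].
  rewrite (_ : [set _ | _] = (fun x : 'rV[R]_d => x ord0 j : measurableTypeR R) @^-1` [set c]).
    by rewrite -[X in measurable X]setTI; exact: measurable_rV_coord.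
  by apply/seteqP; split.
exists [set x : 'rV[R]_d | x ord0 j = c]; split=> //.
- apply/eqP; rewrite eq_le measure_ge0 andbT -(lebesgue_rV_axis j c).
  apply: le_measure; rewrite ?inE//.
  by apply: measurableI => //; exact: measurable_hyperrect.
- by move=> x /= /contrapT.
Qed.

Definition in_range k := forall i, (k i < ncell C i)%N.

Lemma in_range_index k : in_range k -> exists k' : cell_index C, idx k' = k.
Proof.
move=> kN; exists [ffun i => Ordinal (leq_trans (kN i) (ncell_le C i))].
by apply/funext => i; rewrite /idx ffunE.
Qed.

Lemma exists_cell x : Omega x ->
  (forall j m, (0 < m)%N -> (m < ncell C j)%N -> x ord0 j <> cutpt C j m) ->
  exists2 k, in_range k & cell C k x.
Proof.
move=> Ox hx.
have /choice[k hk] j : exists m, (m < ncell C j)%N /\ cutpt C j m < x ord0 j < cutpt C j m.+1.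
  have exm : exists m, x ord0 j < cutpt C j m.
    by exists (ncell C j); rewrite cut_ncell; have /andP[] := Ox j.
  case: (ex_minnP exm) => -[|m] xm mmin.
    by move: xm; rewrite cut0; have /andP[/lt_trans H _] := Ox j => /H; rewrite ltxx.
  have mN : (m < ncell C j)%N by apply: mmin; rewrite cut_ncell; have /andP[] := Ox j.
  exists m; split=> //; rewrite xm andbT lt_neqAle; apply/andP; split; last first.
    by rewrite leNgt; apply/negP => /mmin; rewrite ltnn.
  have [->|m0] := posnP m; last by apply/eqP => /esym; exact: hx.
  by rewrite cut0; have /andP[h _] := Ox j; rewrite lt_eqF.
by exists k => i; have [] := hk i.
Qed.

Lemma ae_cell : {ae mu, forall x, exists2 k, in_range k & cell C k x}.
Proof.
have h : {ae mu, forall x, forall j m, x ord0 j <> cutpt C j m}.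
  have hj j : {ae mu, forall x, forall m, x ord0 j <> cutpt C j m}.
    by apply/ae_foralln => m; exact: ae_axis.
  exact: filter_forall.
near=> x; apply: exists_cell; first by near: x; exact: rect_ae.
by move=> j m _ _; move: j m; near: x; exact: h.
Unshelve. all: end_near. Qed.

Lemma cell_inj k k' x : cell C k x -> cell C k' x -> k = k'.
Proof.
move=> kx kx'; apply/funext => i; have /andP[h1 h2] := kx i; have /andP[h3 h4] := kx' i.
have lt p q : cutpt C i p < x ord0 i -> x ord0 i < cutpt C i q.+1 -> (p <= q)%N.
  move=> xp xq; rewrite leqNgt; apply/negP => qp.
  by have := lt_trans xp xq; rewrite ltNge cut_le.
by apply/eqP; rewrite eqn_leq !lt.
Qed.

Lemma cell_sub_rect k : in_range k -> cell C k `<=` Omega.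
Proof.
move=> kN x kx i; have /andP[h1 h2] := kx i; apply/andP; split.
  by rewrite -(cut0 C) (le_lt_trans _ h1)// cut_le.
by rewrite -(cut_ncell C) (lt_le_trans h2)// cut_le.
Qed.

Lemma cell_out k : ~ in_range k -> cell C k `&` Omega = set0.
Proof.
move=> /existsNP[i /negP]; rewrite -leqNgt => Nk.
apply/seteqP; split=> // x [kx Ox]; have /andP[h _] := kx i; have /andP[_ h'] := Ox i.
by have := lt_trans h h'; rewrite -(cut_ncell C) ltNge cut_le.
Qed.

Lemma measure_cell_out k : ~ in_range k -> mu (cell C k) = 0%E.
Proof.
by move=> kN; rewrite /mu /= /lebesgue_on_rect /mrestr cell_out// measure0.
Qed.

Definition cell_vol k : R := \prod_i cut_len C i (k i).

Lemma cell_vol_gt0 k : 0 < cell_vol k.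
Proof. by apply: prodr_gt0 => i _; exact: cut_len_gt0. Qed.

Lemma measure_cell k : in_range k -> mu (cell C k) = (cell_vol k)%:E.
Proof.
move=> kN; rewrite /mu /= /lebesgue_on_rect /mrestr setIidl; last exact: cell_sub_rect.
rewrite cellE lebesgue_rV_hyperrect; last by move=> i; rewrite mxE ltW// cut_len_gt0.
by congr EFin; apply: eq_bigr => i _; rewrite mxE.
Qed.

Lemma cell_int_out u k : measurable_fun setT u -> ~ in_range k -> cell_int C u k = 0.
Proof.
move=> um kN; rewrite /cell_int /Rintegral null_set_integral//.
- exact: measurable_cell.
- exact/measurable_EFinP/measurable_funTS.
- exact: measure_cell_out.
Qed.

Lemma integrable_cell u k : mu.-integrable setT (EFin \o u) ->
  mu.-integrable (cell C k) (EFin \o u).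
Proof. by move=> iu; apply: (integrableS _ _ _ iu) => //; exact: measurable_cell. Qed.

Definition step_fun (s : ('I_d -> nat) -> R) x : R :=
  \sum_(k : cell_index C) s (idx k) * \1_(cell C (idx k)) x.

Lemma measurable_step_fun s : measurable_fun setT (step_fun s).
Proof.
apply: measurable_sum => k; apply: measurable_funM => //.
by apply: measurable_indic; exact: measurable_cell.
Qed.

Lemma step_funE s k x : in_range k -> cell C k x -> step_fun s x = s k.
Proof.
move=> /in_range_index[k' <-] kx; rewrite /step_fun (bigD1 k')//= indicE mem_set//= mulr1.
rewrite big1 ?addr0// => k'' /eqP k''k'; rewrite indicE memNset ?mulr0// => k''x.
apply: k''k'; apply/ffunP => i; apply/val_inj.
by have := cell_inj kx k''x => /(congr1 (fun f => f i)).
Qed.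

Lemma Rintegral_step s g : mu.-integrable setT (EFin \o g) ->
  \int[mu]_x (step_fun s x * g x) = \sum_(k : cell_index C) s (idx k) * cell_int C g (idx k).
Proof.
move=> ig.
have ik k : mu.-integrable setT (fun x => ((g x)%:E * (\1_(cell C k) x)%:E)%E).
  have := integrable_cell k ig; rewrite integrable_mkcond; last exact: measurable_cell.
  apply: eq_integrable => // x _; rewrite patchE indicE.
  by case: ifPn => _; rewrite ?mule1 ?mule0.
have ck k : (\int[mu]_x ((g x)%:E * (\1_(cell C k) x)%:E) = (cell_int C g k)%:E)%E.
  rewrite /cell_int /Rintegral fineK; last first.
    by apply: integrable_fin_num; [exact: measurable_cell|exact: integrable_cell].
  rewrite [RHS]integral_mkcond; apply: eq_integral => x _; rewrite patchE indicE.
  by case: ifPn => _; rewrite ?mule1 ?mule0.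
rewrite /Rintegral.
have -> : (fun x => (step_fun s x * g x)%:E) = (fun x => \sum_(k : cell_index C)
    ((s (idx k))%:E * ((g x)%:E * (\1_(cell C (idx k)) x)%:E))%E).
  apply/funext => x; rewrite /step_fun mulr_suml -sumEFin; apply: eq_bigr => k _.
  by rewrite -!EFinM -mulrA [_ * g x]mulrC.
rewrite integral_sum//; last by move=> k; exact: integrableZl.
rewrite (eq_bigr (fun k : cell_index C => (s (idx k) * cell_int C g (idx k))%:E)).
  by rewrite sumEFin.
by move=> k _; rewrite integralZl// ck.
Qed.

Lemma step_fun_le s x : `|step_fun s x| <= \sum_(k : cell_index C) `|s (idx k)|.
Proof.
rewrite (le_trans (ler_norm_sum _ _ _))//; apply: ler_sum => k _.
by rewrite normrM ler_piMr// indicE; case: (_ \in _); rewrite ?normr1 ?normr0.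
Qed.

Lemma integrable_step s g : mu.-integrable setT (EFin \o g) ->
  mu.-integrable setT (EFin \o (step_fun s \* g)).
Proof.
move=> ig; have -> : step_fun s \* g = g \* step_fun s.
  by apply/funext => x /=; rewrite mulrC.
apply: (integrable_rect_mul ig (measurable_step_fun s)); last first.
  by move=> x _; exact: step_fun_le.
by apply: sumr_ge0.
Qed.

(** The indices beyond the rectangle contribute 0 for measurable [u], since [cell_int] vanishes
    there. *)
Definition cut_avg u := step_fun (fun k => cell_int C u k / cell_vol k).

End cells.

Lemma continuous_integrable_hyperrect (R : realType) d (a l : 'rV[R]_d) (f : 'rV[R]_d -> R) :
  (forall i, 0 < l ord0 i) -> continuous f ->
  (@lebesgue_rV R d).-integrable (hyperrect a l) (EFin \o f).
Proof.
move=> l0 cf; have [M M0 hM] := continuous_hyperrect_bounded a l cf.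
apply: measurable_bounded_integrable.
- exact: measurable_hyperrect.
- by rewrite [ltLHS]lebesgue_rV_hyperrect ?ltry// => i; exact: ltW.
- by apply: measurable_funTS; exact: continuous_measurable_rV.
- exists M; split; first exact: num_real.
  move=> N MN x Hx /=; rewrite (le_trans _ (ltW MN))//; apply: hM => i.
  by have /andP[/ltW -> /ltW ->] := Hx i.
Qed.

Section test_field_facts.
Context (R : realType) (d : nat) (Omega : set 'rV[R]_d) (H : 'rV[R]_d -> 'rV[R]_d).
Hypothesis HT : tv_test_field Omega H.
Let ei (i : 'I_d) : 'rV[R]_d := delta_mx ord0 i.

Lemma tv_test_field_C1 i : [/\ continuous (fun x => H x ord0 i),
  (forall x, derivable (fun y => H y ord0 i) x (ei i)) &
  continuous ('D_(ei i) (fun y => H y ord0 i))].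
Proof.
by have [/(_ i 1%N) [cH /(_ i) [dH [cDH _]]] _ _] := HT.
Qed.

Lemma tv_test_field_le1 i x : `|H x ord0 i| <= 1.
Proof.
have [_ [K [_ KO HK]] H1] := HT.
have [Ox|nOx] := pselect (Omega x).
  apply: le_trans (H1 x Ox); rewrite [leRHS]/Num.norm/= mx_normrE.
  by apply: (@le_bigmax _ _ _ _ (fun ij => `|H x ij.1 ij.2|) (ord0, i)).
by rewrite HK ?mxE ?normr0// => /KO.
Qed.

Lemma tv_test_field_out i x : ~ Omega x -> H x ord0 i = 0.
Proof.
by have [_ [K [_ KO HK]] _] := HT => nOx; rewrite HK ?mxE// => /KO.
Qed.

Lemma continuous_divergence : continuous (divergence H).
Proof.
apply: (@Cdir_continuous R _ set0 0); apply: Cdir_sum => i; split=> //.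
by have [] := tv_test_field_C1 i.
Qed.

End test_field_facts.

(** * Averaging does not increase the total variation *)

Section averaging_decreases_tv.
Context (R : realType) (d : nat) (a l : 'rV[R]_d) (C : cutting a l).
Hypothesis l0 : forall i, 0 < l ord0 i.
Let Omega := hyperrect a l.
Let mu : {measure set 'rV[R]_d -> \bar R} := lebesgue_on_rect a l.

(* The average of a test field over the faces of the cells satisfies the discrete divergence
   theorem cell by cell, and is an admissible discrete field. *)
Lemma face_average (H : 'rV[R]_d -> 'rV[R]_d) : tv_test_field Omega H ->
  exists F : 'I_d -> ('I_d -> nat) -> R,
  [/\ forall i k, `|F i k| <= 1,
      forall i k, k i = 0%N -> F i k = 0,
      forall i j k, (ncell C j <= k j)%N -> F i k = 0 &
      forall i k, (\int[@lebesgue_rV R d]_(x in cell C k)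
           ('D_(delta_mx ord0 i) (fun y => H y ord0 i) x)%:E)%E =
         (cell_vol C k * ((F i (shift_at i k) - F i k) / cut_len C i (k i)))%:E].
Proof.
case: d a l C l0 @Omega @mu H => [|n] a' l' C' l'0 Om mu' H HT.
  by exists (fun _ _ => 0); split=> // [i k|[]//]; rewrite normr0.
pose lo (k : 'I_n.+1 -> nat) : 'rV[R]_n.+1 := \row_j cutpt C' j (k j).
pose ln (k : 'I_n.+1 -> nat) : 'rV[R]_n.+1 := \row_j cut_len C' j (k j).
pose face i k : set 'rV[R]_n := hyperrect (rV_del i (lo k)) (rV_del i (ln k)).
pose fvol (i : 'I_n.+1) (k : 'I_n.+1 -> nat) : R :=
  \prod_(j < n) cut_len C' (lift i j) (k (lift i j)).
have fvol0 i k : 0 < fvol i k by apply: prodr_gt0 => j _; exact: cut_len_gt0.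
have mface i k : measurable (face i k) by exact: measurable_hyperrect.
have face_vol i k : lebesgue_rV (face i k) = (fvol i k)%:E.
  rewrite lebesgue_rV_hyperrect; last by move=> j; rewrite !mxE ltW// cut_len_gt0.
  by congr EFin; apply: eq_bigr => j _; rewrite !mxE.
have face_shift i k : face i (shift_at i k) = face i k.
  by congr hyperrect; apply/rowP => j; rewrite !mxE shift_at_neq// eq_sym neq_lift.
have fvol_shift i k : fvol i (shift_at i k) = fvol i k.
  by apply: eq_bigr => j _; rewrite shift_at_neq// eq_sym neq_lift.
have cell_fvol i k : cell_vol C' k = cut_len C' i (k i) * fvol i k.
  by rewrite /cell_vol (bigD1_ord i).
pose G i t := fun y : 'rV[R]_n => H (rV_ins i (t, y)) ord0 i.
have mG i t : measurable_fun setT (G i t).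
  have [cH _ _] := tv_test_field_C1 HT i.
  apply: (measurableT_comp (continuous_measurable_rV cH)).
  apply: measurableT_comp; first exact: measurable_rV_ins.
  by apply/measurable_fun_pairP; split; [exact: measurable_cst|exact: measurable_id].
have iG i k t : (@lebesgue_rV R n).-integrable (face i k) (EFin \o G i t).
  apply: measurable_bounded_integrable => //.
  - by rewrite [ltLHS]face_vol ltry.
  - exact: measurable_funTS.
  - exists 1; split; first exact: num_real.
    by move=> N N1 y _ /=; rewrite (le_trans (tv_test_field_le1 HT _ _))// ltW.
(* The average over the lower face of the cell [k] along the axis [i]. The upper face is the lower
   one of [shift_at i k] and has the same cross-section. *)
pose F i k := (fvol i k)^-1 * \int[@lebesgue_rV R n]_(y in face i k) G i (cutpt C' i (k i)) y.
have F0 i k : (forall y, face i k y -> ~ Om (rV_ins i (cutpt C' i (k i), y))) -> F i k = 0.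
  move=> h; rewrite /F (@eq_Rintegral _ _ _ _ _ (cst 0)) ?Rintegral_cst// ?mul0r ?mulr0//.
  by move=> y; rewrite inE => /h yO; exact: (tv_test_field_out HT).
exists F; split.
- move=> i k; rewrite /F normrM gtr0_norm ?invr_gt0// ler_pdivrMl// mulr1.
  rewrite (le_trans (le_normr_Rintegral _ (iG _ _ _)))//.
  have -> : fvol i k = \int[@lebesgue_rV R n]_(y in face i k) 1.
    by rewrite Rintegral_cst// mul1r [X in fine X]face_vol.
  apply: le_Rintegral => //.
  + exact: (integrable_abse (iG _ _ _)).
  + apply: measurable_bounded_integrable => //; first by rewrite [ltLHS]face_vol ltry.
    by exists 1; split; [exact: num_real|move=> N N1 x _ /=; rewrite normr1 ltW].
  + by move=> y _; exact: (tv_test_field_le1 HT).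
- move=> i k k0; apply: F0 => y _ /(_ i); rewrite rV_ins_at/= k0 cut0.
  by rewrite ltxx.
- move=> i j k kN; apply: F0 => y yf Oy; have /andP[_] := Oy j.
  case: (unliftP i j) => [j' jE|jE].
    rewrite jE rV_ins_lift/=; have /andP[+ _] := yf j'; rewrite !mxE -jE.
    move=> /lt_trans H1 /H1; rewrite -(cut_ncell C').
    by rewrite ltNge cut_le.
  rewrite jE rV_ins_at/= -(cut_ncell C') ltNge cut_le//.
  by rewrite -jE.
- move=> i k; have [cH dH cDH] := tv_test_field_C1 HT i.
  rewrite cellE integral_partial//; last by move=> j; rewrite mxE cut_len_gt0.
  have -> : (\row_i0 cutpt C' i0 (k i0)) ord0 i + (\row_i0 cut_len C' i0 (k i0)) ord0 i =
      cutpt C' i (k i).+1 by rewrite !mxE addrC subrK.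
  have -> : (\row_i0 cutpt C' i0 (k i0)) ord0 i = cutpt C' i (k i) by rewrite mxE.
  rewrite -/(face i k) (cell_fvol i) /F face_shift fvol_shift shift_atE -mulrBr.
  rewrite -RintegralB//.
  have cl0 := cut_len_gt0 C' i (k i); have fv0 := fvol0 i k.
  rewrite (_ : _ * _ = \int[@lebesgue_rV R n]_(y in face i k)
     (G i (cutpt C' i (k i).+1) y - G i (cutpt C' i (k i)) y)); last first.
    by field; rewrite !gt_eqF.
  rewrite /Rintegral fineK//.
  apply: (integrable_fin_num (mface i k)).
  have := integrableB (mface i k) (iG i k (cutpt C' i (k i).+1)) (iG i k (cutpt C' i (k i))).
  by apply: eq_integrable => // y _ /=; rewrite EFinB.
Qed.

(** Pairing the average of [u] with [divergence H] amounts to pairing [u] with the cell averages of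
    [divergence H]. By the divergence theorem on each cell these are the discrete divergence of the
    face averages of [H]. *)
Theorem aniso_tv_cut_avg u : u \in Lfun mu 2%:E ->
  (aniso_tv Omega (cut_avg C u) <= aniso_tv Omega u)%E.
Proof.
move=> u2; have um := Lfun_measurable u2.
apply: ge_ereal_sup => _ [H HT <-].
have [F [F1 F0 FN FD]] := face_average HT.
apply: le_trans (discrete_tv_le l0 u2 F1 F0 FN).
have mdiv := continuous_measurable_rV (continuous_divergence HT).
have idiv : mu.-integrable setT (EFin \o divergence H).
  have [M M0 hM] := continuous_hyperrect_bounded a l (continuous_divergence HT).
  apply: (@integrable_rect_bounded _ _ _ _ l0 _ M) => // x Ox; apply: hM => i.
  by have /andP[/ltW -> /ltW ->] := Ox i.
rewrite integral_rectE; last first.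
  by apply/measurable_EFinP/measurable_funM => //; exact: measurable_step_fun.
pose s k := cell_int C u k / cell_vol C k.
have isd := integrable_step C s idiv.
rewrite -[leLHS]fineK; last exact: (integrable_fin_num _ isd).
have := Rintegral_step C s idiv; rewrite /Rintegral -/(cut_avg C u) => ->.
rewrite lee_fin exchange_big/= le_eqVlt; apply/orP; left; apply/eqP.
apply: eq_bigr => k _; rewrite /s.
have [kN|kN] := pselect (in_range C (idx k)); last first.
  by rewrite cell_int_out// !mul0r big1// => i _; rewrite mul0r.
rewrite -mulr_sumr -mulrA; congr (_ * _).
have cv0 : cell_vol C (idx k) != 0 by rewrite gt_eqF// cell_vol_gt0.
apply: (mulfI cv0); rewrite mulrA divff// mul1r mulr_sumr /cell_int /Rintegral.
rewrite (_ : (\int[mu]_(x in _) _)%E = (\sum_i cell_vol C (idx k) *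
    ((F i (shift_at i (idx k)) - F i (idx k)) / cut_len C i (idx k i)))%:E)//.
transitivity (\int[@lebesgue_rV R d]_(x in cell C (idx k)) (divergence H x)%:E)%E.
  apply: eq_measure_integral => A mA AC.
  rewrite /mu /= /lebesgue_on_rect /mrestr setIidl//.
  exact: subset_trans (cell_sub_rect kN).
under eq_integral do rewrite /divergence -sumEFin.
rewrite integral_sum//; last 2 first.
- exact: measurable_cell.
- move=> i; rewrite cellE; have [_ _ cD] := tv_test_field_C1 HT i.
  by apply: continuous_integrable_hyperrect => // j; rewrite mxE cut_len_gt0.
by rewrite -sumEFin; apply: eq_bigr => i _; exact: FD.
Qed.

End averaging_decreases_tv.

(** * Deviation from averages over blocks of cells *)

Section block_averaging.
Context (R : realType) (d : nat) (a l : 'rV[R]_d) (C : cutting a l).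
Hypothesis l0 : forall i, 0 < l ord0 i.
Let Omega := hyperrect a l.
Let mu : {measure set 'rV[R]_d -> \bar R} := lebesgue_on_rect a l.
Implicit Types (i j : 'I_d) (x : 'rV[R]_d) (k : 'I_d -> nat) (u : 'rV[R]_d -> R).

Variable e : 'I_d -> rel nat.
Hypothesis e_refl : forall i, reflexive (e i).
Hypothesis e_sym : forall i, symmetric (e i).
Hypothesis e_trans : forall i, transitive (e i).
Hypothesis e_convex : forall i m n p, (m <= n)%N -> (n <= p)%N -> e i m p -> e i m n.
Hypothesis e_range : forall i m n, e i m n -> (m < ncell C i)%N -> (n < ncell C i)%N.

Let M := ncells C.

Definition block_len i n : R := \sum_(m < M | e i m n) cut_len C i m.

(** The weight of the cell [n] in the average over the block of [m], along the single axis [i]. *)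
Definition block_kernel i m n : R :=
  if e i m n then cut_len C i n / block_len i n else 0.

(** The discrete primitive, in the row index, of the identity minus the averaging kernel. Its
    smallness measures the distance between a step function and its average in the dual sense. *)
Definition kernel_primitive i K n : R :=
  \sum_(m < K) cut_len C i m * ((m == n :> nat)%:R - block_kernel i m n).

Lemma block_len_eq i m n : e i m n -> block_len i m = block_len i n.
Proof.
move=> emn; apply: eq_bigl => q; apply/idP/idP => h.
  exact: (@e_trans i m).
by apply: (@e_trans i n) => //; rewrite e_sym.
Qed.

Lemma block_len_gt0 i n : (n < M)%N -> 0 < block_len i n.
Proof.
move=> nM; rewrite /block_len (bigD1 (Ordinal nM)) /= ?e_refl//.
apply: ltr_pwDl; first exact: cut_len_gt0.
by apply: sumr_ge0 => q _; rewrite ltW// cut_len_gt0.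
Qed.

Lemma block_len_ge0 i n : 0 <= block_len i n.
Proof. by apply: sumr_ge0 => q _; rewrite ltW// cut_len_gt0. Qed.

Lemma block_kernel_ge0 i m n : 0 <= block_kernel i m n.
Proof.
rewrite /block_kernel; case: ifP => // _.
by rewrite divr_ge0 ?block_len_ge0// ltW// cut_len_gt0.
Qed.

Lemma sum_block_kernel_le1 i m : \sum_(n < M) block_kernel i m n <= 1.
Proof.
rewrite /block_kernel -big_mkcond/=.
have -> : \sum_(n < M | e i m n) cut_len C i n / block_len i n = block_len i m / block_len i m.
  rewrite mulr_suml [RHS](eq_bigl (fun n : 'I_M => e i m n)); last by move=> n; rewrite e_sym.
  by apply: eq_bigr => n emn; rewrite (block_len_eq emn).
by have [->|b0] := eqVneq (block_len i m) 0; rewrite ?mul0r// divff.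
Qed.

Lemma sum_eqn_le1 m : \sum_(n < M) (m == n :> nat)%:R <= 1 :> R.
Proof.
have [mM|Mm] := ltnP m M.
  rewrite (bigD1 (Ordinal mM))//= eqxx big1 ?addr0// => n nm.
  by rewrite eq_sym (_ : (_ == _) = false)//; apply: negbTE.
by rewrite big1// => n _; rewrite gtn_eqF// (leq_trans (ltn_ord n)).
Qed.

Lemma kernel_primitiveS i K n : kernel_primitive i K.+1 n =
  kernel_primitive i K n + cut_len C i K * ((K == n)%:R - block_kernel i K n).
Proof. by rewrite /kernel_primitive big_ord_recr. Qed.

Lemma kernel_primitive0 i n : kernel_primitive i 0 n = 0.
Proof. by rewrite /kernel_primitive big_ord0. Qed.

(** The bracket is 0 or 1 minus the fraction of the block lying before [K]. Both the bound by one
    cell length and the vanishing outside the block are read off from this form. *)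
Lemma kernel_primitiveE i K n : kernel_primitive i K n =
  cut_len C i n * ((n < K)%:R - (\sum_(m < K | e i m n) cut_len C i m) / block_len i n).
Proof.
rewrite /kernel_primitive mulrBr; under eq_bigr do rewrite mulrBr.
rewrite sumrB; congr (_ - _).
  have [nK|Kn] := ltnP n K.
    rewrite (bigD1 (Ordinal nK))//= eqxx big1 ?addr0// => m mn.
    by rewrite (_ : (_ == _) = false) ?mulr0//; apply: negbTE.
  by rewrite mulr0 big1// => m _; rewrite ltn_eqF ?mulr0// (leq_trans (ltn_ord m)).
rewrite mulr_suml mulr_sumr [RHS]big_mkcond; apply: eq_bigr => m _.
by rewrite /block_kernel; case: ifP => _; rewrite ?mulr0// mulrCA.
Qed.

Lemma partial_block_len i K n : (K <= M)%N ->
  0 <= \sum_(m < K | e i m n) cut_len C i m <= block_len i n.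
Proof.
move=> KM; rewrite sumr_ge0/=; last by move=> q _; rewrite ltW// cut_len_gt0.
rewrite /block_len (big_ord_widen_cond M (fun m => e i m n) (fun m => cut_len C i m))//.
rewrite [leRHS](bigID (fun m : 'I_M => (m < K)%N))/= lerDl sumr_ge0// => q _.
by rewrite ltW// cut_len_gt0.
Qed.

Lemma kernel_primitive_le i K n : (K <= M)%N -> (n < M)%N ->
  `|kernel_primitive i K n| <= cut_len C i n.
Proof.
move=> KM nM; rewrite kernel_primitiveE normrM gtr0_norm ?cut_len_gt0//.
rewrite ler_piMr// ?(ltW (cut_len_gt0 _ _ _))//.
have b0 := block_len_gt0 i nM; have /andP[p0 pb] := partial_block_len i n KM.
have q0 : 0 <= (\sum_(m < K | e i m n) cut_len C i m) / block_len i n by rewrite divr_ge0// ltW.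
have q1 : (\sum_(m < K | e i m n) cut_len C i m) / block_len i n <= 1.
  by rewrite ler_pdivrMr// mul1r.
by rewrite ler_norml; case: (n < K)%N => /=; apply/andP; split; lra.
Qed.

(** Blocks are convex, so a [K] outside the block of [n] has the whole block before it, where the
    bracket is [1 - 1], or none of it, where the bracket is [0 - 0]. *)
Lemma kernel_primitive_out i K n : (K < M)%N -> (n < M)%N -> ~~ e i K n ->
  kernel_primitive i K n = 0.
Proof.
move=> KM nM eKn; rewrite kernel_primitiveE.
have b0 := block_len_gt0 i nM.
have [nK|Kn] := ltnP n K.
  rewrite (_ : \sum_(m < K | _) _ = block_len i n) ?divff ?gt_eqF// ?subrr ?mulr0//.
  rewrite /block_len
    (big_ord_widen_cond M (fun m => e i m n) (fun m => cut_len C i m)) ?(ltnW KM)//.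
  apply: eq_bigl => m; case emn : (e i m n) => //=.
  rewrite ltnNge; apply/negP => Km; move: eKn; rewrite e_sym.
  by rewrite (@e_convex i n K m) ?(ltnW nK)// e_sym.
rewrite big1 ?mul0r ?subrr ?mulr0// => m emn; exfalso; move: eKn.
have := @e_convex i m K n (ltnW (ltn_ord m)) Kn emn.
rewrite e_sym => eKm; by rewrite (@e_trans i m).
Qed.

Lemma kernel_primitive_full i K n : (ncell C i <= K)%N -> (K <= M)%N -> (n < ncell C i)%N ->
  kernel_primitive i K n = 0.
Proof.
move=> NK KM nN; rewrite kernel_primitiveE (leq_trans nN NK).
have nM := leq_trans nN (ncell_le C i); have b0 := block_len_gt0 i nM.
rewrite (_ : \sum_(m < K | _) _ = block_len i n) ?divff ?gt_eqF// ?subrr ?mulr0//.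
rewrite /block_len (big_ord_widen_cond M (fun m => e i m n) (fun m => cut_len C i m))//.
apply: eq_bigl => m; case emn : (e i m n) => //=.
by rewrite (leq_trans _ NK)// (e_range _ nN)// e_sym.
Qed.

(** The origin of the factor [h]: only the columns in the block of [K] contribute, each at most its
    own cell length. *)
Lemma sum_kernel_primitive_le i K : (K < M)%N ->
  \sum_(n < M) `|kernel_primitive i K n| <= block_len i K.
Proof.
move=> KM; rewrite /block_len [leRHS]big_mkcond; apply: ler_sum => n _.
case: ifPn => enK; first by rewrite kernel_primitive_le// ltnW.
by rewrite kernel_primitive_out ?normr0// e_sym.
Qed.

Variable s : ('I_d -> nat) -> R.
Hypothesis s_le1 : forall k, `|s k| <= 1.
Hypothesis s_out : forall k, ~ in_range C k -> s k = 0.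

(* Averaging in the first [t] coordinates only; [telescoping_field i] is the flux whose difference
   quotient along the axis [i] is the step from [t = i] to [t = i.+1]. *)
Definition partial_avg (t : nat) k : R := \sum_(k' : cell_index C)
  (\prod_(j < d) (if (j < t)%N then block_kernel j (k j) (idx k' j) else (k j == idx k' j)%:R))
    * s (idx k').

Definition telescoping_field i k : R := \sum_(k' : cell_index C)
  (\prod_(j < d) (if j == i then kernel_primitive i (k i) (idx k' i)
     else if (j < i)%N then block_kernel j (k j) (idx k' j) else (k j == idx k' j)%:R))
    * s (idx k').

(** Among the factors only the primitive depends on [k i], and its increment is the cell length
    times the identity minus the kernel, which are the factors at [i] of the two partial
    averages. *)
Lemma telescoping_field_diff i k :
  telescoping_field i (shift_at i k) - telescoping_field i k =
  cut_len C i (k i) * (partial_avg i k - partial_avg i.+1 k).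
Proof.
rewrite /telescoping_field /partial_avg -!sumrB mulr_sumr; apply: eq_bigr => k' _.
rewrite -!mulrBl mulrA; congr (_ * _).
have E1 : \prod_(j < d | j != i) (if j == i then kernel_primitive i (shift_at i k i) (idx k' i)
     else if (j < i)%N then block_kernel j (shift_at i k j) (idx k' j)
     else (shift_at i k j == idx k' j)%:R)
  = \prod_(j < d | j != i)
      (if (j < i)%N then block_kernel j (k j) (idx k' j) else (k j == idx k' j)%:R).
  by apply: eq_bigr => j ji; rewrite (negbTE ji) shift_at_neq.
have E2 : \prod_(j < d | j != i) (if j == i then kernel_primitive i (k i) (idx k' i)
     else if (j < i)%N then block_kernel j (k j) (idx k' j) else (k j == idx k' j)%:R)
  = \prod_(j < d | j != i)
      (if (j < i)%N then block_kernel j (k j) (idx k' j) else (k j == idx k' j)%:R).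
  by apply: eq_bigr => j ji; rewrite (negbTE ji).
have E3 : \prod_(j < d | j != i)
      (if (j < i.+1)%N then block_kernel j (k j) (idx k' j) else (k j == idx k' j)%:R)
  = \prod_(j < d | j != i)
      (if (j < i)%N then block_kernel j (k j) (idx k' j) else (k j == idx k' j)%:R).
  apply: eq_bigr => j ji; congr (if _ then _ else _).
  by rewrite ltnS leq_eqVlt (_ : (j == i :> nat) = false)//; apply: negbTE.
rewrite ![\prod_(j < d) _](bigD1 i)//= !eqxx E1 E2 E3 shift_atE kernel_primitiveS ltnn ltnSn.
ring.
Qed.

Lemma partial_avg0 (k : cell_index C) : partial_avg 0 (idx k) = s (idx k).
Proof.
rewrite /partial_avg (bigD1 k)//= [X in X * _]big1 ?mul1r; last by move=> j _; rewrite eqxx.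
rewrite big1 ?addr0// => k' k'k.
have /existsP[j kj] : [exists j, k' j != k j].
  apply: contraR k'k; rewrite negb_exists => /forallP h.
  by apply/eqP/ffunP => j; have /negPn/eqP := h j.
rewrite (bigD1 j)//= (_ : (idx k j == idx k' j) = false) ?mul0r//.
by apply: negbTE; rewrite eq_sym.
Qed.

Lemma telescoping_field0 i k : k i = 0%N -> telescoping_field i k = 0.
Proof.
by move=> ki; apply: big1 => k' _; rewrite (bigD1 i)//= eqxx ki kernel_primitive0 !mul0r.
Qed.

(** Let [k j] lie beyond the rectangle. Along [j = i] the primitive has passed every block in range;
    along any other axis neither the kernel nor the identity links [k j] to a cell on which [s] may
    be nonzero. *)
Lemma telescoping_field_out i j k : (ncell C j <= k j)%N -> (k i <= M)%N ->
  telescoping_field i k = 0.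
Proof.
move=> Nk kM; apply: big1 => k' _.
have [k'N|/s_out ->] := pselect (in_range C (idx k')); last by rewrite mulr0.
rewrite (bigD1 j)//=; case: eqVneq => [ji|_].
  by subst j; rewrite kernel_primitive_full ?mul0r.
case: ifP => _; last first.
  rewrite (_ : (_ == _) = false) ?mul0r//; apply/negP => /eqP kk.
  by have := k'N j; rewrite -kk ltnNge Nk.
rewrite /block_kernel; case: ifP => ek; rewrite ?mul0r//.
have ek' : e j (idx k' j) (k j) by rewrite e_sym.
by have := e_range ek' (k'N j); rewrite ltnNge Nk.
Qed.

(** After [s] is bounded by 1 the sum factors over the axes: the axis [i] contributes a block
    length, every other axis a row sum of at most 1. *)
Lemma telescoping_field_le i k : (k i < M)%N -> `|telescoping_field i k| <= block_len i (k i).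
Proof.
move=> kM; rewrite (le_trans (ler_norm_sum _ _ _))//.
pose w j (m n : nat) : R := if j == i then `|kernel_primitive i m n|
     else if (j < i)%N then block_kernel j m n else (m == n)%:R.
apply: (@le_trans _ _ (\sum_(k' : cell_index C) \prod_j w j (k j) (k' j))).
  apply: ler_sum => k' _; rewrite normrM -[leRHS]mulr1 ler_pM//.
  rewrite normr_prod; apply: ler_prod => j _; rewrite normr_ge0/= /w.
  case: eqVneq => [->//|_]; case: ifP => _; last by rewrite ger0_norm// ler0n.
  by rewrite ger0_norm// block_kernel_ge0.
rewrite -(@bigA_distr_bigA _ _ _ _ _ _ _ (fun j (m : 'I_M) => w j (k j) m)).
rewrite (bigD1 i)//= -[leRHS]mulr1 ler_pM//.
- by apply: sumr_ge0 => n _; rewrite /w eqxx.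
- apply: prodr_ge0 => j _; apply: sumr_ge0 => n _; rewrite /w; case: ifP => // _.
  by case: ifP => _; rewrite ?ler0n// block_kernel_ge0.
- by rewrite /w eqxx; exact: sum_kernel_primitive_le.
apply: (@le_trans _ _ (\prod_(j < d | j != i) (1 : R))); last by rewrite big1.
apply: ler_prod => j ji; rewrite /w (negbTE ji).
case: (j < i)%N; last first.
  by rewrite sumr_ge0 ?sum_eqn_le1.
by rewrite sum_block_kernel_le1 andbT sumr_ge0// => n _; exact: block_kernel_ge0.
Qed.

(** In dimension one the field is a single sum, and each column is at most one cell length. For a
    sign supported on a union of cells the bound is the measure of that union, which is what a
    pointwise estimate of the deviation requires. *)
Lemma telescoping_field_le_vol i k : (d = 1)%N -> (k i <= M)%N ->
  `|telescoping_field i k| <= \sum_(k' : cell_index C) `|s (idx k')| * cell_vol C (idx k').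
Proof.
move=> d1 kM; rewrite (le_trans (ler_norm_sum _ _ _))//; apply: ler_sum => k' _.
have allj (j : 'I_d) : j = i.
  have j1 : (j < 1)%N by rewrite -d1 ltn_ord.
  have i1 : (i < 1)%N by rewrite -d1 ltn_ord.
  by apply/val_inj; move: j1 i1; rewrite !ltnS !leqn0 => /eqP j0 /eqP i0 /=; rewrite j0 i0.
rewrite normrM mulrC ler_wpM2l// normr_prod /cell_vol; apply: ler_prod => j _.
by rewrite normr_ge0/= (allj j) eqxx kernel_primitive_le//; exact: ltn_ord.
Qed.

Variables (u : 'rV[R]_d -> R) (B : R).
Hypothesis u2 : u \in Lfun mu 2%:E.
Hypothesis B0 : 0 < B.
Hypothesis fieldB : forall i k, (k i < M)%N -> `|telescoping_field i k| <= B.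

Lemma block_deviation_le :
  ((\sum_(k : cell_index C) cell_int C u (idx k) * (s (idx k) - partial_avg d (idx k)))%:E
   <= B%:E * aniso_tv Omega u)%E.
Proof.
(* The cut-off at [M] makes the bound hold for every index. It leaves the differences over
   [cell_index] unchanged, because at [k i = M] the field is 0 anyway. *)
pose F i k := if (k i < M)%N then B^-1 * telescoping_field i k else 0.
have F1 i k : `|F i k| <= 1.
  rewrite /F; case: ifPn => kM; last by rewrite normr0.
  by rewrite normrM gtr0_norm ?invr_gt0// ler_pdivrMl// mulr1 fieldB.
have F0 i k : k i = 0%N -> F i k = 0.
  by move=> ki; rewrite /F telescoping_field0// mulr0 if_same.
have FN i j k : (ncell C j <= k j)%N -> F i k = 0.
  by move=> Nk; rewrite /F; case: ifPn => // kM; rewrite (telescoping_field_out Nk (ltnW kM)) mulr0.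
have FE i (k : cell_index C) : F i (shift_at i (idx k)) - F i (idx k) =
    B^-1 * (cut_len C i (idx k i) * (partial_avg i (idx k) - partial_avg i.+1 (idx k))).
  rewrite -telescoping_field_diff mulrBr {2}/F ltn_ord; congr (_ - _).
  rewrite /F; case: ifPn => // h; rewrite (@telescoping_field_out i i) ?mulr0//.
    by rewrite (leq_trans (ncell_le C i))// leqNgt.
  by rewrite shift_atE ltn_ord.
have := discrete_tv_le l0 u2 F1 F0 FN.
set X := (\sum_i _).
set Y := (\sum_(k : cell_index C) _).
have -> : X = B^-1 * Y.
  rewrite /X /Y exchange_big/= mulr_sumr; apply: eq_bigr => k _.
  rewrite -mulr_sumr mulrCA; congr (_ * _); rewrite -partial_avg0.
  under eq_bigr do rewrite FE.
  transitivity (\sum_(i < d) B^-1 * (partial_avg i (idx k) - partial_avg i.+1 (idx k))).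
    apply: eq_bigr => i _; rewrite -mulrA; congr (_ * _); rewrite mulrAC divff ?mul1r//.
    by rewrite gt_eqF// cut_len_gt0.
  rewrite -mulr_sumr; congr (_ * _).
  rewrite -(big_mkord predT (fun i : nat => partial_avg i (idx k) - partial_avg i.+1 (idx k))).
  rewrite -[LHS]opprK -sumrN.
  under eq_bigr do rewrite opprB.
  by rewrite telescope_sumr// opprB.
by rewrite EFinM -lee_pdivlMl// ?invr_gt0// invrK.
Qed.

Variable Au : 'rV[R]_d -> R.
Hypothesis AuE : forall k x, in_range C k -> cell C k x ->
  Au x = (\sum_(k' : cell_index C | [forall i, e i (idx k' i) (k i)]) cell_int C u (idx k')) /
         \prod_i block_len i (k i).

(** The block average is self-adjoint: the kernel is a cell length over a block length, so averaging
    [s] against the integrals of [u] is averaging [u] against [s]. *)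
Lemma partial_avg_full : \sum_(k : cell_index C) cell_int C u (idx k) * partial_avg d (idx k) =
  \sum_(k : cell_index C) s (idx k) * cell_int C Au (idx k).
Proof.
rewrite /partial_avg; under eq_bigr do rewrite mulr_sumr.
rewrite exchange_big/=; apply: eq_bigr => k' _.
have [kN|/s_out ->] := pselect (in_range C (idx k')); last first.
  by rewrite mul0r big1// => k _; rewrite !mulr0.
under eq_bigr do rewrite mulrA.
rewrite -mulr_suml mulrC; congr (_ * _).
have -> : cell_int C Au (idx k') = cell_vol C (idx k') *
   ((\sum_(k : cell_index C | [forall i, e i (idx k i) (idx k' i)]) cell_int C u (idx k)) /
         \prod_i block_len i (idx k' i)).
  rewrite /cell_int (@eq_Rintegral _ _ _ _ _ (cst ((\sum_(k : cell_index C |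
    [forall i, e i (idx k i) (idx k' i)]) cell_int C u (idx k)) / \prod_i block_len i (idx k' i)))).
    rewrite Rintegral_cst; last exact: measurable_cell.
    by rewrite [X in fine X]measure_cell//= mulrC.
  by move=> x; rewrite inE => kx; exact: AuE.
rewrite mulrCA mulr_suml [RHS]big_mkcond; apply: eq_bigr => k _.
case: ifPn => [/forallP ek|]; last first.
  rewrite negb_forall => /existsP[i /negbTE ei].
  by rewrite (bigD1 i)//= ltn_ord /block_kernel ei mul0r mulr0.
congr (_ * _); rewrite /cell_vol -prodf_div; apply: eq_bigr => i _.
by rewrite ltn_ord /block_kernel ek.
Qed.

End block_averaging.

(** * Cuttings through prescribed points *)

Lemma exists_cuts (R : realType) (a b : R) (Z : seq R) : a < b ->
  exists (c : nat -> R) (N : nat),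
  [/\ forall m, c m < c m.+1, c 0 = a, c N = b,
      forall z, z \in Z -> a < z < b -> exists2 m, (m < N)%N & c m = z &
      forall m, (0 < m)%N -> (m < N)%N -> c m \in Z].
Proof.
move=> ab.
(* Both endpoints and the admissible points of [Z], in increasing order; beyond [b] the sequence [c]
   continues with unit steps. *)
pose s := sort <=%R (undup (a :: b :: [seq z <- Z | a < z < b])).
have ms z : (z \in s) = [|| z == a, z == b | (z \in Z) && (a < z < b)].
  by rewrite mem_sort mem_undup !inE mem_filter [X in [|| _, _ | X]]andbC.
have ss : sorted <%R s.
  by rewrite lt_sorted_uniq_le sort_uniq undup_uniq sort_le_sorted.
have as_ : a \in s by rewrite ms eqxx.
have bs : b \in s by rewrite ms eqxx orbT.
have sab z : z \in s -> a <= z <= b.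
  rewrite ms => /or3P[/eqP->|/eqP->|/andP[_ /andP[/ltW -> /ltW ->]]//]; rewrite lexx ?andbT/=.
    exact: ltW.
  exact: ltW.
have s0 : (0 < size s)%N by case: (s) as_.
pose N := (size s).-1.
have sN : size s = N.+1 by rewrite /N prednK.
pose c m := if (m <= N)%N then nth 0 s m else b + (m - N)%:R.
have cs m : (m <= N)%N -> c m \in s by move=> mN; rewrite /c mN mem_nth// sN ltnS.
have csE z : z \in s -> exists2 m, (m <= N)%N & c m = z.
  move=> zs; exists (index z s); first by rewrite -ltnS -sN index_mem.
  by rewrite /c -ltnS -sN index_mem zs nth_index.
have clt m n : (m < n)%N -> (n <= N)%N -> c m < c n.
  move=> mn nN; rewrite /c nN (leq_trans (ltnW mn) nN).
  by rewrite lt_sorted_ltn_nth// inE sN ltnS// (leq_trans (ltnW mn) nN).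
have c0 : c 0 = a.
  have [m mN cm] := csE _ as_; have [m0|m0] := posnP m; first by rewrite -cm m0.
  have := clt _ _ m0 mN; rewrite cm => h.
  by have /andP[] := sab _ (cs 0%N (leq0n _)); rewrite leNgt h.
have cN : c N = b.
  have [m mN cm] := csE _ bs.
  move: mN; rewrite leq_eqVlt => /predU1P[<-//|mN].
  have := clt _ _ mN (leqnn _); rewrite cm => h.
  by have /andP[_] := sab _ (cs N (leqnn _)); rewrite leNgt h.
exists c, N; split=> //.
- move=> m; have [mN|Nm] := ltnP m N; first exact: clt.
  rewrite {2}/c leqNgt ltnS Nm/=; move: Nm; rewrite leq_eqVlt => /predU1P[<-|Nm].
    by rewrite cN ltrDl ltr0n subn_gt0.
  by rewrite /c leqNgt Nm/= ltrD2l ltr_nat ltn_sub2r// ltnW.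
- move=> z zZ zab; have [|m] := csE z; first by rewrite ms zZ zab !orbT.
  rewrite leq_eqVlt => /predU1P[->|mN] cm; last by exists m.
  by move: zab; rewrite -cm cN ltxx andbF.
- move=> m m0 mN; have := cs m (ltnW mN); rewrite ms => /or3P[/eqP ca|/eqP cb|/andP[]//].
    by have := clt _ _ m0 (ltnW mN); rewrite c0 ca ltxx.
  by have := clt _ _ mN (leqnn _); rewrite cN cb ltxx.
Qed.

(** The first clause lets a cutting refine a grid; the second one, which excludes further interior
    cut points, makes its cells coincide with those of the grid. *)
Lemma exists_cutting (R : realType) d (a l : 'rV[R]_d) (Z : 'I_d -> seq R) :
  (forall i, 0 < l ord0 i) ->
  exists C : cutting a l,
   (forall i z, z \in Z i -> a ord0 i < z < a ord0 i + l ord0 i ->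
      exists2 m, (m < ncell C i)%N & cutpt C i m = z) /\
   (forall i m, (0 < m)%N -> (m < ncell C i)%N -> cutpt C i m \in Z i).
Proof.
move=> l0.
have h i : exists cN : (nat -> R) * nat,
  [/\ forall m, cN.1 m < cN.1 m.+1, cN.1 0 = a ord0 i, cN.1 cN.2 = a ord0 i + l ord0 i,
      forall z, z \in Z i -> a ord0 i < z < a ord0 i + l ord0 i ->
        exists2 m, (m < cN.2)%N & cN.1 m = z &
      forall m, (0 < m)%N -> (m < cN.2)%N -> cN.1 m \in Z i].
  have [|c [N H]] := @exists_cuts R (a ord0 i) (a ord0 i + l ord0 i) (Z i).
    by rewrite ltrDl.
  by exists (c, N).
have /choice[f hf] := h.
exists (@Cutting R d a l (fun i => (f i).1) (fun i => (f i).2)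
  (fun i => let: And5 p _ _ _ _ := hf i in p)
  (fun i => let: And5 _ p _ _ _ := hf i in p)
  (fun i => let: And5 _ _ p _ _ := hf i in p)).
by split=> i; have [] := hf i.
Qed.

Lemma connected_hyperrect (R : realType) d (b m : 'rV[R]_d) : connected (hyperrect b m).
Proof.
have [->|/set0P[x bx]] := eqVneq (hyperrect b m) set0; first exact: connected0.
pose seg y : set 'rV[R]_d := (fun t : R => x + t *: (y - x)) @` `[0, 1].
have -> : hyperrect b m = \bigcup_(y in hyperrect b m) seg y.
  apply/seteqP; split=> y.
    move=> my; exists y => //; exists 1; first by rewrite /= in_itv/= ler01 lexx.
    by rewrite scale1r addrC subrK.
  move=> [z bz [t /=]]; rewrite in_itv/= => /andP[t0 t1] <- i; rewrite !mxE.
  have /andP[] := bx i; have /andP[] := bz i.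
  move: (x ord0 i) (z ord0 i) (b ord0 i) (m ord0 i) => x1 z1 b1 m1 h1 h2 h3 h4.
  have p1 : 0 <= t * (z1 - b1) by rewrite mulr_ge0// subr_ge0 ltW.
  have p2 : 0 <= (1 - t) * (x1 - b1) by rewrite mulr_ge0// subr_ge0// ltW.
  have p3 : 0 <= t * (b1 + m1 - z1) by rewrite mulr_ge0// subr_ge0 ltW.
  have p4 : 0 <= (1 - t) * (b1 + m1 - x1) by rewrite mulr_ge0// subr_ge0// ltW.
  (* Strict inequalities need a positive convex weight: [1 - t] in the first case, [t] in the
     second. *)
  have [t12|t12] := lerP t 2^-1.
    have p5 : 0 < (1 - t) * (x1 - b1) by rewrite mulr_gt0//; lra.
    have p6 : 0 < (1 - t) * (b1 + m1 - x1) by rewrite mulr_gt0//; lra.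
    by apply/andP; split; lra.
  have p5 : 0 < t * (z1 - b1) by rewrite mulr_gt0//; lra.
  have p6 : 0 < t * (b1 + m1 - z1) by rewrite mulr_gt0//; lra.
  by apply/andP; split; lra.
apply: bigcup_connected.
  exists x => y _; exists 0; first by rewrite /= in_itv/= lexx ler01.
  by rewrite scale0r addr0.
move=> y _; apply: connected_continuous_connected; first exact: segment_connected.
apply: continuous_subspaceT => t; apply: cvgD; first exact: cvg_cst.
by apply: cvgZr_tmp; exact: cvg_id.
Qed.

Lemma sum_cut_len_le (R : realType) d (a l : 'rV[R]_d) (C : cutting a l) i (P : pred nat)
    (al be : R) K : al <= be ->
  (forall m, P m -> al <= cutpt C i m /\ cutpt C i m.+1 <= be) ->
  \sum_(m < K | P m) cut_len C i m <= be - al.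
Proof.
move=> ab HP.
(* The induction on [K] needs a bound that grows with the cut points: the length of the part of the
   interval from [al] to [be] lying left of [cutpt C i K]. *)
suff : \sum_(m < K | P m) cut_len C i m <= Num.max 0 (Num.min (cutpt C i K) be - al).
  move=> /le_trans; apply; rewrite ge_max subr_ge0 ab/= lerB//.
  by rewrite ge_min lexx orbT.
elim: K => [|K IH]; first by rewrite big_ord0 le_max lexx.
rewrite big_mkcond big_ord_recr/= -big_mkcond/=.
have cK := cut_ltS C i K.
case: ifPn => [/HP[h1 h2]|_]; rewrite /cut_len; move: IH; set S := \sum_(_ < _ | _) _ => IH.
  move: IH; rewrite (min_l (le_trans (ltW cK) h2)) (min_l h2).
  rewrite !max_r ?subr_ge0 ?(le_trans h1 (ltW cK))//.
  by move=> ?; lra.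
by rewrite addr0 (le_trans IH)// ge_max le_max lexx/= le_max lerD2r
  le_min !ge_min lexx (ltW cK) !orbT.
Qed.

Lemma bigmax_seq_ltP (R : realType) (r : seq R) (P : pred R) (x0 y : R) :
  \big[Num.max/x0]_(z <- r | P z) z < y <->
  x0 < y /\ forall z, z \in r -> P z -> z < y.
Proof.
elim: r => [|z r IH]; first by rewrite big_nil; split=> [|[]].
rewrite big_cons; case: ifPn => Pz.
  rewrite gt_max; split=> [/andP[zy /IH[x0y H]]|[x0y H]].
    by split=> // w; rewrite inE => /predU1P[->//|]; exact: H.
  apply/andP; split; first by apply: H; rewrite ?inE ?eqxx.
  by apply/IH; split=> // w wr; apply: H; rewrite inE wr orbT.
rewrite IH; split=> -[x0y H]; split=> // w.
  by rewrite inE => /predU1P[->|/H//]; rewrite (negbTE Pz).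
by move=> wr; apply: H; rewrite inE wr orbT.
Qed.

Lemma bigmin_seq_gtP (R : realType) (r : seq R) (P : pred R) (x0 y : R) :
  y < \big[Num.min/x0]_(z <- r | P z) z <->
  y < x0 /\ forall z, z \in r -> P z -> y < z.
Proof.
elim: r => [|z r IH]; first by rewrite big_nil; split=> [|[]].
rewrite big_cons; case: ifPn => Pz.
  rewrite lt_min; split=> [/andP[zy /IH[x0y H]]|[x0y H]].
    by split=> // w; rewrite inE => /predU1P[->//|]; exact: H.
  apply/andP; split; first by apply: H; rewrite ?inE ?eqxx.
  by apply/IH; split=> // w wr; apply: H; rewrite inE wr orbT.
rewrite IH; split=> -[x0y H]; split=> // w.
  by rewrite inE => /predU1P[->|/H//]; rewrite (negbTE Pz).
by move=> wr; apply: H; rewrite inE wr orbT.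
Qed.

(** * Grids *)

Section grid.
Context (R : realType) (d : nat) (a l : 'rV[R]_d) (G : set (set 'rV[R]_d)).
Hypothesis l0 : forall i, 0 < l ord0 i.
Let Omega := hyperrect a l.
Hypothesis hG : is_grid Omega G.
Let mu : {measure set 'rV[R]_d -> \bar R} := lebesgue_on_rect a l.
Implicit Types (i j : 'I_d) (x y : 'rV[R]_d) (k : 'I_d -> nat) (u : 'rV[R]_d -> R).

Let off : set 'rV[R]_d := Omega `\` \bigcup_(P in G) P.

(** A hyperplane determines its level along a given axis, so the finiteness of [G] passes to the
    levels. *)
Lemma grid_levels : exists Z : 'I_d -> seq R, forall i c, c \in Z i <-> G (axis_hyperplane i c).
Proof.
have [Gfin _ _] := hG.
have h i : exists Zi : seq R, forall c, c \in Zi <-> G (axis_hyperplane i c).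
  have : finite_set [set c | G (axis_hyperplane i c)].
    apply: (@finite_preimage _ _ G (axis_hyperplane i)) => // c c' _ _ E.
    have : axis_hyperplane i c (const_mx c) by rewrite /axis_hyperplane/= mxE.
    by rewrite E /axis_hyperplane/= mxE.
  move=> /finite_seqP[s sE]; exists s => c.
  by rewrite -[G _]/([set c | G (axis_hyperplane i c)] c) sE.
by have /choice[Z hZ] := h; exists Z.
Qed.

Variable Z : 'I_d -> seq R.
Hypothesis hZ : forall i c, c \in Z i <-> G (axis_hyperplane i c).

Lemma offP x : off x <-> Omega x /\ forall i, x ord0 i \notin Z i.
Proof.
have [_ hP _] := hG; split=> -[Ox H]; split=> //.
  by move=> i; apply/negP => /hZ Gx; apply: H; exists (axis_hyperplane i (x ord0 i)).
move=> [P GP Px]; have [i [c PE]] := hP P GP; subst P.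
by have /negP := H i; apply; apply/hZ; rewrite Px.
Qed.

Definition block_lo x : 'rV[R]_d :=
  \row_i \big[Num.max/a ord0 i]_(z <- Z i | z < x ord0 i) z.

Definition block_hi x : 'rV[R]_d :=
  \row_i \big[Num.min/(a ord0 i + l ord0 i)]_(z <- Z i | x ord0 i < z) z.

Definition grid_block x : set 'rV[R]_d := hyperrect (block_lo x) (block_hi x - block_lo x).

Lemma grid_blockE x y : grid_block x y <-> forall i,
  [/\ a ord0 i < y ord0 i, y ord0 i < a ord0 i + l ord0 i,
     forall z, z \in Z i -> z < x ord0 i -> z < y ord0 i &
     forall z, z \in Z i -> x ord0 i < z -> y ord0 i < z].
Proof.
have E i : block_lo x ord0 i + (block_hi x - block_lo x) ord0 i = block_hi x ord0 i.
  by move: (block_lo x) (block_hi x) => L H; rewrite !mxE; ring.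
split=> H i.
  have := H i; rewrite E !mxE => /andP[/bigmax_seq_ltP[h1 h2] /bigmin_seq_gtP[h3 h4]].
  by split.
have [h1 h2 h3 h4] := H i; rewrite E !mxE; apply/andP; split.
  exact/bigmax_seq_ltP.
exact/bigmin_seq_gtP.
Qed.

Lemma grid_block_self x : off x -> grid_block x x.
Proof.
move=> /offP[Ox Hx]; apply/grid_blockE => i; have /andP[h1 h2] := Ox i.
by split.
Qed.

Lemma grid_block_off x y : off x -> grid_block x y -> off y.
Proof.
move=> /offP[Ox Hx] /grid_blockE H; apply/offP; split=> i.
  by have [-> ->] := H i.
have [_ _ h1 h2] := H i; apply/negP => yZ.
have [yx|xy|E] := ltgtP (y ord0 i) (x ord0 i).
- by have := h1 _ yZ yx; rewrite ltxx.
- by have := h2 _ yZ xy; rewrite ltxx.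
- by have := Hx i; rewrite -E yZ.
Qed.

(** The box is connected and meets no hyperplane. Conversely, each coordinate maps the component
    onto an interval that avoids all levels, so no point of the component lies across a level from
    [x]. *)
Lemma grid_block_component x : off x -> connected_component off x = grid_block x.
Proof.
move=> ox; apply/seteqP; split; last first.
  apply: connected_component_max.
  - exact: grid_block_self.
  - by move=> y; exact: grid_block_off.
  - exact: connected_hyperrect.
move=> y cy.
have sub : connected_component off x `<=` off by exact: connected_component_sub.
have [oy _] := sub y cy.
apply/grid_blockE => i; have /andP[h1 h2] := oy i.
have itv : is_interval ((fun w : 'rV[R]_d => w ord0 i) @` connected_component off x).
  apply/connected_intervalP/connected_continuous_connected.
    exact: component_connected.
  by apply: continuous_subspaceT; exact: coord_continuous.
have cx : connected_component off x x by exact: connected_component_refl.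
have no z : z \in Z i -> ~ ((fun w : 'rV[R]_d => w ord0 i) @` connected_component off x) z.
  move=> zZ [w /sub/offP[_ /(_ i)] + wz].
  by rewrite -wz in zZ; rewrite zZ.
split=> // z zZ zx; rewrite ltNge; apply/negP => yz; apply: (no z zZ).
  apply: (itv (y ord0 i) (x ord0 i)); [by exists y|by exists x|].
  by rewrite yz ltW.
apply: (itv (x ord0 i) (y ord0 i)); [by exists x|by exists y|].
by rewrite yz ltW.
Qed.

Lemma block_len_pos x i : off x -> 0 < (block_hi x - block_lo x) ord0 i.
Proof.
move=> /grid_block_self /(_ i) /andP[h1 h2].
by have := lt_trans h1 h2; rewrite ltrDl.
Qed.

Lemma le_mesh_size x i : off x -> (block_hi x - block_lo x) ord0 i <= mesh_size Omega G.
Proof.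
move=> ox; apply: ub_le_sup; last first.
  exists (block_lo x), (block_hi x - block_lo x), i; split=> //.
    by exists x => //; exact: grid_block_component.
  by move=> j; exact: block_len_pos.
(* The supremum is meaningful only for a bounded set. A box inside the rectangle contains its points
   at one quarter and three quarters, so half of each side is shorter than the side of the
   rectangle; the sum over the axes gives a uniform bound. *)
exists (\sum_j 2 * l ord0 j) => _ [b [m [j [[y oy bm] m0 ->]]]].
have sub : hyperrect b m `<=` Omega.
  by rewrite -bm => z /(@connected_component_sub _ _ _ _) [].
pose pt (t : R) : 'rV[R]_d := \row_q (b ord0 q + t * m ord0 q).
have hpt t : 0 < t < 1 -> hyperrect b m (pt t).
  move=> /andP[t0 t1] q; rewrite mxE ltrDl mulr_gt0//= ltrD2l.
  by rewrite gtr_pMl.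
have q1 : ((0 : R) < 4^-1) && ((4^-1 : R) < 1) by apply/andP; split; lra.
have q2 : ((0 : R) < 3 / 4) && ((3 / 4 : R) < 1) by apply/andP; split; lra.
have /(_ j)/andP[h1 _] := sub _ (hpt _ q1); rewrite mxE in h1.
have /(_ j)/andP[_ h2] := sub _ (hpt _ q2); rewrite mxE in h2.
rewrite (@le_trans _ _ (2 * l ord0 j))//.
  by move: h1 h2; move: (a ord0 j) (l ord0 j) (b ord0 j) (m ord0 j) => *; lra.
rewrite (bigD1 j)//= lerDl sumr_ge0// => q _.
by rewrite mulr_ge0// ltW.
Qed.

Lemma grid_avg_off u x : off x -> grid_avg Omega G u x =
  (fine (lebesgue_rV (grid_block x)))^-1 * \int[@lebesgue_rV R d]_(y in grid_block x) u y.
Proof.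
move=> ox; rewrite /grid_avg -(fsbig_widen [set grid_block x]).
- rewrite fsbig_set1 indicE mem_set; last exact: grid_block_self.
  by rewrite mulr1.
- by move=> _ ->; exists x => //; exact: grid_block_component.
- move=> Q [[z oz <-] /= zx]; rewrite indicE memNset ?mulr0// => cx.
  apply: zx; rewrite -(grid_block_component ox).
  exact: same_connected_component.
Qed.

Lemma grid_avg_out u x : ~ off x -> grid_avg Omega G u x = 0.
Proof.
move=> ox; apply: fsbig1 => Q [z oz <-]; rewrite indicE memNset ?mulr0//.
by move=> /(@connected_component_sub _ _ _ _).
Qed.

Section adapted.
Variable C : cutting a l.
Hypothesis adapted : forall i z, z \in Z i -> a ord0 i < z < a ord0 i + l ord0 i ->
  exists2 m, (m < ncell C i)%N & cutpt C i m = z.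

(* Cells [m] and [n] of the axis [i] lie between the same hyperplanes of the grid. *)
Definition same_block i : rel nat := fun m n =>
  ((m < ncell C i)%N == (n < ncell C i)%N) &&
  all (fun z => (z <= cutpt C i m) == (z <= cutpt C i n)) (Z i).

Lemma same_block_refl i : reflexive (same_block i).
Proof. by move=> m; rewrite /same_block eqxx/=; apply/allP => z _. Qed.

Lemma same_block_sym i : symmetric (same_block i).
Proof.
by move=> m n; rewrite /same_block eq_sym; congr (_ && _); apply: eq_all => z; rewrite eq_sym.
Qed.

Lemma same_block_trans i : transitive (same_block i).
Proof.
move=> m n p /andP[/eqP h1 /allP h2] /andP[/eqP h3 /allP h4].
rewrite /same_block h1 h3 eqxx/=; apply/allP => z zZ.
by rewrite (eqP (h2 z zZ)); exact: h4.
Qed.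

Lemma same_block_convex i m n p : (m <= n)%N -> (n <= p)%N -> same_block i m p -> same_block i m n.
Proof.
move=> mn np /andP[/eqP h1 /allP h2]; apply/andP; split.
  apply/eqP; apply/idP/idP => [|/(leq_ltn_trans mn)//].
  by rewrite h1 => /(leq_ltn_trans np).
apply/allP => z zZ; have /eqP hz := h2 z zZ; apply/eqP; apply/idP/idP => h.
  exact: le_trans h (cut_le _ _ mn).
by rewrite hz (le_trans h (cut_le _ _ np)).
Qed.

Lemma same_block_range i m n : same_block i m n -> (m < ncell C i)%N -> (n < ncell C i)%N.
Proof. by move=> /andP[/eqP ->]. Qed.

(** A level inside the rectangle is a cut point, so no level runs through a cell of the rectangle,
    and the lower end of the cell decides on which side of [z] all of it lies. *)
Lemma cell_level k x i z : in_range C k -> cell C k x -> z \in Z i ->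
  [/\ x ord0 i <> z, (z < x ord0 i) = (z <= cutpt C i (k i)) &
      (x ord0 i < z) = ~~ (z <= cutpt C i (k i))].
Proof.
move=> kN kx zZ; have /andP[h1 h2] := kx i.
have main : ~~ (z <= cutpt C i (k i)) -> x ord0 i < z.
  rewrite -ltNge => cz; rewrite ltNge; apply/negP => zx.
  have zc := le_lt_trans zx h2.
  have [|m mN cm] := adapted zZ.
    apply/andP; split.
      by rewrite -(cut0 C) (le_lt_trans _ cz)// cut_le.
    by rewrite -(cut_ncell C) (lt_le_trans zc)// cut_le.
  have km : (k i < m)%N by rewrite ltnNge; apply/negP => /(cut_le C i); rewrite cm leNgt cz.
  by have := cut_le C i km; rewrite cm leNgt zc.
case: (boolP (z <= cutpt C i (k i))) => [zc|/main xz].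
  have zx := le_lt_trans zc h1; split=> //; first by move=> xz; rewrite xz ltxx in zx.
  by rewrite ltNge (ltW zx).
split=> //; first by move=> E; rewrite E ltxx in xz.
by rewrite ltNge (ltW xz).
Qed.

Lemma cell_off k x : in_range C k -> cell C k x -> off x.
Proof.
move=> kN kx; apply/offP; split; first exact: cell_sub_rect kx.
move=> i; apply/negP => xZ.
by have [] := cell_level kN kx xZ.
Qed.

Lemma cell_grid_block k k' x y : in_range C k -> in_range C k' -> cell C k x -> cell C k' y ->
  grid_block x y <-> forall i, same_block i (k' i) (k i).
Proof.
move=> kN k'N kx k'y; rewrite grid_blockE; split=> H i.
  have [_ _ h3 h4] := H i; rewrite /same_block kN k'N eqxx/=; apply/allP => z zZ.
  have [_ e1 e2] := cell_level kN kx zZ; have [_ e3 e4] := cell_level k'N k'y zZ.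
  rewrite -e1 -e3; apply/eqP; apply/idP/idP => h; last exact: h3.
  rewrite ltNge; apply/negP; rewrite le_eqVlt => /predU1P[E|xz].
    by have [] := cell_level kN kx zZ.
  by have := lt_trans h (h4 _ zZ xz); rewrite ltxx.
have Oy : Omega y by exact: cell_sub_rect k'y.
have /andP[h1 h2] := Oy i; have /andP[_ /allP h] := H i; split=> // z zZ.
  have [_ -> _] := cell_level kN kx zZ; have [_ -> _] := cell_level k'N k'y zZ.
  by rewrite (eqP (h z zZ)).
have [_ _ ->] := cell_level kN kx zZ; have [_ _ ->] := cell_level k'N k'y zZ.
by rewrite (eqP (h z zZ)).
Qed.

Lemma exists_cell_point k : exists x, cell C k x.
Proof.
exists (\row_i ((cutpt C i (k i) + cutpt C i (k i).+1) / 2)) => i; rewrite mxE.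
by have := cut_ltS C i (k i) => h; apply/andP; split; lra.
Qed.

Lemma block_len_mesh i n : (n < ncell C i)%N -> block_len C same_block i n <= mesh_size Omega G.
Proof.
(* Any cell whose index along the axis [i] is [n] will do, since only the side along this axis is
   compared. *)
move=> nN; pose k j := if j == i then n else 0%N.
have kN : in_range C k by move=> j; rewrite /k; case: eqVneq => [->//|_]; exact: ncell_gt0.
have [x kx] := exists_cell_point k.
have ox := cell_off kN kx.
apply: le_trans (le_mesh_size i ox).
have kin : k i = n by rewrite /k eqxx.
rewrite !mxE.
apply: (@sum_cut_len_le _ _ _ _ C i (fun m => same_block i m n)) => [|m /andP[/eqP mN /allP h]].
  by have := block_len_pos i ox; rewrite !mxE subr_gt0 => /ltW.
have level z : z \in Z i -> [/\ (z < x ord0 i) = (z <= cutpt C i m) &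
      (x ord0 i < z) = ~~ (z <= cutpt C i m)].
  by move=> zZ; rewrite (eqP (h z zZ)) -kin; have [_ -> ->] := cell_level kN kx zZ.
split.
  rewrite big_seq_cond; apply: bigmax_le => [|z /andP[zZ]].
    by rewrite -(cut0 C) cut_le.
  by have [-> _] := level z zZ.
rewrite big_seq_cond; apply: le_bigmin => [|z /andP[zZ]].
  by rewrite -(cut_ncell C) cut_le// mN.
have [_ ->] := level z zZ; rewrite -ltNge => mz.
have [zb|bz] := ltP z (a ord0 i + l ord0 i); last first.
  by rewrite (le_trans _ bz)// -(cut_ncell C) cut_le// mN.
have [|q qN cq] := adapted zZ.
  by rewrite zb andbT -(cut0 C) (le_lt_trans _ mz)// cut_le.
rewrite -cq cut_le// ltnNge; apply/negP => /(cut_le C i).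
by rewrite cq leNgt mz.
Qed.

Lemma block_vol k : in_range C k ->
  \sum_(k' : cell_index C | [forall i, same_block i (idx k' i) (k i)]) cell_vol C (idx k') =
  \prod_i block_len C same_block i (k i).
Proof.
move=> kN; rewrite /block_len.
under eq_bigr do rewrite big_mkcond.
rewrite (@bigA_distr_bigA _ _ _ _ _ _ _ (fun i (m : 'I_(ncells C)) =>
  if same_block i m (k i) then cut_len C i m else 0)) big_mkcond; apply: eq_bigr => k' _.
case: ifPn => [/forallP H|].
  by rewrite /cell_vol; apply: eq_bigr => i _; rewrite H.
rewrite negb_forall => /existsP[i /negbTE Hi].
by rewrite (bigD1 i)//= Hi mul0r.
Qed.

Lemma Rintegral_grid_block k x u : mu.-integrable setT (EFin \o u) ->
  in_range C k -> cell C k x ->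
  \int[mu]_(y in grid_block x) u y =
  \sum_(k' : cell_index C | [forall i, same_block i (idx k' i) (k i)]) cell_int C u (idx k').
Proof.
move=> iu kN kx.
have mB : measurable (grid_block x) by exact: measurable_hyperrect.
pose s (k' : 'I_d -> nat) : R := if `[< forall i, same_block i (k' i) (k i) >] then 1 else 0.
transitivity (\int[mu]_y (step_fun C s y * u y)).
  rewrite Rintegral_mkcond /Rintegral; congr fine; apply: ae_eq_integral => //.
  - apply/measurable_EFinP/(measurable_restrictT _ mB)/measurable_funTS.
    by apply/measurable_EFinP; case/integrableP: iu.
  - by case/integrableP: (integrable_step C s iu).
  - have acell := ae_cell C.
    apply: filterS acell => y [k' k'N k'y] _; rewrite (step_funE s k'N k'y) patchE /s.
    have H := cell_grid_block kN k'N kx k'y.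
    case: ifPn => [|]; rewrite ?inE ?notin_setE => yB.
      by rewrite asboolT ?mul1r//; exact/H.
    by rewrite asboolF ?mul0r// => /H.
rewrite (Rintegral_step C s iu) [RHS]big_mkcond; apply: eq_bigr => k' _.
rewrite /s; have -> : `[< forall i, same_block i (idx k' i) (k i) >] =
    [forall i, same_block i (idx k' i) (k i)].
  by apply/idP/idP => [/asboolP H|/forallP H]; [exact/forallP|exact/asboolP].
by case: ifP; rewrite ?mul1r ?mul0r.
Qed.

(** Supplies the hypothesis [AuE] of the block averaging for every cutting that refines the grid. *)
Lemma grid_avg_adapted k x u : mu.-integrable setT (EFin \o u) ->
  in_range C k -> cell C k x ->
  grid_avg Omega G u x =
  (\sum_(k' : cell_index C | [forall i, same_block i (idx k' i) (k i)]) cell_int C u (idx k')) /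
  \prod_i block_len C same_block i (k i).
Proof.
move=> iu kN kx; have ox := cell_off kN kx.
have BO : grid_block x `<=` Omega by move=> y /(grid_block_off ox) [].
rewrite (grid_avg_off _ ox) mulrC -(Rintegral_grid_block iu kN kx).
congr (_ * _^-1).
  rewrite /Rintegral; congr fine; apply/esym/eq_measure_integral => A mA AB.
  rewrite /mu /= /lebesgue_on_rect /mrestr setIidl//.
  exact: subset_trans BO.
have mB : measurable (grid_block x) by exact: measurable_hyperrect.
have i1 : mu.-integrable setT (EFin \o cst (1 : R)).
  apply: (@integrable_rect_bounded _ _ _ _ l0 _ 1) => // y _.
  by rewrite /= normr1.
have := Rintegral_grid_block i1 kN kx.
rewrite /= Rintegral_cst// mul1r => E.
rewrite -(block_vol kN) -[fine _]/(fine (lebesgue_rV (grid_block x))).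
have -> : lebesgue_rV (grid_block x) = mu (grid_block x).
  by rewrite /mu /= /lebesgue_on_rect /mrestr setIidl.
rewrite E; apply: eq_bigr => k' /forallP H.
have k'N : in_range C (idx k').
  by move=> i; apply: (same_block_range _ (kN i)); rewrite same_block_sym.
rewrite /cell_int Rintegral_cst; last exact: measurable_cell.
by rewrite mul1r [X in fine X]measure_cell.
Qed.

End adapted.

(** The equality holds at every point: off the cells of the rectangle a point lies outside the
    rectangle or on a hyperplane of the grid, and both averages are 0. *)
Lemma grid_avg_cutting : exists C : cutting a l, forall u,
  mu.-integrable setT (EFin \o u) -> grid_avg Omega G u = cut_avg C u.
Proof.
have [C [C1 C2]] := @exists_cutting R d a l Z l0.
exists C => u iu; apply/funext => x.
have um : measurable_fun setT u by case/integrableP: iu => /measurable_EFinP.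
have [[k kN kx]|nox] := pselect (exists2 k, in_range C k & cell C k x).
  rewrite (grid_avg_adapted C1 iu kN kx) /cut_avg (step_funE _ kN kx).
  (* Every interior cut point is a level here, so it separates its neighbouring cells and each block
     is a single cell. *)
  have eqk k' : (forall i, same_block C i (k' i) (k i)) -> k' = k.
    move=> H; apply/funext => i; have k'N : (k' i < ncell C i)%N.
      by apply: (same_block_range _ (kN i)); rewrite same_block_sym.
    have no m n : (m < n)%N -> (n < ncell C i)%N -> ~~ same_block C i m n.
      move=> mn nN; rewrite /same_block negb_and; apply/orP; right.
      rewrite -has_predC; apply/hasP; exists (cutpt C i n).
        by apply: C2 => //; exact: leq_ltn_trans mn.
      by rewrite /= lexx eqb_id leNgt cut_lt.
    have [kk|kk|//] := ltngtP (k' i) (k i).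
      by have := H i; rewrite (negbTE (no _ _ kk (kN i))).
    by have := H i; rewrite same_block_sym (negbTE (no _ _ kk k'N)).
  have [k0 k0E] := in_range_index kN.
  have sumE (g : ('I_d -> nat) -> R) :
      \sum_(k' : cell_index C | [forall i, same_block C i (idx k' i) (k i)]) g (idx k') = g k.
    rewrite (bigD1 k0)/=; last by apply/forallP => i; rewrite k0E same_block_refl.
    rewrite big1 ?addr0 ?k0E// => k' /andP[/forallP /eqk k'k /eqP]; case.
    apply/ffunP => i; apply/val_inj.
    exact: (etrans (congr1 (fun f => f i) k'k) (esym (congr1 (fun f => f i) k0E))).
  by rewrite sumE -(block_vol kN) sumE.
rewrite grid_avg_out; last first.
  move=> /offP[Ox Hx]; apply: nox; apply: exists_cell => // j m m0 mN E.
  by have := C2 j m m0 mN; rewrite -E (negbTE (Hx j)).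
rewrite /cut_avg /step_fun big1// => k _.
have [kN|kN] := pselect (in_range C (idx k)); last by rewrite cell_int_out// !mul0r.
by rewrite indicE memNset ?mulr0// => kx; apply: nox; exists (idx k).
Qed.



End grid.

(** * Deviation from grid averages *)

Section monotone_class.
Context (R : realType) (d : nat).
Implicit Types (x y : 'rV[R]_d) (E : set 'rV[R]_d).

(** Membership depends only on the position of the coordinates relative to finitely many levels.
    Such a set is resolved by any cutting through these levels, and Boolean operations merely
    concatenate the lists of levels. *)
Definition cut_invariant (Z : 'I_d -> seq R) E := forall x y,
  (forall i z, z \in Z i -> (z < x ord0 i) = (z < y ord0 i) /\ (x ord0 i < z) = (y ord0 i < z)) ->
  E x -> E y.

Definition cut_algebra : set (set 'rV[R]_d) :=
  [set E | measurable E /\ exists Z, cut_invariant Z E].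

Lemma cut_algebra_setring : setring cut_algebra.
Proof.
split.
- by split=> //; exists (fun=> [::]).
- move=> A B [mA [Z HZ]] [mB [Z' HZ']]; split; first exact: measurableU.
  exists (fun i => Z i ++ Z' i) => x y xy [Ax|Bx]; [left|right].
    by apply: (HZ x) => // i z zZ; apply: xy; rewrite mem_cat zZ.
  by apply: (HZ' x) => // i z zZ; apply: xy; rewrite mem_cat zZ orbT.
- move=> A B [mA [Z HZ]] [mB [Z' HZ']]; split; first exact: measurableD.
  exists (fun i => Z i ++ Z' i) => x y xy [Ax Bx]; split.
    by apply: (HZ x) => // i z zZ; apply: xy; rewrite mem_cat zZ.
  move=> By; apply: Bx; apply: (HZ' y) => // i z zZ.
  by have [|-> ->] := xy i z; rewrite ?mem_cat ?zZ ?orbT.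
Qed.

(** The monotone class generated by a ring of sets is its sigma-ring, here a sigma-algebra because
    the whole space belongs to the ring; a box belongs to the ring with its end points as levels. *)
Lemma measurable_cut_algebra E : measurable E -> <<M cut_algebra >> E.
Proof.
rewrite (g_monotone_g_sigma_ring cut_algebra_setring) => mE.
have algT : cut_algebra setT by split=> //; exists (fun=> [::]).
have sr := @smallest_sigma_ring _ cut_algebra.
have [sr0 srD srU] := sr.
have : sigma_algebra setT <<sr cut_algebra >>.
  split=> // A srA; apply: srD => //.
  exact: sub_gen_smallest.
rewrite measurable_rV_boxes in mE => sa.
apply: mE; split=> // _ [[b m] _ <-] /=.
apply: sub_gen_smallest; split; first exact: measurable_hyperrect.
exists (fun i => [:: b ord0 i; b ord0 i + m ord0 i]) => x y xy bx i.
have /andP[h1 h2] := bx i; apply/andP; split.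
  by have [|<- _] := xy i (b ord0 i); rewrite ?inE ?eqxx.
by have [|_ <-] := xy i (b ord0 i + m ord0 i); rewrite ?inE ?eqxx ?orbT.
Qed.

Variable mu : {measure set 'rV[R]_d -> \bar R}.

Lemma cvg_Rintegral_set (g : 'rV[R]_d -> R) (F : (set 'rV[R]_d)^nat) E :
  mu.-integrable setT (EFin \o g) -> (forall n, measurable (F n)) -> measurable E ->
  (forall x, \1_(F n) x @[n --> \oo] --> (\1_E x : R)) ->
  (\int[mu]_(x in F n) g x) @[n --> \oo] --> \int[mu]_(x in E) g x.
Proof.
move=> ig mF mE FE.
have gm : measurable_fun setT g by case/integrableP: ig => /measurable_EFinP.
have rE A : (\int[mu]_(x in A) (g x)%:E = \int[mu]_x (g x * \1_A x)%:E)%E.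
  rewrite integral_mkcond; apply: eq_integral => x _.
  by rewrite patchE indicE; case: ifPn => _; rewrite ?mulr1 ?mulr0.
have iE : mu.-integrable E (EFin \o g) by exact: (integrableS _ _ _ ig).
have : (\int[mu]_(x in F n) (g x)%:E)%E @[n --> \oo] --> (\int[mu]_(x in E) (g x)%:E)%E.
  under eq_fun do rewrite rE; rewrite rE.
  apply: (@dominated_cvg _ _ _ mu _ _ _ _ (fun x => `|g x|%:E)) => //.
  - by move=> n; apply/measurable_EFinP; apply: measurable_funM.
  - move=> x _; apply/cvg_EFin; first exact: nearW.
    by apply: cvgM; [exact: cvg_cst|exact: FE].
  - exact: (integrable_abse ig).
  - move=> n x _ /=; rewrite lee_fin normrM ler_piMr// indicE.
    by case: (_ \in _); rewrite ?normr1 ?normr0.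
rewrite -(fineK (integrable_fin_num mE iE)).
by move/fine_cvg; apply.
Qed.

(** An upper bound on the integrals passes to monotone limits of sets by dominated convergence,
    whatever the sign of [g]. *)
Lemma Rintegral_le_cut_algebra (g : 'rV[R]_d -> R) (c : R) :
  mu.-integrable setT (EFin \o g) ->
  (forall E, cut_algebra E -> \int[mu]_(x in E) g x <= c) ->
  forall E, measurable E -> \int[mu]_(x in E) g x <= c.
Proof.
move=> ig H E mE.
pose M := [set E | measurable E /\ \int[mu]_(x in E) g x <= c].
suff : M E by case.
have := measurable_cut_algebra mE; apply; split; last first.
  by move=> A [mA ZA]; split=> //; exact: H.
have key (F : (set 'rV[R]_d)^nat) E' : (forall n, M (F n)) -> measurable E' ->
    (forall x, \1_(F n) x @[n --> \oo] --> (\1_E' x : R)) -> M E'.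
  move=> FM mE' FE; split=> //.
  have cv := @cvg_Rintegral_set g F E' ig (fun n => (FM n).1) mE' FE.
  rewrite -(cvg_lim _ cv)//; apply: limr_le; last by apply: nearW => n; have [] := FM n.
  by apply/cvg_ex; eexists; exact: cv.
split=> F mF FM; apply: (key F) => //.
- by apply: bigcupT_measurable => n; have [] := FM n.
- move=> x; case: (boolP (x \in \bigcup_n F n)) => [|]; rewrite ?inE ?notin_setE => xU.
    have [n _ Fnx] := xU.
    apply: cvg_near_cst; near=> m; rewrite !indicE !mem_set//.
    have nm : (n <= m)%N by near: m; exact: nbhs_infty_ge.
    by have /subsetPset := mF _ _ nm; exact.
  apply: cvg_near_cst; near=> m; rewrite !indicE !memNset// => Fmx.
  by apply: xU; exists m.
- by apply: bigcapT_measurable => n; have [] := FM n.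
- move=> x; case: (boolP (x \in \bigcap_n F n)) => [|]; rewrite ?inE ?notin_setE => xU.
    by apply: cvg_near_cst; near=> m; rewrite !indicE !mem_set//; exact: xU.
  have /existsNP[n /not_implyP[_ nFx]] := xU.
  apply: cvg_near_cst; near=> m; rewrite !indicE !memNset// => Fmx; apply: nFx.
  have nm : (n <= m)%N by near: m; exact: nbhs_infty_ge.
  by have /subsetPset := mF _ _ nm; apply.
Unshelve. all: end_near. Qed.

End monotone_class.

Section grid_deviation.
Context (R : realType) (d : nat) (a l : 'rV[R]_d) (G : set (set 'rV[R]_d)).
Hypothesis d1 : (1 <= d)%N.
Hypothesis l0 : forall i, 0 < l ord0 i.
Let Omega := hyperrect a l.
Hypothesis hG : is_grid Omega G.
Let mu : {measure set 'rV[R]_d -> \bar R} := lebesgue_on_rect a l.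
Let h := mesh_size Omega G.
Variable u : 'rV[R]_d -> R.
Hypothesis u2 : u \in Lfun mu 2%:E.
Let w : 'rV[R]_d -> R := u \- grid_avg Omega G u.

Lemma integrable_grid_avg v : mu.-integrable setT (EFin \o v) ->
  mu.-integrable setT (EFin \o grid_avg Omega G v).
Proof.
move=> iv; have [Z hZ] := grid_levels hG.
have [C ->//] := grid_avg_cutting l0 hG hZ.
have i1 : mu.-integrable setT (EFin \o cst (1 : R)).
  apply: (@integrable_rect_bounded _ _ _ _ l0 _ 1) => // y _.
  by rewrite /= normr1.
have := integrable_step C (fun k => cell_int C v k / cell_vol C k) i1.
by apply: eq_integrable => // x _ /=; rewrite mulr1.
Qed.

Lemma integrable_grid_deviation : mu.-integrable setT (EFin \o w).
Proof.
have iu := Lfun2_integrable_rect l0 u2.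
have := integrableB measurableT iu (integrable_grid_avg iu).
by apply: eq_integrable => // x _.
Qed.

Lemma rect_measure_fin_num E : measurable E -> mu E \is a fin_num.
Proof.
move=> mE; rewrite ge0_fin_numE ?measure_ge0//.
exact: rect_measure_lty.
Qed.

Lemma mesh_size_gt0 : 0 < h.
Proof.
have [Z hZ] := grid_levels hG.
have [C [C1 _]] := @exists_cutting R d a l Z l0.
pose i0 : 'I_d := Ordinal d1.
apply: (@lt_le_trans _ _ (block_len C (same_block Z C) i0 0)).
  apply: block_len_gt0; first exact: same_block_refl.
  by rewrite (leq_trans (ncell_gt0 C l0 i0))// ncell_le.
by apply: block_len_mesh => //; exact: ncell_gt0.
Qed.

(** A cutting through the levels of both the grid and [E] makes the indicator of [E] constant on its
    cells, so the signed integral is a block deviation. The flux is bounded by the mesh size in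
    general, and by the measure of [E] in dimension one. *)
Lemma grid_deviation_cut_algebra (sg : R) E : `|sg| = 1 -> cut_algebra E ->
  ((sg * \int[mu]_(x in E) w x)%:E <= h%:E * aniso_tv Omega u)%E /\
  (d = 1%N -> ((sg * \int[mu]_(x in E) w x)%:E <= mu E * aniso_tv Omega u)%E).
Proof.
move=> sg1 [mE [Z' HZ']].
have [Z hZ] := grid_levels hG.
have [C [C1 _]] := @exists_cutting R d a l (fun i => Z i ++ Z' i) l0.
have CZ i z : z \in Z i -> a ord0 i < z < a ord0 i + l ord0 i ->
    exists2 m, (m < ncell C i)%N & cutpt C i m = z.
  by move=> zZ; apply: C1; rewrite mem_cat zZ.
have CZ' i z : z \in Z' i -> a ord0 i < z < a ord0 i + l ord0 i ->
    exists2 m, (m < ncell C i)%N & cutpt C i m = z.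
  by move=> zZ; apply: C1; rewrite mem_cat zZ orbT.
pose inE k : Prop := in_range C k /\ forall x, cell C k x -> E x.
pose s k : R := if `[< inE k >] then sg else 0.
have sE k x : in_range C k -> cell C k x -> s k = sg * \1_E x.
  move=> kN kx; rewrite /s indicE.
  case: (boolP (x \in E)) => [|]; rewrite ?in_setE ?notin_setE => xE.
    rewrite asboolT ?mulr1//; split=> // y ky; apply: (HZ' x) => // i z zZ.
    have [_ -> ->] := cell_level CZ' kN kx zZ.
    by have [_ -> ->] := cell_level CZ' kN ky zZ.
  by rewrite asboolF ?mulr0// => -[_ /(_ x kx)].
have s_le1 k : `|s k| <= 1 by rewrite /s; case: ifP => _; rewrite ?sg1 ?normr0.
have s_out k : ~ in_range C k -> s k = 0 by move=> kN; rewrite /s asboolF// => -[].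
have iu := Lfun2_integrable_rect l0 u2.
have iw := integrable_grid_deviation.
have iA := integrable_grid_avg iu.
have acell := ae_cell C.
have Ew : sg * \int[mu]_(x in E) w x = \sum_(k : cell_index C)
    cell_int C u (idx k) * (s (idx k) - partial_avg C (same_block Z C) s d (idx k)).
  transitivity (\int[mu]_x (step_fun C s x * w x)).
    rewrite -RintegralZl//; last exact: (integrableS _ _ _ iw).
    rewrite Rintegral_mkcond /Rintegral; congr fine; apply: ae_eq_integral => //.
    - apply/measurable_EFinP/(measurable_restrictT _ mE)/measurable_funTS/measurable_funM => //.
      by apply/measurable_EFinP; case/integrableP: iw.
    - by case/integrableP: (integrable_step C s iw).
    - apply: filterS acell => x [k kN kx] _.
      rewrite (step_funE s kN kx) (sE k x kN kx) patchE indicE.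
      by case: ifPn => _; rewrite ?mulr1 ?mulr0 ?mul0r.
  rewrite (Rintegral_step C s iw).
  under [RHS]eq_bigr do rewrite mulrBr.
  rewrite sumrB (@partial_avg_full _ _ _ _ C (same_block Z C) s s_out u (grid_avg Omega G u)).
    rewrite -sumrB; apply: eq_bigr => k _; rewrite [cell_int C u _ * _]mulrC -mulrBr; congr (_ * _).
    rewrite /cell_int -RintegralB//.
    + exact: measurable_cell.
    + exact: integrable_cell.
    + exact: integrable_cell.
  by move=> k x kN kx; exact: grid_avg_adapted.
have main B : 0 < B ->
    (forall i k, (k i < ncells C)%N -> `|telescoping_field C (same_block Z C) s i k| <= B) ->
    ((sg * \int[mu]_(x in E) w x)%:E <= B%:E * aniso_tv Omega u)%E.
  move=> B0 HB; rewrite Ew.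
  apply: block_deviation_le => //.
  - exact: same_block_refl.
  - exact: same_block_sym.
  - by move=> i m n; exact: same_block_range.
split.
  apply: main; first exact: mesh_size_gt0.
  move=> i k kM; have [kN|kN] := ltnP (k i) (ncell C i).
    apply: (le_trans (telescoping_field_le _ _ _ _ s_le1 kM)); last exact: block_len_mesh.
    - exact: same_block_refl.
    - exact: same_block_sym.
    - exact: same_block_trans.
    - exact: same_block_convex.
  rewrite (telescoping_field_out _ _ _ s_out kN (ltnW kM)).
  - by rewrite normr0 ltW// mesh_size_gt0.
  - exact: same_block_refl.
  - exact: same_block_sym.
  - by move=> j m n; exact: same_block_range.
move=> dd.
have i1 : mu.-integrable setT (EFin \o cst (1 : R)).
  by apply: (@integrable_rect_bounded _ _ _ _ l0 _ 1) => // y _; rewrite /= normr1.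
have muE : \sum_(k : cell_index C) `|s (idx k)| * cell_vol C (idx k) = fine (mu E).
  transitivity (\int[mu]_x (step_fun C (fun k => `|s k|) x * cst (1 : R) x)).
    rewrite (Rintegral_step C _ i1); apply: eq_bigr => k _.
    have [kN|kN] := pselect (in_range C (idx k)); last by rewrite s_out// normr0 !mul0r.
    rewrite /cell_int Rintegral_cst//; last exact: measurable_cell.
    by rewrite mul1r [X in fine X]measure_cell.
  rewrite -[RHS]mul1r -Rintegral_cst// [RHS]Rintegral_mkcond /Rintegral; congr fine.
  apply: ae_eq_integral => //.
  - by case/integrableP: (integrable_step C (fun k => `|s k|) i1).
  - apply/measurable_EFinP/(measurable_restrictT _ mE)/measurable_funTS.
    exact: measurable_cst.
  - apply: filterS acell => x [k kN kx] _; rewrite (step_funE _ kN kx) (sE k x kN kx) patchE indicE.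
    by case: ifPn => _; rewrite ?mulr1 ?mulr0 ?normr0 ?mul0r ?sg1 ?mulr1.
have mufin : mu E \is a fin_num by exact: rect_measure_fin_num.
(* [main] asks for a positive bound; over a null set the integral is 0 anyway. *)
have [mu0|mu0] := eqVneq (mu E) 0%E.
  rewrite mu0 mul0e lee_fin /Rintegral null_set_integral ?mulr0//.
  by case/integrableP: iw => + _; exact: measurable_funS.
rewrite -(fineK mufin); apply: main.
  by apply: fine_gt0; rewrite lt0e mu0 measure_ge0 -ge0_fin_numE ?measure_ge0// mufin.
move=> i k kM; rewrite -muE; apply: telescoping_field_le_vol => //; last exact: ltnW.
exact: same_block_refl.
Qed.

Variable j : R.
Hypothesis uj : aniso_tv Omega u = j%:E.

Let signed_le (sg : R) E : `|sg| = 1 -> measurable E ->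
  sg * \int[mu]_(x in E) w x <= h * j.
Proof.
move=> sg1 mE; have iw := integrable_grid_deviation.
have isw : mu.-integrable setT (EFin \o (fun x => sg * w x)).
  have := integrableZl measurableT sg iw.
  by apply: eq_integrable.
rewrite -RintegralZl//; last exact: (integrableS _ _ _ iw).
move: E mE; apply: (Rintegral_le_cut_algebra isw) => E EA.
have [mE _] := EA.
rewrite RintegralZl//; last exact: (integrableS _ _ _ iw).
by have [+ _] := grid_deviation_cut_algebra sg1 EA; rewrite uj -EFinM lee_fin.
Qed.

(** The positivity set of [w] and its complement contribute [h * j] each, whence the factor 2. *)
Lemma grid_deviation_L1 : \int[mu]_x `|w x| <= 2 * h * j.
Proof.
have iw := integrable_grid_deviation.
have mw : measurable_fun setT w by case/integrableP: iw => /measurable_EFinP.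
pose E := [set x | 0 < w x].
have mE : measurable E.
  rewrite /E -[X in measurable X]setTI.
  have := mw measurableT `]0, +oo[%classic (measurable_itv _).
  by congr (measurable (_ `&` _)); apply/seteqP; split=> x /=; rewrite in_itv/= andbT.
have restr F : measurable F -> mu.-integrable setT (EFin \o (w \_ F)).
  move=> mF; have := integrableS measurableT mF (@subsetT _ _) iw.
  by rewrite integrable_mkcond// restrict_EFin.
have -> : \int[mu]_x `|w x| = \int[mu]_(x in E) w x - \int[mu]_(x in ~` E) w x.
  rewrite ![\int[mu]_(x in E) _]Rintegral_mkcond [\int[mu]_(x in ~` E) _]Rintegral_mkcond.
  rewrite -RintegralB//; [|exact: restr|by apply: restr; exact: measurableC].
  apply: eq_Rintegral => x _; rewrite !patchE in_setC.
  case: (boolP (x \in E)) => [|]; rewrite ?inE ?notin_setE /E/= => wx.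
    by rewrite subr0 gtr0_norm.
  by rewrite sub0r ler0_norm// leNgt; apply/negP.
have h1 := signed_le (normr1 R) mE.
have h2 := signed_le (normrN1 R) (measurableC mE).
by rewrite /= mul1r mulN1r in h1 h2; lra.
Qed.

(** The integral of [sg * w - j] is nonpositive over every measurable set. Over the set where this
    function is positive, it must then be 0, so that set is null. *)
Let signed_ae_le (sg : R) : d = 1%N -> `|sg| = 1 -> {ae mu, forall x, sg * w x <= j}.
Proof.
move=> dd sg1; have iw := integrable_grid_deviation.
pose g x := sg * w x - j.
have isw : mu.-integrable setT (EFin \o (fun x => sg * w x)).
  have := integrableZl measurableT sg iw.
  by apply: eq_integrable.
have ij : mu.-integrable setT (EFin \o cst j).
  by apply: (@integrable_rect_bounded _ _ _ _ l0 _ `|j|) => // y _.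
have ig : mu.-integrable setT (EFin \o g).
  have := integrableB measurableT isw ij.
  by apply: eq_integrable.
have mg : measurable_fun setT g by case/integrableP: ig => /measurable_EFinP.
have gle E : measurable E -> \int[mu]_(x in E) g x <= 0.
  move: E; apply: (Rintegral_le_cut_algebra ig) => E EA; have [mE _] := EA.
  rewrite RintegralB//; [|exact: (integrableS _ _ _ isw)|exact: (integrableS _ _ _ ij)].
  rewrite RintegralZl//; last exact: (integrableS _ _ _ iw).
  rewrite Rintegral_cst// subr_le0.
  have [_ /(_ dd)] := grid_deviation_cut_algebra sg1 EA; rewrite uj.
  by rewrite -(fineK (rect_measure_fin_num mE)) -EFinM lee_fin [j * _]mulrC.
pose E := [set x | 0 < g x].
have mE : measurable E.
  rewrite /E -[X in measurable X]setTI.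
  have := mg measurableT `]0, +oo[%classic (measurable_itv _).
  by congr (measurable (_ `&` _)); apply/seteqP; split=> x /=; rewrite in_itv/= andbT.
have iE := integrableS measurableT mE (@subsetT _ _) ig.
have : (\int[mu]_(x in E) `|(EFin \o g) x| = 0)%E.
  have -> : (\int[mu]_(x in E) `|(EFin \o g) x| = \int[mu]_(x in E) (g x)%:E)%E.
    by apply: eq_integral => x; rewrite inE /E /= => gx; rewrite gtr0_norm.
  apply/eqP; rewrite eq_le; apply/andP; split.
    by rewrite -(fineK (integrable_fin_num mE iE)) lee_fin; exact: gle.
  by apply: integral_ge0 => x; rewrite /E /= lee_fin => /ltW.
have mgE : measurable_fun E (EFin \o g) by apply/measurable_EFinP; exact: measurable_funTS.
move=> /(ae_eq_integral_abs mu mE mgE); apply: filterS => x gx.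
rewrite leNgt; apply/negP => jx; have gx0 : 0 < g x by rewrite /g subr_gt0.
by have [] := gx gx0; move/eqP; rewrite gt_eqF.
Qed.

Lemma grid_deviation_sup : d = 1%N -> {ae mu, forall x, `|w x| <= j}.
Proof.
move=> dd; have h1 := signed_ae_le dd (normr1 R).
have h2 := signed_ae_le dd (normrN1 R).
by apply: filterS2 h1 h2 => x; rewrite mul1r mulN1r ler_norml lerNl => -> ->.
Qed.

End grid_deviation.

(** * Variational inequalities *)

Section square_integrable.
Context d (T : measurableType d) (R : realType) (mu : {measure set T -> \bar R}).
Implicit Types u v w : T -> R.

Lemma sqr_integrable_Lfun2 u : measurable_fun setT u ->
  mu.-integrable setT (EFin \o (fun x => u x ^+ 2)) -> u \in Lfun mu 2%:E.
Proof.
move=> mu_ iu; rewrite inE; apply/andP; split; rewrite inE//= /finite_norm.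
apply: (@lty_poweRy _ _ 2); first by [].
rewrite powR_Lnorm//; have /integrableP[_] := iu; apply: le_lt_trans.
rewrite le_eqVlt; apply/orP; left; apply/eqP; apply: eq_integral => x _ /=.
by rewrite powR_mulrn// normrX.
Qed.

Lemma Lfun2_mul_integrable u v : u \in Lfun mu 2%:E -> v \in Lfun mu 2%:E ->
  mu.-integrable setT (EFin \o (fun x => u x * v x)).
Proof. by move=> u2 v2; apply/Lfun1_integrable; exact: Lfun2_mul_Lfun1. Qed.

Lemma Lfun2_lin p q u v : u \in Lfun mu 2%:E -> v \in Lfun mu 2%:E ->
  (fun x => p * u x + q * v x) \in Lfun mu 2%:E.
Proof.
move=> u2 v2; apply: sqr_integrable_Lfun2.
  have mu_ := Lfun_measurable u2; have mv_ := Lfun_measurable v2.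
  by apply: measurable_funD; exact: measurable_funM.
have i1 := integrableZl measurableT (p ^+ 2) (Lfun2_mul_integrable u2 u2).
have i2 := integrableZl measurableT (2 * p * q) (Lfun2_mul_integrable u2 v2).
have i3 := integrableZl measurableT (q ^+ 2) (Lfun2_mul_integrable v2 v2).
have := integrableD measurableT (integrableD measurableT i1 i2) i3.
apply: eq_integrable => // x _ /=; rewrite -!EFinM -!EFinD; congr EFin.
by ring.
Qed.

Lemma Lfun2B u v : u \in Lfun mu 2%:E -> v \in Lfun mu 2%:E -> u \- v \in Lfun mu 2%:E.
Proof.
move=> u2 v2; have -> : u \- v = fun x => 1 * u x + (-1) * v x.
  by apply/funext => x /=; rewrite mul1r mulN1r.
exact: Lfun2_lin.
Qed.

Definition ip u v : R := \int[mu]_x (u x * v x).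

Lemma ipC u v : ip u v = ip v u.
Proof. by apply: eq_Rintegral => x _; rewrite mulrC. Qed.

Lemma ip_linl p q u v w : u \in Lfun mu 2%:E -> v \in Lfun mu 2%:E -> w \in Lfun mu 2%:E ->
  ip (fun x => p * u x + q * v x) w = p * ip u w + q * ip v w.
Proof.
move=> u2 v2 w2; have iu := Lfun2_mul_integrable u2 w2.
have iv := Lfun2_mul_integrable v2 w2.
rewrite /ip -!RintegralZl// -RintegralD//; last 2 first.
- by have := integrableZl measurableT p iu; apply: eq_integrable.
- by have := integrableZl measurableT q iv; apply: eq_integrable.
by apply: eq_Rintegral => x _; rewrite mulrDl !mulrA.
Qed.

Lemma ipBl u v w : u \in Lfun mu 2%:E -> v \in Lfun mu 2%:E -> w \in Lfun mu 2%:E ->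
  ip (u \- v) w = ip u w - ip v w.
Proof.
move=> u2 v2 w2; have := ip_linl 1 (-1) u2 v2 w2; rewrite mul1r mulN1r => <-.
by congr ip; apply/funext => x /=; rewrite mul1r mulN1r.
Qed.

Lemma ipBr u v w : u \in Lfun mu 2%:E -> v \in Lfun mu 2%:E -> w \in Lfun mu 2%:E ->
  ip w (u \- v) = ip w u - ip w v.
Proof. by move=> u2 v2 w2; rewrite ipC ipBl// ![ip w _]ipC. Qed.

Lemma ip_ge0 u : 0 <= ip u u.
Proof. by apply: Rintegral_ge0 => // x _; rewrite -expr2 sqr_ge0. Qed.

Lemma ip_lin_sqr t u v : u \in Lfun mu 2%:E -> v \in Lfun mu 2%:E ->
  let z x := u x + t * v x in ip z z = ip u u + 2 * t * ip u v + t ^+ 2 * ip v v.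
Proof.
move=> u2 v2 z; have zE : z = fun x => 1 * u x + t * v x.
  by apply/funext => x; rewrite mul1r.
have z2 : z \in Lfun mu 2%:E by rewrite zE; exact: Lfun2_lin.
rewrite {1}zE ip_linl// [ip u z]ipC [ip v z]ipC zE !ip_linl// [ip v u]ipC.
by ring.
Qed.

Lemma Lnorm2_ip u : u \in Lfun mu 2%:E -> ('N[mu]_2%:E[EFin \o u] ^+ 2 = (ip u u)%:E)%E.
Proof.
move=> u2; have fN : 'N[mu]_2%:E[EFin \o u]%E \is a fin_num.
  rewrite ge0_fin_numE ?Lnorm_ge0//.
  by move: u2; rewrite inE => /andP[_]; rewrite inE.
have n2 : 2 != 0 :> R by rewrite pnatr_eq0.
have := powR_Lnorm mu (EFin \o u) n2.
rewrite -(fineK fN) poweR_EFin powR_mulrn ?fine_ge0 ?Lnorm_ge0//.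
rewrite expe2 -EFinM -expr2 => ->.
have fi := integrable_fin_num measurableT (Lfun2_mul_integrable u2 u2).
rewrite /ip /Rintegral fineK//; apply: eq_integral => x _ /=.
by rewrite powR_mulrn// real_normK ?num_real// expr2.
Qed.

(** With [z = u - v] of norm 0, the square norm of [w + t z] is affine in [t] and nonnegative, so
    its slope [2 * ip w z] vanishes. *)
Lemma ip_ae_eq u v w : u \in Lfun mu 2%:E -> v \in Lfun mu 2%:E -> w \in Lfun mu 2%:E ->
  ip (u \- v) (u \- v) <= 0 -> ip w u = ip w v.
Proof.
move=> u2 v2 w2 uv0; apply/eqP; rewrite -subr_eq0 -ipBr//; apply/eqP.
have z2 := Lfun2B u2 v2; set z := u \- v in z2 uv0 *.
have h t : 0 <= ip w w + 2 * t * ip w z.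
  apply: le_trans (ip_ge0 (fun x => w x + t * z x)) _; rewrite ip_lin_sqr//.
  by rewrite gerDl; apply: mulr_ge0_le0 => //; exact: sqr_ge0.
apply/eqP/negPn/negP => n0.
(* At this [t] the affine function takes the value -1. *)
have := h (- (ip w w + 1) / (2 * ip w z)).
have -> : 2 * (- (ip w w + 1) / (2 * ip w z)) * ip w z = - (ip w w + 1) by field.
by rewrite opprD addrA subrr add0r ler0N1.
Qed.

End square_integrable.

Lemma quadratic_slope_ge0 (R : realFieldType) (x y : R) : 0 <= y ->
  (forall t, 0 < t <= 1 -> 0 <= t * x + t ^+ 2 * y) -> 0 <= x.
Proof.
move=> y0 h; rewrite leNgt; apply/negP => x0.
have p0 : 0 < y - x by rewrite subr_gt0; exact: lt_le_trans y0.
(* Dividing by [2 * (y - x)] instead of [2 * y] covers [y = 0] and keeps [t <= 1], while still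
   [t * y <= - x / 2]. *)
have t0 : 0 < - x / (2 * (y - x)) by rewrite divr_gt0 ?oppr_gt0 ?mulr_gt0.
have t1 : - x / (2 * (y - x)) <= 1 by rewrite ler_pdivrMr ?mulr_gt0//; lra.
have := h (- x / (2 * (y - x))); rewrite t0 t1 => /(_ isT).
set t := _ / _ in t0 t1 *.
have -> : t * x + t ^+ 2 * y = t * (x + t * y) by ring.
rewrite pmulr_rge0//; apply/negP; rewrite -ltNge.
have -> : x + t * y = (x * (y - 2 * x)) / (2 * (y - x)) by rewrite /t; field; rewrite gt_eqF.
by rewrite pmulr_llt0 ?invr_gt0 ?mulr_gt0// nmulr_rlt0//; lra.
Qed.

Section variational_inequality.
Context (R : realType) (d : nat) (a l : 'rV[R]_d).
Hypothesis l0 : forall i, 0 < l ord0 i.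
Let Omega := hyperrect a l.
Let mu : {measure set 'rV[R]_d -> \bar R} := lebesgue_on_rect a l.

Lemma integrable_mul_divergence u H : mu.-integrable setT (EFin \o u) ->
  tv_test_field Omega H -> mu.-integrable setT (EFin \o (fun x => u x * divergence H x)).
Proof.
move=> iu HT; have mdiv := continuous_measurable_rV (continuous_divergence HT).
have [M M0 hM] := continuous_hyperrect_bounded a l (continuous_divergence HT).
have : mu.-integrable setT (EFin \o (u \* divergence H)); last exact.
apply: (integrable_rect_mul iu mdiv M0) => x Ox; apply: hM => i.
by have /andP[/ltW -> /ltW ->] := Ox i.
Qed.

Lemma tv_pairingE u H : mu.-integrable setT (EFin \o u) -> tv_test_field Omega H ->
  (\int[@lebesgue_rV R d]_(x in Omega) (u x * divergence H x)%:E =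
   (\int[mu]_x (u x * divergence H x))%:E)%E.
Proof.
move=> iu HT; have iH := integrable_mul_divergence iu HT.
rewrite integral_rectE; last by case/integrableP: iH.
by rewrite -(fineK (integrable_fin_num measurableT iH)).
Qed.

Lemma aniso_tv_ge0 (u : 'rV[R]_d -> R) : (0 <= aniso_tv Omega u)%E.
Proof.
have C0 k : Ck k (fun=> 0 : R) :> Prop.
  elim: k => [|k IH]; first by split=> // x; exact: cst_continuous.
  split; first by move=> x; exact: cst_continuous.
  move=> i; split=> [x|]; first exact: derivable_cst.
  by rewrite (_ : 'D_ _ _ = fun=> 0)//; apply/funext => x; rewrite derive_cst.
have HT : tv_test_field Omega (fun=> 0).
  split.
  - by move=> i k; under eq_fun do rewrite mxE; exact: C0.
  - by exists set0; split=> //; exact: compact0.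
  - by move=> x _; rewrite normr0.
apply: ereal_sup_ubound; exists (fun=> 0) => //.
apply: integral0_eq => x _; rewrite /divergence big1 ?mulr0// => i _.
by under eq_fun do rewrite mxE; rewrite derive_cst.
Qed.

Lemma aniso_tv0 : aniso_tv Omega (fun=> 0) = 0%E.
Proof.
apply/eqP; rewrite eq_le aniso_tv_ge0 andbT; apply: ge_ereal_sup => _ [H HT <-].
by rewrite integral0_eq// => x _; rewrite mul0r.
Qed.

Lemma aniso_tv_segment (t ju jv : R) u v :
  mu.-integrable setT (EFin \o u) -> mu.-integrable setT (EFin \o v) -> 0 <= t <= 1 ->
  aniso_tv Omega u = ju%:E -> aniso_tv Omega v = jv%:E ->
  (aniso_tv Omega (fun x => u x + t * (v x - u x)%R)%R <= (ju + t * (jv - ju)%R)%R%:E)%E.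
Proof.
move=> iu iv /andP[t0 t1] uE vE; apply: ge_ereal_sup => _ [H HT <-].
have iuH := integrable_mul_divergence iu HT; have ivH := integrable_mul_divergence iv HT.
have hu : \int[mu]_x (u x * divergence H x) <= ju.
  by rewrite -lee_fin -tv_pairingE// -uE; apply: ereal_sup_ubound; exists H.
have hv : \int[mu]_x (v x * divergence H x) <= jv.
  by rewrite -lee_fin -tv_pairingE// -vE; apply: ereal_sup_ubound; exists H.
have it : mu.-integrable setT (EFin \o (fun x => u x + t * (v x - u x))).
  have := integrableD measurableT iu
    (integrableZl measurableT t (integrableB measurableT iv iu)).
  by apply: eq_integrable => // x _ /=; rewrite -EFinB -EFinM -EFinD.
rewrite tv_pairingE// lee_fin.
have -> : \int[mu]_x ((u x + t * (v x - u x)) * divergence H x) =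
    (1 - t) * \int[mu]_x (u x * divergence H x) + t * \int[mu]_x (v x * divergence H x).
  rewrite -!RintegralZl// -RintegralD//; last 2 first.
  - by have := integrableZl measurableT (1 - t) iuH; apply: eq_integrable.
  - by have := integrableZl measurableT t ivH; apply: eq_integrable.
  by apply: eq_Rintegral => x _; ring.
have -> : ju + t * (jv - ju) = (1 - t) * ju + t * jv by ring.
by apply: lerD; apply: ler_wpM2l => //; rewrite subr_ge0.
Qed.

Variable alpha : R.
Hypothesis alpha0 : 0 < alpha.

Lemma rof_energyE g u : g \in Lfun mu 2%:E -> u \in Lfun mu 2%:E ->
  rof_energy a l alpha g u =
  ((2^-1 * ip mu (u \- g) (u \- g))%:E + alpha%:E * aniso_tv Omega u)%E.
Proof.
move=> g2 u2; rewrite /rof_energy EFinM; congr (_ * _ + _)%E.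
by apply: Lnorm2_ip; exact: Lfun2B.
Qed.

(** The competitor 0 has finite energy, which rules out an infinite total variation. *)
Lemma rof_minimizer_tv g u : g \in Lfun mu 2%:E -> rof_minimizer a l alpha g u ->
  exists2 j : R, 0 <= j & aniso_tv Omega u = j%:E.
Proof.
move=> g2 [u2 umin].
have z2 : (fun=> 0 : R) \in Lfun mu 2%:E.
  have -> : (fun=> 0 : R) = u \- u by apply/funext => x /=; rewrite subrr.
  exact: Lfun2B.
have := umin _ z2; rewrite !rof_energyE// aniso_tv0 mule0 adde0.
have := aniso_tv_ge0 u; case: (aniso_tv Omega u) => [j| |]//.
  by rewrite lee_fin => j0 _; exists j.
by rewrite mulry gtr0_sg// mul1e addey// leye_eq.
Qed.

(** Energies are compared along the segment from [u] to [w]. Convexity of the total variation leaves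
    a quadratic in [t] that is nonnegative on [0 < t <= 1], so its linear coefficient is
    nonnegative. *)
Lemma rof_variational_inequality g u w ju jw : g \in Lfun mu 2%:E -> w \in Lfun mu 2%:E ->
  rof_minimizer a l alpha g u -> aniso_tv Omega u = ju%:E -> aniso_tv Omega w = jw%:E ->
  0 <= ip mu (u \- g) (w \- u) + alpha * (jw - ju).
Proof.
move=> g2 w2 [u2 umin] uE wE.
have wu2 := Lfun2B w2 u2; have ug2 := Lfun2B u2 g2.
apply: (@quadratic_slope_ge0 _ _ (2^-1 * ip mu (w \- u) (w \- u))).
  by rewrite mulr_ge0// ?invr_ge0// ip_ge0.
move=> t /andP[t0 t1].
have v2 : (fun x => u x + t * (w x - u x)) \in Lfun mu 2%:E.
  have -> : (fun x => u x + t * (w x - u x)) = fun x => 1 * u x + t * (w \- u) x.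
    by apply/funext => x; rewrite mul1r.
  exact: Lfun2_lin.
have := umin _ v2; rewrite !rof_energyE//.
have /(aniso_tv_segment (Lfun2_integrable_rect l0 u2) (Lfun2_integrable_rect l0 w2))
  : 0 <= t <= 1 by rewrite t1 ltW.
move=> /(_ _ _ uE wE) Jt E1.
have := le_trans E1 (leeD2l _ (lee_wpmul2l (_ : 0 <= alpha%:E)%E Jt)).
rewrite lee_fin ltW// => /(_ isT).
rewrite uE -!EFinM -!EFinD lee_fin.
have -> : ip mu ((fun x => u x + t * (w x - u x)) \- g)
    ((fun x => u x + t * (w x - u x)) \- g) =
    ip mu (u \- g) (u \- g) + 2 * t * ip mu (u \- g) (w \- u) +
    t ^+ 2 * ip mu (w \- u) (w \- u).
  rewrite -ip_lin_sqr//; congr ip; apply/funext => x /=; ring.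
by lra.
Qed.

Lemma rof_contraction f g u v : f \in Lfun mu 2%:E -> g \in Lfun mu 2%:E ->
  rof_minimizer a l alpha f u -> rof_minimizer a l alpha g v ->
  ip mu (v \- u) (v \- u) <= ip mu (g \- f) (v \- u).
Proof.
move=> f2 g2 um vm; have [ju ju0 uE] := rof_minimizer_tv f2 um.
have [jv jv0 vE] := rof_minimizer_tv g2 vm.
have [u2 _] := um; have [v2 _] := vm.
have := rof_variational_inequality f2 v2 um uE vE.
have := rof_variational_inequality g2 u2 vm vE uE.
rewrite !ipBl ?ipBr//; try exact: Lfun2B.
rewrite [ip mu v u]ipC; lra.
Qed.

End variational_inequality.

(** * The averaging operator as an orthogonal projection *)

Section averaging.
Context (R : realType) (d : nat) (a l : 'rV[R]_d) (C : cutting a l).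
Hypothesis l0 : forall i, 0 < l ord0 i.
Let mu : {measure set 'rV[R]_d -> \bar R} := lebesgue_on_rect a l.

Lemma step_fun_Lfun2 s : step_fun C s \in Lfun mu 2%:E.
Proof.
apply: sqr_integrable_Lfun2; first exact: measurable_step_fun.
pose M := \sum_(k : cell_index C) `|s (idx k)|.
apply: (@integrable_rect_bounded _ _ _ _ l0 _ (M ^+ 2)).
- by apply: measurable_funX; exact: measurable_step_fun.
- exact: sqr_ge0.
- move=> x _; rewrite normrX lerXn2r ?nnegrE ?sumr_ge0//.
  exact: step_fun_le.
Qed.

Lemma ip_cut_avg g p : g \in Lfun mu 2%:E -> p \in Lfun mu 2%:E ->
  ip mu (cut_avg C g) p = ip mu g (cut_avg C p).
Proof.
move=> g2 p2; rewrite [RHS]ipC /ip /cut_avg.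
rewrite !Rintegral_step; [|exact: Lfun2_integrable_rect..].
by apply: eq_bigr => k _; rewrite mulrAC [X in X / _]mulrC mulrAC.
Qed.

Lemma cell_int_cut_avg g k : measurable_fun setT g -> cell_int C (cut_avg C g) k = cell_int C g k.
Proof.
move=> mg; have [kN|kN] := pselect (in_range C k); last first.
  by rewrite (cell_int_out mg kN) cell_int_out//; exact: measurable_step_fun.
have mk := measurable_cell C k.
rewrite {1}/cell_int.
rewrite (@eq_Rintegral _ _ _ _ _ (cst (cell_int C g k / cell_vol C k))); last first.
  by move=> x; rewrite inE => kx /=; rewrite /cut_avg (step_funE _ kN kx).
rewrite Rintegral_cst// [X in fine X]measure_cell// -mulrA mulVf ?mulr1//.
by rewrite gt_eqF// cell_vol_gt0.
Qed.

Lemma ip_cut_avg_proj g p : g \in Lfun mu 2%:E -> p \in Lfun mu 2%:E ->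
  ip mu (cut_avg C g) (cut_avg C p) = ip mu (cut_avg C g) p.
Proof.
move=> g2 p2; have Ap2 := step_fun_Lfun2 (fun k => cell_int C p k / cell_vol C k).
rewrite /ip {1 3}/cut_avg !Rintegral_step; [|exact: Lfun2_integrable_rect..].
by apply: eq_bigr => k _; rewrite cell_int_cut_avg//; exact: Lfun_measurable p2.
Qed.

End averaging.

Section rof_averaging.
Context (R : realType) (d : nat) (a l : 'rV[R]_d) (G : set (set 'rV[R]_d)).
Hypothesis l0 : forall i, 0 < l ord0 i.
Let Omega := hyperrect a l.
Hypothesis hG : is_grid Omega G.
Let mu : {measure set 'rV[R]_d -> \bar R} := lebesgue_on_rect a l.

Lemma grid_avg_Lfun2 f : f \in Lfun mu 2%:E -> grid_avg Omega G f \in Lfun mu 2%:E.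
Proof.
move=> f2; have [Z hZ] := grid_levels hG.
have [C CE] := grid_avg_cutting l0 hG hZ.
rewrite CE; first exact: step_fun_Lfun2.
exact: Lfun2_integrable_rect.
Qed.

Variables (alpha : R) (f u v : 'rV[R]_d -> R).
Hypothesis alpha0 : 0 < alpha.
Hypothesis f2 : f \in Lfun mu 2%:E.
Hypothesis um : rof_minimizer a l alpha f u.
Hypothesis vm : rof_minimizer a l alpha (grid_avg Omega G f) v.

(* The minimizer [v] for averaged data is a.e. equal to its own average, since averaging
   decreases the total variation and is an orthogonal projection. *)
Lemma rof_averaging : ip mu (v \- u) (v \- u) <= ip mu f (u \- grid_avg Omega G u).
Proof.
have [Z hZ] := grid_levels hG.
have [C CE] := grid_avg_cutting l0 hG hZ.
have [u2 _] := um; have [v2 _] := vm.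
have Af2 := grid_avg_Lfun2 f2.
have := rof_contraction l0 alpha0 f2 Af2 um vm.
have [jv jv0 vE] := rof_minimizer_tv alpha0 Af2 vm.
move: Af2 vm; rewrite !CE; [|exact: Lfun2_integrable_rect..] => Af2 vm'.
have Av2 : cut_avg C v \in Lfun mu 2%:E by exact: step_fun_Lfun2.
have Au2 : cut_avg C u \in Lfun mu 2%:E by exact: step_fun_Lfun2.
have Jv := aniso_tv_cut_avg C l0 v2.
have [jw wE jwv] : exists2 jw : R, aniso_tv Omega (cut_avg C v) = jw%:E & jw <= jv.
  have := aniso_tv_ge0 a l (cut_avg C v); move: Jv; rewrite [X in (_ <= X)%E]vE -/Omega.
  by case: (aniso_tv Omega (cut_avg C v)) => // jw; rewrite lee_fin => ? _; exists jw.
(* The data [A f] are orthogonal to [A v - v], so this says that the square norm of [v - A v] is at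
   most [alpha * (jw - jv)], which is nonpositive. *)
have VI := rof_variational_inequality l0 alpha0 Af2 Av2 vm' vE wE.
have vAv : forall w, w \in Lfun mu 2%:E -> ip mu w (cut_avg C v) = ip mu w v.
  move=> w w2; apply: ip_ae_eq => //; move: VI; rewrite -/mu.
  have : alpha * (jw - jv) <= 0 by rewrite pmulr_rle0// subr_le0.
  rewrite !ipBl ?ipBr//; try exact: Lfun2B.
  rewrite !ip_cut_avg_proj// [ip mu v (cut_avg C v)]ipC.
  by move: (ip mu _ v) (ip mu v v) (ip mu _ v) (ip mu _ v) => ? ? ? ?; lra.
move=> H; apply: le_trans H _; rewrite -/mu.
rewrite !ipBl ?ipBr//; try exact: Lfun2B.
(* Self-adjointness moves the average off [f]; as [v] and [A v] pair equally with [f], the terms in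
   [v] cancel. *)
rewrite -(vAv _ f2) !ip_cut_avg//.
have E (x y z : R) : x - y - (x - z) <= z - y by lra.
exact: E.
Qed.

End rof_averaging.

(** * Norm estimates *)

Section Lnorm_estimates.
Context d (T : measurableType d) (R : realType) (mu : {measure set T -> \bar R}).
Implicit Types (w f : T -> R).
Local Open Scope ereal_scope.

Lemma Lnorm_powR w (c p : R) : (0 < c)%R -> (0 < p)%R ->
  'N[mu]_p%:E[EFin \o (fun x => `|w x| `^ c)%R] = 'N[mu]_(p * c)%:E[EFin \o w] `^ c.
Proof.
move=> c0 p0; rewrite unlock -poweRrM.
have -> : ((p * c)^-1 * c = p^-1)%R by field; rewrite !gt_eqF.
have E x : `|(EFin \o (fun x => `|w x| `^ c)%R) x| `^ p = `|(EFin \o w) x| `^ (p * c).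
  by rewrite /= ger0_norm ?powR_ge0// -powRrM mulrC.
by congr (_ `^ _); apply: eq_integral => x _; exact: E.
Qed.

Lemma poweR_le (x y : \bar R) (r : R) : 0 <= x -> x <= y -> (0 <= r)%R -> x `^ r <= y `^ r.
Proof.
move=> x0 xy r0; apply: gt0_ler_poweR => //; rewrite in_itv/= leey andbT//.
exact: le_trans xy.
Qed.

(** Hoelder's inequality for the factorization of [|w|^s] into the powers [c1 = (1 - t) s] and
    [c2 = t s], with exponents [1 / c1] and [q / c2]; they are conjugate precisely by the relation
    between [s], [t] and [q]. *)
Lemma Lnorm_interpolation w (s q t : R) : measurable_fun setT w ->
  (0 < s)%R -> (0 < q)%R -> (0 < t < 1)%R -> (s^-1 = 1 - t + t / q)%R ->
  'N[mu]_s%:E[EFin \o w] <= 'N[mu]_1[EFin \o w] `^ (1 - t) * 'N[mu]_q%:E[EFin \o w] `^ t.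
Proof.
move=> mw s0 q0 /andP[t0 t1] st.
have t1' : (0 < 1 - t)%R by rewrite subr_gt0.
pose c1 := ((1 - t) * s)%R; pose c2 := (t * s)%R.
have c10 : (0 < c1)%R by rewrite mulr_gt0.
have c20 : (0 < c2)%R by rewrite mulr_gt0.
have mp c : measurable_fun setT (fun x => `|w x| `^ c)%R.
  apply: (@measurableT_comp _ _ _ _ _ _ (@powR R ^~ c)) => //.
  exact: measurableT_comp.
have := @hoelder _ _ _ mu (fun x => `|w x| `^ c1)%R (fun x => `|w x| `^ c2)%R
  c1^-1 (q / c2) (mp _) (mp _).
rewrite invr_gt0 divr_gt0// => /(_ c10 isT).
have -> : (c1^-1^-1 + (q / c2)^-1 = 1)%R.
  rewrite invrK invf_div /c1 /c2 mulrAC -mulrDl -st mulVf// gt_eqF//.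
move=> /(_ erefl).
rewrite !Lnorm_powR ?invr_gt0 ?divr_gt0// mulVf ?gt_eqF// mulfVK ?gt_eqF//.
have -> : ((fun x => `|w x| `^ c1) \* (fun x => `|w x| `^ c2) = (fun x => `|w x| `^ s))%R.
  apply/funext => x /=; rewrite -powRD; first by congr powR; rewrite /c1 /c2; ring.
  by rewrite gt_eqF// addr_gt0.
rewrite Lnorm_powR// mul1r => H.
have := @poweR_le _ _ s^-1 _ H; rewrite -poweRrM mulfV ?gt_eqF// poweRe1 ?Lnorm_ge0//.
move=> /(_ (poweR_ge0 _ _)); rewrite invr_ge0 => /(_ (ltW s0)).
rewrite poweRM ?poweR_ge0// -!poweRrM.
by rewrite /c1 /c2 !mulfK ?gt_eqF.
Qed.

(** Almost everywhere [|w|^s] is at most [j^(s - 1) |w|], so only the L^1 norm remains. *)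
Lemma Lnorm_le_bound w (s c j : R) : measurable_fun setT w -> (1 <= s)%R -> (0 <= j)%R ->
  {ae mu, forall x, `|w x| <= j}%R -> 'N[mu]_1[EFin \o w] <= c%:E ->
  'N[mu]_s%:E[EFin \o w] <= ((c * j `^ (s - 1)) `^ s^-1)%:E.
Proof.
move=> mw s1 j0 wj wc; have s0 : (0 < s)%R by exact: lt_le_trans s1.
have -> : 'N[mu]_s%:E[EFin \o w] = (\int[mu]_x (`|(EFin \o w) x| `^ s)) `^ s^-1.
  by rewrite unlock.
rewrite -poweR_EFin; apply: poweR_le.
- by apply: integral_ge0 => x _; exact: poweR_ge0.
- apply: (@le_trans _ _ (\int[mu]_x ((j `^ (s - 1))%:E * (`|w x|)%:E))).
    apply: ae_ge0_le_integral => //.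
    + by move=> x _; exact: poweR_ge0.
    + apply/measurable_EFinP; apply: (@measurableT_comp _ _ _ _ _ _ (@powR R ^~ s)) => //.
      exact: measurableT_comp.
    + by move=> x _; rewrite -EFinM lee_fin mulr_ge0// powR_ge0.
    + apply/measurable_EFinP/measurable_funM => //.
      exact: measurableT_comp.
    + apply: filterS wj => x wx _; rewrite /= -EFinM lee_fin.
      rewrite -[X in (_ <= _ * X)%R]powRr1//.
      have [->|w0] := eqVneq `|w x|%R 0%R.
        by rewrite powR0 ?mulr_ge0 ?powR_ge0// gt_eqF.
      rewrite -[in leLHS](subrK 1%R s) [leLHS]powRD ?w0 ?implybT//.
      apply: ler_wpM2r; first exact: powR_ge0.
      by apply: ge0_ler_powR => //; rewrite ?subr_ge0 ?nnegrE.
  rewrite ge0_integralZl//; last 2 first.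
  - by apply/measurable_EFinP; exact: measurableT_comp.
  - by rewrite lee_fin powR_ge0.
  rewrite muleC EFinM; apply: lee_wpmul2r; first by rewrite lee_fin powR_ge0.
  by move: wc; rewrite Lnorm1.
- by rewrite invr_ge0 ltW.
Qed.

Lemma Lnorm1_mul_sup f w : measurable_fun setT w -> f \in Lfun mu +oo ->
  'N[mu]_1[EFin \o (f \* w)%R] <= 'N[mu]_+oo[EFin \o f] * 'N[mu]_1[EFin \o w].
Proof.
move=> mw fy; have mf := Lfun_measurable fy.
have fN : 'N[mu]_+oo[EFin \o f] \is a fin_num.
  rewrite ge0_fin_numE ?Lnorm_ge0//.
  by move: fy; rewrite inE => /andP[_]; rewrite inE.
(* If the whole space is null, the norm is 0 by convention rather than an essential supremum, but
   then the claim holds almost everywhere trivially. *)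
have fM : {ae mu, forall x, (`|f x|)%:E <= 'N[mu]_+oo[EFin \o f]}.
  rewrite unlock /Lnorm; case: ifPn => [_|]; first exact: (ess_sup_ge mu (abse \o (EFin \o f))).
  rewrite -leNgt => mu0; exists setT; split=> //.
  by apply/eqP; rewrite eq_le mu0/=.
rewrite !Lnorm1 -(fineK fN) -ge0_integralZl//; last 2 first.
- by apply: measurableT_comp => //; exact/measurable_EFinP.
- by rewrite lee_fin; apply: fine_ge0; exact: Lnorm_ge0.
apply: ae_ge0_le_integral => //.
- by apply/measurable_EFinP/measurableT_comp => //; exact: measurable_funM.
- by move=> x _; rewrite mule_ge0// lee_fin; apply: fine_ge0; exact: Lnorm_ge0.
- apply/measurable_EFinP/measurable_funM => //; exact: measurableT_comp.
apply: filterS fM => x fx _ /=; rewrite -EFinM lee_fin normrM ler_wpM2r//.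
by rewrite -lee_fin fineK.
Qed.

Lemma ip_le_Lnorm1 f w : f \in Lfun mu 2%:E -> w \in Lfun mu 2%:E ->
  (ip mu f w)%:E <= 'N[mu]_1[EFin \o (f \* w)%R].
Proof.
move=> f2 w2; have ifw := Lfun2_mul_integrable f2 w2.
rewrite Lnorm1 /ip /Rintegral fineK; last exact: (integrable_fin_num measurableT ifw).
apply: le_trans (lee_abs _) _; apply: le_abse_integral => //.
by case/integrableP: ifw.
Qed.

End Lnorm_estimates.

(** The convex function [|.|^q] lies above its tangent at [s]: the mixed term [|s|^(q - 1) |y|] is
    estimated by Young's inequality with exponents [q / (q - 1)] and [q]. *)
Lemma powR_tangent (R : realType) (q s y : R) : 1 < q ->
  `|s| `^ q + q * (`|s| `^ (q - 1) * Num.sg s) * (y - s) <= `|y| `^ q.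
Proof.
move=> q1; have q0 : 0 < q by exact: lt_trans q1.
have q10 : 0 < q - 1 by rewrite subr_gt0.
have sq : `|s| `^ (q - 1) * `|s| = `|s| `^ q.
  have [s0|s0] := eqVneq `|s| 0; first by rewrite s0 mulr0 powR0// gt_eqF.
  rewrite -[X in _ * X]powRr1// -powRD ?s0 ?implybT//.
  by rewrite subrK.
have Y : `|s| `^ (q - 1) * `|y| <= `|s| `^ q / (q / (q - 1)) + `|y| `^ q / q.
  have <- : (`|s| `^ (q - 1)) `^ (q / (q - 1)) = `|s| `^ q.
    by rewrite -powRrM mulrCA divff ?gt_eqF// mulr1.
  apply: conjugate_powR => //; first by rewrite divr_gt0.
  by field; rewrite !gt_eqF.
have : `|s| `^ (q - 1) * Num.sg s * (y - s) <= `|s| `^ (q - 1) * `|y| - `|s| `^ q.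
  rewrite -sq -mulrBr -mulrA; apply: ler_wpM2l; first exact: powR_ge0.
  rewrite mulrBr -normrEsg lerB//.
  have [->|s0] := eqVneq s 0; first by rewrite sgr0 mul0r.
  by apply: le_trans (ler_norm _) _; rewrite normrM normr_sg s0 mul1r.
move=> /(ler_wpM2l (ltW q0)); rewrite mulrA => H.
have := ler_wpM2l (ltW q0) Y.
have -> : q * (`|s| `^ q / (q / (q - 1)) + `|y| `^ q / q) = (q - 1) * `|s| `^ q + `|y| `^ q.
  by field; rewrite !gt_eqF.
rewrite mulrBr mulrBl mul1r in H *.
by move: H; lra.
Qed.

Section averaging_Lq.
Context (R : realType) (d : nat) (a l : 'rV[R]_d) (C : cutting a l).
Hypothesis l0 : forall i, 0 < l ord0 i.
Let mu : {measure set 'rV[R]_d -> \bar R} := lebesgue_on_rect a l.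

Lemma step_fun_cases x : (exists k, forall s, step_fun C s x = s k) \/
  (forall s, step_fun C s x = 0).
Proof.
have [[k kx]|nk] := pselect (exists k : cell_index C, cell C (idx k) x); [left|right].
  exists (idx k) => s; rewrite /step_fun (bigD1 k)//= indicE mem_set//= mulr1.
  rewrite big1 ?addr0// => k' /eqP k'k; rewrite indicE memNset ?mulr0// => k'x.
  apply: k'k; apply/ffunP => i; apply/val_inj.
  by have := cell_inj kx k'x => /(congr1 (fun f => f i)).
move=> s; rewrite /step_fun big1// => k _; rewrite indicE memNset ?mulr0// => kx.
by apply: nk; exists k.
Qed.

(** Jensen's inequality on all cells at once: the tangent at the cell average has a slope [p]
    constant on each cell, and the linear terms integrate to 0 because [u] and its average have the
    same integral over every cell. *)
Lemma Lnorm_cut_avg (q : R) u : 1 < q -> u \in Lfun mu 2%:E ->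
  ('N[mu]_q%:E[EFin \o cut_avg C u] <= 'N[mu]_q%:E[EFin \o u])%E.
Proof.
move=> q1 u2; have q0 : 0 < q by exact: lt_trans q1.
have [->|uN] := eqVneq ('N[mu]_q%:E[EFin \o u])%E +oo%E; first exact: leey.
have mu_ := Lfun_measurable u2.
have uq : u \in Lfun mu q%:E.
  rewrite inE; apply/andP; split; rewrite inE//= /finite_norm.
  by rewrite ltey.
pose s k := cell_int C u k / cell_vol C k.
pose p k := q * (`|s k| `^ (q - 1) * Num.sg (s k)).
have iu := Lfun_integrable (ltW q1) uq.
have iu1 := Lfun2_integrable_rect l0 u2.
have As2 : cut_avg C u \in Lfun mu 2%:E by exact: step_fun_Lfun2.
have iA1 := Lfun2_integrable_rect l0 As2.
have stepq : (fun x => `|cut_avg C u x| `^ q) = step_fun C (fun k => `|s k| `^ q).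
  apply/funext => x; rewrite /cut_avg; have [[k kE]|E0] := step_fun_cases x.
    by rewrite !kE.
  by rewrite !E0 normr0 powR0// gt_eqF.
have iA : mu.-integrable setT (EFin \o (fun x => `|cut_avg C u x| `^ q)).
  by rewrite stepq; apply: Lfun2_integrable_rect => //; exact: step_fun_Lfun2.
have ipu := integrable_step C p iu1; have ipA := integrable_step C p iA1.
have Epp : \int[mu]_x (step_fun C p x * u x) = \int[mu]_x (step_fun C p x * cut_avg C u x).
  rewrite !Rintegral_step//; apply: eq_bigr => k _.
  by rewrite cell_int_cut_avg.
have key : \int[mu]_x (`|cut_avg C u x| `^ q) <= \int[mu]_x (`|u x| `^ q).
  have h x : `|cut_avg C u x| `^ q +
      (step_fun C p x * u x - step_fun C p x * cut_avg C u x) <= `|u x| `^ q.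
    rewrite -mulrBr /cut_avg; have [[k kE]|E0] := step_fun_cases x.
      by rewrite !kE; exact: powR_tangent.
    by rewrite !E0 mul0r addr0 normr0 powR0 ?powR_ge0// gt_eqF.
  have iB : mu.-integrable setT (EFin \o (fun x =>
      step_fun C p x * u x - step_fun C p x * cut_avg C u x)).
    by have := integrableB measurableT ipu ipA; apply: eq_integrable.
  have iD : mu.-integrable setT (EFin \o (fun x => `|cut_avg C u x| `^ q +
      (step_fun C p x * u x - step_fun C p x * cut_avg C u x))).
    by have := integrableD measurableT iA iB; apply: eq_integrable.
  have := le_Rintegral measurableT iD iu (fun x _ => h x).
  rewrite RintegralD//.
  by rewrite RintegralB// Epp subrr addr0.
rewrite unlock; apply: poweR_le; last by rewrite invr_ge0 ltW.
  by apply: integral_ge0 => x _; exact: poweR_ge0.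
have E (w : 'rV[R]_d -> R) : mu.-integrable setT (EFin \o (fun x => `|w x| `^ q)) ->
    (\int[mu]_x (`|(EFin \o w) x| `^ q) = (\int[mu]_x (`|w x| `^ q))%:E)%E.
  by move=> iw; rewrite /Rintegral fineK//; exact: (integrable_fin_num measurableT iw).
by rewrite !E// lee_fin.
Qed.

End averaging_Lq.

(** Expanding the square norm of [p - z] suffices: being nonnegative, it gives
    [ip z z >= 2 * ip z p - ip p p >= ip p p]. *)
Lemma Lnorm2_le_pairing d (T : measurableType d) (R : realType)
    (mu : {measure set T -> \bar R}) (p z : T -> R) :
  p \in Lfun mu 2%:E -> z \in Lfun mu 2%:E -> ip mu p p <= ip mu z p ->
  ('N[mu]_2%:E[EFin \o p] <= 'N[mu]_2%:E[EFin \o z])%E.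
Proof.
move=> p2 z2 H.
have ppzz : ip mu p p <= ip mu z z.
  have := ip_ge0 mu (p \- z); rewrite ipBl ?ipBr//; last exact: Lfun2B.
  by rewrite [ip mu p z]ipC; lra.
have fN y : y \in Lfun mu 2%:E -> ('N[mu]_2%:E[EFin \o y] \is a fin_num)%E.
  move=> y2; rewrite ge0_fin_numE ?Lnorm_ge0//.
  by move: y2; rewrite inE => /andP[_]; rewrite inE.
have := Lnorm2_ip z2; have := Lnorm2_ip p2.
rewrite -(fineK (fN _ p2)) -(fineK (fN _ z2)) !expe2 -!EFinM => -[pE] [zE].
rewrite lee_fin -ler_sqr ?nnegrE; try by apply: fine_ge0; exact: Lnorm_ge0.
by rewrite !expr2 pE zE.
Qed.

Lemma hoelder_ratio (R : realType) (q : R) : 1 < q ->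
  fine (hoelder_conjugate q%:E / q%:E)%E = (q - 1)^-1.
Proof.
move=> q1; have q0 : 0 < q by lra.
have q10 : 0 < q - 1 by lra.
have -> : hoelder_conjugate q%:E = (q / (q - 1))%:E.
  by rewrite /hoelder_conjugate /= eqe (gt_eqF q0) -EFinB inver (gt_eqF q10).
by rewrite inver (gt_eqF q0) /=; field; rewrite !gt_eqF.
Qed.

Lemma hoelder_ratio_ge0 (R : realType) (q : \bar R) : (2%:E <= q)%E ->
  0 <= fine (hoelder_conjugate q / q)%E.
Proof.
case: q => [q| |]//; last by rewrite invey mule0.
by rewrite lee_fin => q2; rewrite hoelder_ratio ?invr_ge0; lra.
Qed.

(** * Estimates of the pairing with the data *)

Section final_estimates.
Context (R : realType) (d : nat) (a l : 'rV[R]_d) (G : set (set 'rV[R]_d)).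
Hypothesis d1 : (1 <= d)%N.
Hypothesis l0 : forall i, 0 < l ord0 i.
Let Omega := hyperrect a l.
Hypothesis hG : is_grid Omega G.
Let mu : {measure set 'rV[R]_d -> \bar R} := lebesgue_on_rect a l.
Let h := mesh_size Omega G.
Variables (u : 'rV[R]_d -> R) (j : R).
Hypothesis u2 : u \in Lfun mu 2%:E.
Hypothesis j0 : 0 <= j.
Hypothesis uj : aniso_tv Omega u = j%:E.
Let w : 'rV[R]_d -> R := u \- grid_avg Omega G u.

Lemma grid_deviation_Lfun2 : w \in Lfun mu 2%:E.
Proof. by apply: Lfun2B => //; exact: grid_avg_Lfun2. Qed.

Let mw : measurable_fun setT w := Lfun_measurable grid_deviation_Lfun2.

Lemma grid_deviation_Lnorm1 : ('N[mu]_1[EFin \o w] <= (2 * h * j)%R%:E)%E.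
Proof.
have iw := Lfun2_integrable_rect l0 grid_deviation_Lfun2.
rewrite Lnorm1 -(fineK (integrable_fin_num measurableT (integrable_abse iw))) lee_fin.
exact: (grid_deviation_L1 d1 l0 hG u2 uj).
Qed.

Lemma grid_deviation_Lq (q : R) : 1 < q ->
  ('N[mu]_q%:E[EFin \o w] <= 2%:E * 'N[mu]_q%:E[EFin \o u])%E.
Proof.
move=> q1; have [Z hZ] := grid_levels hG.
have [C CE] := grid_avg_cutting l0 hG hZ.
have mu_ := Lfun_measurable u2.
have := Lfun_measurable (grid_avg_Lfun2 l0 hG u2).
rewrite /w CE; last exact: Lfun2_integrable_rect.
move=> mA; apply: (@le_trans _ _ ('N[mu]_q%:E[EFin \o u] + 'N[mu]_q%:E[EFin \o cut_avg C u])%E).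
  rewrite -[X in (_ <= _ + X)%E]oppe_Lnorm.
  apply: (@minkowski_EFin _ _ _ mu u (\- cut_avg C u) q) => //.
    exact: measurable_funN.
  exact: ltW.
rewrite (_ : 2%:E = 1 + 1)%E// ge0_muleDl// mul1e.
by apply: leeD2l; exact: Lnorm_cut_avg.
Qed.

(** The weight [r] of the L^q norm is forced by [1/q' = 1 - r + r/q], which gives
    [r = 1/(q - 1) = q'/q]. It is at most 1 because [q >= 2], and it is 0 for infinite [q]. *)
Lemma grid_pairing_le (q : \bar R) f : (2%:E <= q)%E -> f \in Lfun mu q ->
  let r := fine (hoelder_conjugate q / q)%E in
  ('N[mu]_1[EFin \o (f \* w)%R] <= 'N[mu]_q[EFin \o f] *
     ((2 * h * j) `^ (1 - r))%:E * (2%:E * 'N[mu]_q[EFin \o u]) `^ r)%E.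
Proof.
have h0 : 0 < h by exact: mesh_size_gt0.
have c0 : 0 <= 2 * h * j by rewrite !mulr_ge0// ltW.
case: q => [q| |]//; last first.
  move=> _ fy; rewrite hoelder_conjugatey invey mule0 /= subr0 powRr1// poweRe0 mule1.
  apply: le_trans (Lnorm1_mul_sup mw fy) _.
  by apply: lee_wpmul2l; [exact: Lnorm_ge0|exact: grid_deviation_Lnorm1].
rewrite lee_fin => q2 fq.
have q0 : 0 < q by lra.
have q1 : 1 < q by lra.
have q10 : 0 < q - 1 by lra.
rewrite hoelder_ratio//.
set r := (q - 1)^-1 => /=.
have r0 : 0 < r by rewrite invr_gt0.
have r1 : r <= 1 by rewrite invf_le1//; lra.
pose q' := q / (q - 1).
have q'0 : 0 < q' by rewrite divr_gt0.
have mf := Lfun_measurable fq.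
have H := @hoelder _ _ _ mu f w q q' mf mw q0 q'0.
apply: le_trans (H _) _.
  by rewrite /q'; field; rewrite !gt_eqF.
rewrite -muleA; apply: lee_wpmul2l; first exact: Lnorm_ge0.
have wr : ('N[mu]_q%:E[EFin \o w] `^ r <= (2%:E * 'N[mu]_q%:E[EFin \o u]) `^ r)%E.
  by apply: poweR_le; [exact: Lnorm_ge0|exact: grid_deviation_Lq|exact: ltW].
apply: (@le_trans _ _ ('N[mu]_1[EFin \o w] `^ (1 - r) * 'N[mu]_q%:E[EFin \o w] `^ r)%E).
  (* The interpolation inequality requires a weight below 1; weight 1 means [q = q' = 2], where both
     sides coincide. *)
  move: r1; rewrite le_eqVlt => /predU1P[r1|r1].
    have qE : q = 2.
      have : q - 1 = 1 by rewrite -[LHS]invrK -/r r1 invr1.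
      by lra.
    rewrite r1 subrr poweRe0 mul1e poweRe1 ?Lnorm_ge0// /q' qE.
    by rewrite (_ : 2 / (2 - 1) = 2)//; field.
  apply: Lnorm_interpolation => //; first by rewrite r0.
  rewrite /q' /r; field.
  by rewrite !gt_eqF.
apply: lee_pmul => //; try exact: poweR_ge0.
rewrite -poweR_EFin; apply: poweR_le; [exact: Lnorm_ge0|exact: grid_deviation_Lnorm1|].
by rewrite subr_ge0.
Qed.

(** The sup bound replaces the L^q norm of [w]: its L^q' norm is at most [(2 h j * j^(q' -
    1))^(1/q') = (2 h)^(1/q') j], and [2^(1/q') <= 2]. *)
Lemma grid_pairing_le_dim1 (q : \bar R) f : d = 1%N -> (2%:E <= q)%E -> f \in Lfun mu q ->
  ('N[mu]_1[EFin \o (f \* w)%R] <=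
   'N[mu]_q[EFin \o f] * (2 * j * h `^ (1 - fine q^-1%E))%R%:E)%E.
Proof.
move=> dd; have h0 : 0 < h by exact: mesh_size_gt0.
have c0 : 0 <= 2 * h * j by rewrite !mulr_ge0// ltW.
case: q => [q| |]//; last first.
  move=> _ fy; rewrite invey /= subr0 powRr1; last exact: ltW.
  apply: le_trans (Lnorm1_mul_sup mw fy) _.
  apply: lee_wpmul2l; first exact: Lnorm_ge0.
  by rewrite mulrAC; exact: grid_deviation_Lnorm1.
rewrite lee_fin => q2 fq.
have q0 : 0 < q by lra.
have q10 : 0 < q - 1 by lra.
pose q' := q / (q - 1).
have q'0 : 0 < q' by rewrite divr_gt0.
have mf := Lfun_measurable fq.
have H := @hoelder _ _ _ mu f w q q' mf mw q0 q'0.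
apply: le_trans (H _) _.
  by rewrite /q'; field; rewrite !gt_eqF.
apply: lee_wpmul2l; first exact: Lnorm_ge0.
have q'1 : 1 <= q' by rewrite /q' ler_pdivlMr// mul1r; lra.
have := Lnorm_le_bound mw q'1 j0 (grid_deviation_sup d1 l0 hG u2 uj dd) grid_deviation_Lnorm1.
move=> /le_trans; apply; rewrite lee_fin.
have qV : q'^-1 = 1 - q^-1 by rewrite /q'; field; rewrite !gt_eqF.
have -> : fine (q%:E)^-1%E = q^-1 by rewrite inver gt_eqF.
rewrite -qV.
have -> : 2 * h * j * j `^ (q' - 1) = 2 * h * j `^ q'.
  have [->|jN] := eqVneq j 0; first by rewrite mulr0 mul0r powR0 ?mulr0// gt_eqF.
  rewrite -mulrA -[X in X * _ `^ _]powRr1// -powRD ?jN ?implybT//.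
  by rewrite addrC subrK.
rewrite !powRM ?mulr_ge0 ?powR_ge0//; try exact: ltW.
rewrite -powRrM mulfV ?gt_eqF// powRr1//.
rewrite mulrAC; apply: ler_wpM2r; first exact: powR_ge0.
apply: ler_wpM2r => //; rewrite -[leRHS]powRr1//; apply: ler_powR; first by lra.
by rewrite invf_le1.
Qed.

End final_estimates.

Theorem theorem5p3 (R : realType) (d : nat) (hd : (1 <= d)%N)
    (a l : 'rV[R]_d) (hl : forall i, 0 < l ord0 i)
    (alpha : R) (halpha : 0 < alpha)
    (G : set (set 'rV[R]_d)) (hG : is_grid (hyperrect a l) G) :
  let Omega := hyperrect a l in
  let mu : {measure set 'rV[R]_d -> \bar R} := lebesgue_on_rect a l in
  let J := aniso_tv Omega in
  let A := grid_avg Omega G in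
  let h := mesh_size Omega G in
  (forall f uf uAf : 'rV[R]_d -> R,
     f \in Lfun mu 2%:E ->
     rof_minimizer a l alpha f uf ->
     rof_minimizer a l alpha (A f) uAf ->
     ('N[mu]_2%:E[EFin \o (uAf \- uf)%R]
        <= 'N[mu]_2%:E[EFin \o (A f \- f)%R])%E) /\
  (forall (q : \bar R) (f uf uAf : 'rV[R]_d -> R),
     (2%:E <= q)%E ->
     f \in Lfun mu q ->
     rof_minimizer a l alpha f uf ->
     rof_minimizer a l alpha (A f) uAf ->
     let r := fine (hoelder_conjugate q / q)%E in
     ('N[mu]_2%:E[EFin \o (uAf \- uf)%R] ^+ 2
        <= (2 `^ (1 + r))%:E * (J uf `^ (1 - r))
           * ('N[mu]_q[EFin \o uf] `^ r)
           * ('N[mu]_q[EFin \o uf] + 'N[mu]_q[EFin \o f])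
           * (h `^ (1 - r))%:E)%E /\
     (d = 1%N ->
      ('N[mu]_2%:E[EFin \o (uAf \- uf)%R] ^+ 2
        <= 2%:E * J uf
           * ('N[mu]_q[EFin \o uf] + 'N[mu]_q[EFin \o f])
           * (h `^ (1 - fine q^-1%E)%R)%:E)%E)).
Proof.
move=> Omega mu J A h; split.
  move=> f u v f2 um vm; have [u2 _] := um; have [v2 _] := vm.
  have Af2 := grid_avg_Lfun2 hl hG f2.
  have vu2 := Lfun2B v2 u2; have Aff2 := Lfun2B Af2 f2.
  have H := rof_contraction hl halpha f2 Af2 um vm.
  by apply: Lnorm2_le_pairing.
move=> q f u v q2 fq um vm r.
have mufin : mu setT \is a fin_num by exact: rect_measure_fin.
have q1 : (1 <= q)%E by apply: le_trans q2; rewrite lee_fin; lra.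
have f2 : f \in Lfun mu 2%:E by apply: (Lfun_subset _ q1 mufin q2 fq); rewrite lee_fin; lra.
have [u2 _] := um; have [v2 _] := vm.
have [j j0 uj] := rof_minimizer_tv halpha f2 um.
have h0 : 0 < h by exact: mesh_size_gt0.
have w2 := grid_deviation_Lfun2 hl hG u2.
have main : ('N[mu]_2%:E[EFin \o (v \- u)%R] ^+ 2 <=
    'N[mu]_1[EFin \o (f \* (u \- A u))%R])%E.
  rewrite Lnorm2_ip; last exact: Lfun2B.
  apply: le_trans (ip_le_Lnorm1 f2 w2); rewrite lee_fin.
  exact: (rof_averaging hl hG halpha f2 um vm).
have U0 : (0 <= 'N[mu]_q[EFin \o u])%E by exact: Lnorm_ge0.
have F0 : (0 <= 'N[mu]_q[EFin \o f])%E by exact: Lnorm_ge0.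
have FUF : ('N[mu]_q[EFin \o f] <= 'N[mu]_q[EFin \o u] + 'N[mu]_q[EFin \o f])%E.
  by apply: leeDr.
split.
  apply: (le_trans main); apply: le_trans (grid_pairing_le hd hl hG u2 j0 uj q2 fq) _.
  rewrite -/mu -/h -/r [J u]uj poweR_EFin poweRM// poweR_EFin.
  rewrite !powRM ?mulr_ge0//; try exact: ltW.
  set F := 'N[mu]_q[EFin \o f]%E in F0 FUF *; set U := 'N[mu]_q[EFin \o u]%E in U0 FUF *.
  have -> (c c' X Y : \bar R) : (X * c * (c' * Y) = c * c' * Y * X)%E.
    by rewrite [(X * c)%E]muleC -muleA [(X * (_ * _))%E]muleC !muleA.
  rewrite [leRHS]muleAC [X in (_ <= X * _)%E]muleAC -!EFinM.
  (* The L^1 bound contributes [2^(1 - r)] and the L^q bound [2^r]. Their product 2 is at most the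
     stated [2^(1 + r)] because [r >= 0]. *)
  have cc : 2 `^ (1 - r) * h `^ (1 - r) * j `^ (1 - r) * 2 `^ r <=
      2 `^ (1 + r) * j `^ (1 - r) * h `^ (1 - r).
    have -> : 2 `^ (1 - r) * h `^ (1 - r) * j `^ (1 - r) * 2 `^ r =
        2 `^ (1 - r) * 2 `^ r * (j `^ (1 - r) * h `^ (1 - r)) by ring.
    rewrite -[leRHS]mulrA; apply: ler_wpM2r; first by rewrite mulr_ge0// powR_ge0.
    rewrite -powRD ?pnatr_eq0 ?implybT// subrK ler_powR//; first by lra.
    by rewrite lerDl; exact: hoelder_ratio_ge0.
  have Ur0 : (0 <= U `^ r)%E by exact: poweR_ge0.
  apply: lee_pmul => //.
  - by apply: mule_ge0 => //; rewrite lee_fin !mulr_ge0// powR_ge0.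
  - by apply: lee_wpmul2r => //; rewrite lee_fin.
move=> dd; apply: (le_trans main).
apply: le_trans (grid_pairing_le_dim1 hd hl hG u2 j0 uj dd q2 fq) _.
rewrite -/mu -/h [J u]uj muleC -muleA [X in (_ <= _ * X)%E]muleC muleA -!EFinM.
by apply: lee_wpmul2l => //; rewrite lee_fin !mulr_ge0// powR_ge0.
Qed.
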